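(* Let $V$ and $W$ be compact manifolds of dimensions $v,w\geq 3$, with Yamabe metrics $g$ on $V$ and $h$ on $W$ such that $\mu(V,g)>0$ and $\mu(W,h)>0$. Put $$\varepsilon_{v,w}=\frac{a_{v+w}}{a_v^{\,v/(v+w)}\,a_w^{\,w/(v+w)}}.$$ Then $$\varepsilon_{v,w}\;\leq\;\frac{\inf_{\lambda\in(0,\infty)}\mu(V\times W,\,g+\lambda h)}{(v+w)\left(\frac{\mu(V,g)}{v}\right)^{\frac{v}{v+w}}\left(\frac{\mu(W,h)}{w}\right)^{\frac{w}{v+w}}}\;\leq\;1 .$$
   Context: For an integer $n\geq 3$ set $a_n=\frac{4(n-1)}{n-2}$ and $p_n=\frac{2n}{n-2}$. Manifolds are without boundary. For a Riemannian manifold $(N,k)$ of dimension $n\geq 3$ with scalar curvature $s^k$ and volume measure $dv^k$, the conformal Yamabe constant is $$\mu(N,k)=\inf_{u\in C_c^\infty(N),\,u\not\equiv 0}\ \frac{\int_N\left(a_n|du|_k^2+s^k u^2\right)dv^k}{\left(\int_N|u|^{p_n}\,dv^k\right)^{2/p_n}}.$$ For compact $N$, the normalized Einstein-Hilbert functional is $\mathcal{E}(k)=\frac{\int_N s^k\,dv^k}{\mathrm{vol}^k(N)^{(n-2)/n}}$. A metric $k$ on a compact manifold $N$ is called a Yamabe metric if it minimizes $\mathcal{E}$ within its conformal class $[k]$, i.e. $\mathcal{E}(k)=\mu(N,k)$; Yamabe metrics have constant scalar curvature. *)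

(* Defs.v *)
From HB Require Import structures.
From mathcomp Require Import all_boot all_order all_algebra.
From mathcomp Require Import all_classical all_reals all_analysis.

Set Implicit Arguments.
Unset Strict Implicit.
Unset Printing Implicit Defensive.

Import Order.TTheory GRing.Theory Num.Theory.
Import numFieldNormedType.Exports.

Local Open Scope classical_set_scope.
Local Open Scope ring_scope.

HB.instance Definition _ (T U : ptopologicalType) := Pointed.on (T * U)%type.

Notation borel T := (g_sigma_algebraType (@open T)).

Section Euclidean.
Context {R : realType}.

Definition partial n (a : 'I_n) (f : 'rV[R]_n -> R) : 'rV[R]_n -> R :=
  fun x => 'D_(delta_mx 0 a) f x.

Fixpoint smooth_upto n (k : nat) (U : set 'rV[R]_n) (f : 'rV[R]_n -> R) : Prop :=
  {in U, continuous f} /\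
  if k is k'.+1 then
    forall a : 'I_n, {in U, forall x, derivable f x (delta_mx 0 a)} /\
                     smooth_upto k' U (partial a f)
  else True.

(* Meaningful for open U only. *)
Definition smooth_on n (U : set 'rV[R]_n) (f : 'rV[R]_n -> R) : Prop :=
  forall k, smooth_upto k U f.

(* By Tonelli, for a nonnegative Borel function this iterated integral is the
   integral with respect to n-dimensional Lebesgue measure. *)
Fixpoint integral_rV n : ('rV[R]_n -> \bar R) -> \bar R :=
  match n with
  | 0 => fun f => f 0
  | m.+1 => fun f =>
      (\int[lebesgue_measure]_(t in [set: R])
         integral_rV (fun y : 'rV[R]_m => f (row_mx (const_mx t : 'rV_1) y)))%E
  end.

End Euclidean.

(* The charts form an arbitrary smooth atlas, not necessarily maximal.  The
   inverse [chart_inv i] of [chart i] is relevant on [chart i @` chart_dom i] only. *)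
Record manifold (R : realType) (n : nat) := Manifold {
  carrier :> ptopologicalType;
  chart_index : Type;
  chart_dom : chart_index -> set carrier;
  chart : chart_index -> carrier -> 'rV[R]_n;
  chart_inv : chart_index -> 'rV[R]_n -> carrier;
  manifold_hausdorff : hausdorff_space carrier;
  manifold_second_countable : @second_countable carrier;
  open_chart_dom : forall i, open (chart_dom i);
  chart_dom_cover : forall p, exists i, chart_dom i p;
  open_chart_image : forall i, open (chart i @` chart_dom i);
  chartK : forall i, {in chart_dom i, cancel (chart i) (chart_inv i)};
  chart_continuous : forall i, {in chart_dom i, continuous (chart i)};
  chart_inv_continuous : forall i, {in chart i @` chart_dom i, continuous (chart_inv i)};
  transition_smooth : forall i j (a : 'I_n),
    smooth_on (chart i @` (chart_dom i `&` chart_dom j))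
      (fun x => chart j (chart_inv i x) 0 a)
}.

Arguments chart_index {R n} m : rename.
Arguments chart_dom {R n m} i : rename.
Arguments chart {R n m} i p : rename.
Arguments chart_inv {R n m} i x : rename.

(* A covariant 2-tensor field, given by its matrix in each chart. *)
Definition tensor (R : realType) n (M : manifold R n) :=
  chart_index M -> 'rV[R]_n -> 'M[R]_n.

Section Riemannian.
Context {R : realType} {n : nat} {M : manifold R n}.

Definition chart_image (i : chart_index M) : set 'rV[R]_n := chart i @` chart_dom i.

Definition smooth (u : M -> R) : Prop :=
  forall i : chart_index M, smooth_on (chart_image i) (u \o chart_inv i).

Definition compactly_supported (u : M -> R) : Prop :=
  compact (closure [set p | u p != 0]).

(* The function on M whose expression in every chart i is [f i]; it is unique,
   and it exists when the [f i] are compatible with the changes of charts. *)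
Definition glue (f : chart_index M -> 'rV[R]_n -> R) : M -> R :=
  xget (cst 0) [set s : M -> R | forall i p, chart_dom i p -> s p = f i (chart i p)].

Implicit Type g : tensor M.

Definition riemannian_metric g : Prop :=
  [/\ forall i a b, smooth_on (chart_image i) (fun x => g i x a b),
      forall i x, chart_image i x -> (g i x)^T = g i x,
      forall i x, chart_image i x ->
        forall y : 'rV[R]_n, y != 0 -> 0 < (y *m g i x *m y^T) 0 0 &
      forall i j x, (chart i @` (chart_dom i `&` chart_dom j)) x ->
        let J := jacobian (chart j \o chart_inv i) x in
        g i x = J *m g j (chart j (chart_inv i x)) *m J^T].

(* |du|^2 = g^{ab} d_a u d_b u *)
Definition grad_sq g (u : M -> R) : M -> R :=
  glue (fun i x => \sum_a \sum_b
    invmx (g i x) a b * partial a (u \o chart_inv i) x * partial b (u \o chart_inv i) x).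

(* Gamma^c_{ab} *)
Definition christoffel (G : 'rV[R]_n -> 'M[R]_n) (c a b : 'I_n)
    (x : 'rV[R]_n) : R :=
  2^-1 * \sum_d invmx (G x) c d *
    (partial a (fun y => G y b d) x + partial b (fun y => G y a d) x
     - partial d (fun y => G y a b) x).

(* R_{ab} = d_c Gamma^c_{ab} - d_b Gamma^c_{ac}
            + Gamma^c_{cd} Gamma^d_{ab} - Gamma^c_{bd} Gamma^d_{ac} *)
Definition ricci (G : 'rV[R]_n -> 'M[R]_n) (a b : 'I_n) (x : 'rV[R]_n) : R :=
  let Gam := christoffel G in
  \sum_c (partial c (Gam c a b) x - partial b (Gam c a c) x
    + \sum_d (Gam c c d x * Gam d a b x - Gam c b d x * Gam d a c x)).

Definition scalar_curvature g : M -> R :=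
  glue (fun i x => \sum_a \sum_b invmx (g i x) a b * ricci (g i) a b x).

Definition is_volume g (m : {measure set (borel M) -> \bar R}) : Prop :=
  forall i (A : set (borel M)), measurable A -> A `<=` chart_dom i ->
    m A = integral_rV (fun x =>
            (\1_(chart i @` A) x * Num.sqrt (\det (g i x)))%:E).

(* A Riemannian metric has exactly one such measure; mzero is a junk value. *)
Definition volume g : {measure set (borel M) -> \bar R} :=
  if pselect (exists m, is_volume g m) is left e then projT1 (cid e) else mzero.

Definition a_ (k : nat) : R := 4 * (k%:R - 1) / (k%:R - 2).
Definition p_ (k : nat) : R := 2 * k%:R / (k%:R - 2).

Definition yamabe_quotient g (u : M -> R) : R :=
  (\int[volume g]_x (a_ n * grad_sq g u x + scalar_curvature g x * u x ^+ 2))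
  / (\int[volume g]_x (`|u x| `^ p_ n)) `^ (2 / p_ n).

Definition yamabe_constant g : \bar R :=
  ereal_inf [set (yamabe_quotient g u)%:E | u in
    [set u : M -> R | [/\ smooth u, compactly_supported u & exists x, u x != 0]]].

Definition einstein_hilbert g : R :=
  (\int[volume g]_x scalar_curvature g x)
  / fine (volume g [set: M]) `^ ((n%:R - 2) / n%:R).

(* On a compact manifold yamabe_quotient g u = einstein_hilbert (u^{4/(n-2)} g)
   for smooth u > 0, and such u suffice to compute the infimum, so the equation
   says that g minimizes einstein_hilbert in its conformal class. *)
Definition yamabe_metric g : Prop :=
  riemannian_metric g /\ (einstein_hilbert g)%:E = yamabe_constant g.

End Riemannian.

Section Product.
Context {R : realType}.

Lemma hausdorff_prod (T U : topologicalType) :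
  hausdorff_space T -> hausdorff_space U -> hausdorff_space (T * U)%type.
Proof.
move=> hT hU p q pq.
have H A B : nbhs p.1 A -> nbhs q.1 B -> A `&` B !=set0.
  move=> pA qB.
  have [|| z [/= zA zB]] := pq (A `*` setT) (B `*` setT).
  - by exists (A, setT) => //=; split=> //; exact: filterT.
  - by exists (B, setT) => //=; split=> //; exact: filterT.
  by exists z.1; case: zA; case: zB.
have H' A B : nbhs p.2 A -> nbhs q.2 B -> A `&` B !=set0.
  move=> pA qB.
  have [|| z [/= zA zB]] := pq (setT `*` A) (setT `*` B).
  - by exists (setT, A) => //=; split=> //; exact: filterT.
  - by exists (setT, B) => //=; split=> //; exact: filterT.
  by exists z.2; case: zA; case: zB.
rewrite (surjective_pairing p) (surjective_pairing q).
by rewrite (hT _ _ H) (hU _ _ H').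
Qed.

Lemma open_setX (T U : topologicalType) (A : set T) (B : set U) :
  open A -> open B -> open (A `*` B).
Proof.
move=> oA oB; rewrite openE => -[a b] [/= Aa Bb].
by exists (A, B) => //=; split; exact: open_nbhs_nbhs.
Qed.

Lemma second_countable_prod (T U : topologicalType) :
  @second_countable T -> @second_countable U -> @second_countable (T * U)%type.
Proof.
move=> [A cA [oA bA]] [B cB [oB bB]].
exists [set X | exists2 ab, (A `*` B) ab & X = ab.1 `*` ab.2].
  have -> : [set X : set (T * U) | exists2 ab, (A `*` B) ab & X = ab.1 `*` ab.2] =
      (fun ab : set T * set U => ab.1 `*` ab.2) @` (A `*` B).
    by apply/seteqP; split=> X /=; [move=> [ab ? ->]|move=> [ab ? <-]]; exists ab.
  by apply: (card_le_trans (card_image_le _ _)); exact: countableX.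
split=> [X [[a b] [/= Aa Bb] ->]|[x y] X [[P Q] /= [xP yQ] sPQ]].
  by apply: open_setX; [exact: oA|exact: oB].
have [a [Aa ax] aP] := bA _ _ xP.
have [b [Bb yb] bQ] := bB _ _ yQ.
exists (a `*` b); first by split=> //; exists (a, b).
by move=> z [/= z1 z2]; apply: sPQ; split; [exact: aP|exact: bQ].
Qed.

Lemma row_mx_continuous (T : topologicalType) m n (p : T)
    (f : T -> 'rV[R]_m) (g : T -> 'rV[R]_n) :
  {for p, continuous f} -> {for p, continuous g} ->
  {for p, continuous (fun q => row_mx (f q) (g q))}.
Proof.
move=> cf cg A [P nP sPA].
have nearP : \forall q \near p, forall i j, P i j (row_mx (f q) (g q) i j).
  near=> q; move=> i j; move: i j; near: q.
  apply: filter_forall => i; apply: filter_forall => j.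
  have := nP i j; rewrite -(splitK j); case: (fintype.split j) => k /=.
    rewrite row_mxEl => nPk; near do rewrite row_mxEl.
    have := cf _ (@coord_continuous _ _ _ i k _ _ nPk); exact.
  rewrite row_mxEr => nPk; near do rewrite row_mxEr.
  have := cg _ (@coord_continuous _ _ _ i k _ _ nPk); exact.
by apply: filterS nearP => q; exact: sPA.
Unshelve. all: by end_near. Qed.

Lemma smooth_uptoS n k (U V : set 'rV[R]_n) f :
  V `<=` U -> smooth_upto k U f -> smooth_upto k V f.
Proof.
elim: k U V f => [|k IH] U V f sVU /= [cf H].
  split=> // x /set_mem /sVU /mem_set; exact: cf.
split; first by move=> x /set_mem /sVU /mem_set; exact: cf.
move=> a; have [df sf] := H a; split; last exact: IH sf.
by move=> x /set_mem /sVU /mem_set; exact: df.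
Qed.

Lemma smooth_upto_cst n k (U : set 'rV[R]_n) (c : R) :
  smooth_upto k U (fun=> c).
Proof.
elim: k U c => [|k IH] U c /=; first by split=> // x _; exact: cst_continuous.
split=> [x _|a]; first exact: cst_continuous.
split=> [x _|]; first exact: derivable_cst.
have -> : partial a (fun _ : 'rV[R]_n => c) = fun=> 0.
  by apply/funext => x; rewrite /partial derive_cst.
exact: IH.
Qed.

Lemma smooth_upto_comp m n k (L : {linear 'rV[R]_m -> 'rV[R]_n}) U f :
  continuous L ->
  (forall a, L (delta_mx 0 a) = 0 \/ exists b, L (delta_mx 0 a) = delta_mx 0 b) ->
  smooth_upto k U f -> smooth_upto k (L @^-1` U) (f \o L).
Proof.
move=> cL hL; elim: k U f => [|k IH] U f /= [cf H].
  split=> // x /set_mem /mem_set Ux.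
  by apply: continuous_comp; [exact: cL|exact: cf].
split=> [x /set_mem /mem_set Ux|a].
  by apply: continuous_comp; [exact: cL|exact: cf].
have E x v : (fun h : R => h^-1 *: (((f \o L) \o shift x) (h *: v) - (f \o L) x)) =
    (fun h : R => h^-1 *: ((f \o shift (L x)) (h *: L v) - f (L x))).
  by apply/funext => h; rewrite /comp/shift (linearP L).
have [La0|[b Lab]] := hL a.
  have E0 x : (fun h : R => h^-1 *: (((f \o L) \o shift x) (h *: delta_mx 0 a) - (f \o L) x)) =
    (fun=> 0).
    by rewrite E La0; apply/funext => h /=; rewrite scaler0 add0r subrr scaler0.
  split=> [x _|]; first by rewrite /derivable E0; exact: is_cvg_cst.
  have -> : partial a (f \o L) = fun=> 0.
    by apply/funext => x; rewrite /partial /derive E0 lim_cst.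
  exact: smooth_upto_cst.
have [df sf] := H b; split=> [x /set_mem /mem_set Ux|].
  by rewrite /derivable E Lab; exact: df.
have -> : partial a (f \o L) = partial b f \o L.
  by apply/funext => x; rewrite /partial /derive E Lab.
exact: IH.
Qed.

Lemma lsubmx_delta m n (a : 'I_(m + n)) :
  lsubmx (delta_mx 0 a : 'rV[R]_(m + n)) = 0 \/
  exists b, lsubmx (delta_mx 0 a : 'rV[R]_(m + n)) = delta_mx 0 b.
Proof.
rewrite -(splitK a); case: (fintype.split a) => k /=; [right; exists k|left];
  apply/rowP => j; rewrite !mxE/=.
  by rewrite eq_lshift.
by rewrite eq_lrshift.
Qed.

Lemma rsubmx_delta m n (a : 'I_(m + n)) :
  rsubmx (delta_mx 0 a : 'rV[R]_(m + n)) = 0 \/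
  exists b, rsubmx (delta_mx 0 a : 'rV[R]_(m + n)) = delta_mx 0 b.
Proof.
rewrite -(splitK a); case: (fintype.split a) => k /=; [left|right; exists k];
  apply/rowP => j; rewrite !mxE/=.
  by rewrite eq_rlshift.
by rewrite eq_rshift.
Qed.

Context {v w : nat} (V : manifold R v) (W : manifold R w).

Let pdom (i : chart_index V * chart_index W) : set (V * W)%type := chart_dom i.1 `*` chart_dom i.2.
Let pchart (i : chart_index V * chart_index W) (p : (V * W)%type) : 'rV[R]_(v + w) :=
  row_mx (chart i.1 p.1) (chart i.2 p.2).
Let pparam (i : chart_index V * chart_index W) (z : 'rV[R]_(v + w)) : (V * W)%type :=
  (chart_inv i.1 (lsubmx z), chart_inv i.2 (rsubmx z)).

Let pimage i : pchart i @` pdom i =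
  lsubmx @^-1` (chart i.1 @` chart_dom i.1) `&` rsubmx @^-1` (chart i.2 @` chart_dom i.2).
Proof.
apply/seteqP; split=> [z [p [p1 p2] <-]|z [[p p1 pz] [q q2 qz]]].
  split; rewrite /= /pchart ?row_mxKl ?row_mxKr.
    by exists p.1.
  by exists p.2.
by exists (p, q) => //; rewrite /pchart pz qz hsubmxK.
Qed.

Let popen_dom i : open (pdom i).
Proof. by apply: open_setX; exact: open_chart_dom. Qed.

Let pdom_cover p : exists i, pdom i p.
Proof.
have [i ip] := chart_dom_cover p.1; have [j jp] := chart_dom_cover p.2.
by exists (i, j).
Qed.

Let popen_image i : open (pchart i @` pdom i).
Proof.
rewrite pimage; apply: openI.
  apply: open_comp => [x _|]; first exact: continuous_lsubmx.
  exact: open_chart_image.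
apply: open_comp => [x _|]; first exact: continuous_rsubmx.
exact: open_chart_image.
Qed.

Let pchartK i : {in pdom i, cancel (pchart i) (pparam i)}.
Proof.
move=> [p q] /set_mem[/= ip iq].
by rewrite /pparam /pchart row_mxKl row_mxKr !chartK ?inE.
Qed.

Let pchart_continuous i : {in pdom i, continuous (pchart i)}.
Proof.
move=> [p q] /set_mem[/= ip iq].
apply: (@row_mx_continuous _ _ _ (p, q) (chart i.1 \o fst) (chart i.2 \o snd)).
  apply: continuous_comp; first exact: cvg_fst.
  by apply: chart_continuous; rewrite inE.
apply: continuous_comp; first exact: cvg_snd.
by apply: chart_continuous; rewrite inE.
Qed.

Let pparam_continuous i : {in pchart i @` pdom i, continuous (pparam i)}.
Proof.
move=> z; rewrite pimage inE => -[/= z1 z2].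
have cl : {for z, continuous (chart_inv i.1 \o lsubmx)}.
  apply: continuous_comp; first exact: continuous_lsubmx.
  by apply: chart_inv_continuous; rewrite inE.
have cr : {for z, continuous (chart_inv i.2 \o rsubmx)}.
  apply: continuous_comp; first exact: continuous_rsubmx.
  by apply: chart_inv_continuous; rewrite inE.
exact: cvg_pair cl cr.
Qed.

Let ptransition_smooth i j a :
  smooth_on (pchart i @` (pdom i `&` pdom j)) (fun x => pchart j (pparam i x) 0 a).
Proof.
move=> k; rewrite -(splitK a); case: (fintype.split a) => b /=.
  have -> : (fun x => pchart j (pparam i x) 0 (lshift w b)) =
      (fun x => chart j.1 (chart_inv i.1 x) 0 b) \o lsubmx.
    by apply/funext => x; rewrite /pchart row_mxEl.
  apply: (@smooth_uptoS _ _ (lsubmx @^-1` (chart i.1 @` (chart_dom i.1 `&` chart_dom j.1)))).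
    move=> z [p [[p1 p2] [q1 q2]] <-]; rewrite /= /pchart row_mxKl.
    by exists p.1.
  apply: smooth_upto_comp; last exact: transition_smooth.
    exact: continuous_lsubmx.
  exact: lsubmx_delta.
have -> : (fun x => pchart j (pparam i x) 0 (rshift v b)) =
    (fun x => chart j.2 (chart_inv i.2 x) 0 b) \o rsubmx.
  by apply/funext => x; rewrite /pchart row_mxEr.
apply: (@smooth_uptoS _ _ (rsubmx @^-1` (chart i.2 @` (chart_dom i.2 `&` chart_dom j.2)))).
  move=> z [p [[p1 p2] [q1 q2]] <-]; rewrite /= /pchart row_mxKr.
  by exists p.2.
apply: smooth_upto_comp; last exact: transition_smooth.
  exact: continuous_rsubmx.
exact: rsubmx_delta.
Qed.

Definition prod_manifold : manifold R (v + w) :=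
  @Manifold R (v + w) (V * W)%type (chart_index V * chart_index W)%type
    pdom pchart pparam
    (hausdorff_prod (@manifold_hausdorff _ _ V) (@manifold_hausdorff _ _ W))
    (second_countable_prod (@manifold_second_countable _ _ V)
       (@manifold_second_countable _ _ W))
    popen_dom pdom_cover popen_image pchartK pchart_continuous
    pparam_continuous ptransition_smooth.

Definition prod_metric (g : tensor V) (h : tensor W) : tensor prod_manifold :=
  fun i z => block_mx (g i.1 (lsubmx z)) 0 0 (h i.2 (rsubmx z)).

End Product.

Definition scale_metric (R : realType) n (M : manifold R n)
    (lam : R) (h : tensor M) : tensor M :=
  fun i x => lam *: h i x.

Definition eps_ (R : realType) (v w : nat) : R :=
  a_ (v + w) / (a_ v `^ (v%:R / (v + w)%:R) * a_ w `^ (w%:R / (v + w)%:R)).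

(* Main.v *)
(** Put [K = (v + w) (mu(V, g) / v)^(v / (v + w)) (mu(W, h) / w)^(w / (v + w))].

    Lower bound: since [a_(v+w) <= min(a_v, a_w)] and the scalar curvatures have positive mean, the
    energy of [u] on the product is at least [a_(v+w) / a_v] times the integral over [W] of the
    energies of the slices [u (-, y)] plus [a_(v+w) / a_w] times the integral over [V] of those of
    [u (x, -)].  The Yamabe inequality on each slice bounds these by mixed [L^2(L^p)] norms of [u].
    Weighted AM-GM turns the sum into a product of powers, and Hoelder's and Minkowski's
    inequalities bound the product of the two mixed norms below by the [L^p_(v+w)] norm.  As
    [mu(W, h)] is scale invariant, the bound [eps_(v,w) K] does not depend on [lambda].

    Upper bound: choose [lambda] with [s_g / v = s_(lambda h) / w]; the test function 1 on the
    product has quotient exactly [K].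

    The totalized notions (glued scalar curvature, volume measure, [fine]) take the junk value 0
    when ill-defined; this would make the Einstein-Hilbert functional 0, so positivity of the Yamabe
    constants rules it out.  Constancy of the scalar curvature of a Yamabe metric is not assumed: it
    is proved almost everywhere from the first variation of the Yamabe quotient at [u = 1]. *)

Require Import Defs.
From HB Require Import structures.
From mathcomp Require Import all_boot all_order all_algebra.
From mathcomp Require Import all_classical all_reals all_analysis.
From mathcomp Require Import measurable_realfun ring lra.
Import Defs.

Set Implicit Arguments.
Unset Strict Implicit.
Unset Printing Implicit Defensive.

Import Order.TTheory GRing.Theory Num.Theory.
Import numFieldNormedType.Exports.

Local Open Scope classical_set_scope.
Local Open Scope ring_scope.

(** * Differential calculus on row vectors *)

Section calculus.
Context {R : realType}.

(** Dividing by [v] and [w] in [K] is the normalisation of weighted AM-GM whose equality case is the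
    condition on lambda in the upper bound. The factor [eps_] is the weighted geometric mean of
    [a_ (v + w) / a_ v] and [a_ (v + w) / a_ w], the losses in comparing the gradient terms of the
    product with those of the slices.

    Most of the work links slices to the product. [volume] is picked by choice, so the volume of the
    product is identified by uniqueness, checked on finitely many charts. [integral_rV] is an
    iterated integral and has to be realised by a measure. Product measures live on the product
    sigma-algebra, which second countability compares with the Borel sets. The scalar curvature is
    glued from charts: once its chart expressions are compatible for [g] and [h], those of the
    scaled and product metrics are computed from them. By compactness the integrands on the
    manifolds are bounded on finite measure spaces, which settles integrability throughout. *)

Lemma rV_coord_norm n (h : 'rV[R]_n) i : `|h 0 i| <= `|h|.
Proof. by rewrite /Num.norm /= mx_normrE; exact: (le_bigmax _ (fun ij => `|h ij.1 ij.2|) (0, i)). Qed.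

Lemma rV_norm_le n (h : 'rV[R]_n) (b : R) : 0 <= b -> (forall i, `|h 0 i| <= b) -> `|h| <= b.
Proof.
move=> b0 hb; rewrite /Num.norm /= mx_normrE; apply: bigmax_le => // -[i j] _ /=.
by rewrite ord1.
Qed.

(** Along the line through [y] the difference quotients of [f] are those of a function of one
    variable, to which the mean value theorem applies. The sign of [s] is arbitrary, hence the bound
    on the absolute value of [c]. *)
Lemma mvt_partial n (f : 'rV[R]_n -> R) (a : 'I_n) y (s : R) :
  (forall t, `|t| <= `|s| -> derivable f (t *: delta_mx 0 a + y) (delta_mx 0 a)) ->
  exists2 c, `|c| <= `|s| &
    f (s *: delta_mx 0 a + y) - f y = s * partial a f (c *: delta_mx 0 a + y).
Proof.
set e := delta_mx 0 a => df.
pose phi (t : R) := f (t *: e + y).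
have E t : (fun h : R => h^-1 *: ((phi \o shift t) (h *: 1) - phi t)) =
    (fun h : R => h^-1 *: ((f \o shift (t *: e + y)) (h *: e) - f (t *: e + y))).
  apply/funext => h; rewrite /phi /= addrA -scalerDl.
  by rewrite [h *: 1]mulr1.
have dphi t : `|t| <= `|s| -> is_derive t (1 : R) phi (partial a f (t *: e + y)).
  move=> ts; apply: DeriveDef; last by rewrite /partial /derive E.
  by rewrite /derivable E; exact: df.
have cphi t : `|t| <= `|s| -> {for t, continuous phi}.
  by move=> /dphi[/derivable1_diffP dd _]; exact: differentiable_continuous.
have phi0 : phi 0 = f y by rewrite /phi scale0r add0r.
have [s0|s0] := leP 0 s.
  have bnd t : t \in `[0, s] -> `|t| <= `|s|.
    by rewrite in_itv/= => /andP[t0 ts]; rewrite !ger0_norm.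
  have [||c cs] := @MVT_segment R phi (fun t => partial a f (t *: e + y)) 0 s s0.
  - by move=> t ts; apply: dphi; apply: bnd; apply: subset_itv_oo_cc.
  - by apply: continuous_in_subspaceT => t /set_mem /= ts; apply: cphi; exact: bnd.
  rewrite phi0 subr0 mulrC => H; exists c => //; exact: bnd.
have bnd t : t \in `[s, 0] -> `|t| <= `|s|.
  by rewrite in_itv/= => /andP[ts t0]; rewrite !ler0_norm ?lerN2// ltW.
have [||c cs] := @MVT_segment R phi (fun t => partial a f (t *: e + y)) s 0 (ltW s0).
- by move=> t ts; apply: dphi; apply: bnd; apply: subset_itv_oo_cc.
- by apply: continuous_in_subspaceT => t /set_mem /= ts; apply: cphi; exact: bnd.
rewrite phi0 sub0r => H; exists c; first exact: bnd.
by rewrite -[LHS]opprB H mulrN opprK mulrC.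
Qed.

(** Go from [x] to [x + h] one coordinate at a time, use the mean value theorem on each step and
    continuity of the partials to control the error. [smooth_on] speaks of iterated partials only,
    while the chain rule for changes of charts is about differentials. *)
Lemma differentiable_partials n (f : 'rV[R]_n -> R) x :
  (\forall y \near x, forall a, derivable f y (delta_mx 0 a)) ->
  (forall a, {for x, continuous (partial a f)}) -> differentiable f x.
Proof.
move=> df cf.
pose L0 (h : 'rV[R]_n) : R := \sum_a h 0 a * partial a f x.
have linL0 : linear L0.
  move=> k u w; rewrite /L0 scaler_sumr -big_split /=; apply: eq_bigr => a _.
  by rewrite !mxE mulrDl scalerAl.
pose sxlM := GRing.isLinear.Build _ _ _ _ _ linL0.
pose L : {linear 'rV[R]_n -> R} := HB.pack L0 sxlM.
have cL : continuous L.
  move=> h; change ({for h, continuous L0}); rewrite /L0.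
  have -> : (fun h : 'rV[R]_n => \sum_a h 0 a * partial a f x) =
     \sum_a (fun h : 'rV[R]_n => h 0 a * partial a f x).
    by apply/funext => z; rewrite fct_sumE.
  elim/big_ind : _ => [|u w|a _]; first exact: cst_continuous.
    exact: continuousD.
  by apply: continuousM; [exact: coord_continuous|exact: cst_continuous].
have H : f \o shift x = cst (f x) + L +o_ (0 : 'rV[R]_n) id.
  apply/eqaddoP => e e0.
  (* Each of the [n] coordinate steps contributes an error of at most [e / n.+1] times the norm of
     [h]; the successor keeps this quotient positive for [n = 0]. *)
  have n0 : 0 < (n.+1%:R : R) by rewrite ltr0n.
  have en0 : 0 < e / n.+1%:R by rewrite divr_gt0.
  have near1 : \forall y \near x, (forall a, derivable f y (delta_mx 0 a)) /\
      forall a, `|partial a f x - partial a f y| < e / n.+1%:R.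
    have cfa : \forall y \near x, forall a, `|partial a f x - partial a f y| < e / n.+1%:R.
      by refine (@filter_forall _ _ _ (nbhs x) _ _) => a; move/cvgrPdist_lt : (cf a) => /(_ _ en0).
    by apply: filterS2 df cfa => y.
  have /nbhs_ballP[r /= r0 hr] := near1.
  apply/nbhs_ballP; exists r => //= h; rewrite -ball_normE /ball_/= sub0r normrN => hnr.
  (* [tr k] keeps the first [k] coordinates of [h]; the increment of [f] telescopes along these
     points, all of norm at most that of [h]. *)
  pose tr (k : nat) : 'rV[R]_n := \row_j (if (j < k)%N then h 0 j else 0).
  have tr0 : tr 0 = 0 by apply/rowP => j; rewrite !mxE.
  have trn : tr n = h by apply/rowP => j; rewrite !mxE ltn_ord.
  have trS (k : 'I_n) : tr k.+1 = h 0 k *: delta_mx 0 k + tr k.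
    apply/rowP => j; rewrite !mxE eqxx /= ltnS leq_eqVlt -val_eqE /=.
    case: (ltngtP j k) => jk /=; rewrite ?mulr0 ?mulr1 ?add0r ?addr0//.
    by congr (h _ _); apply: val_inj.
  have trc (k : 'I_n) c : `|c| <= `|h 0 k| -> `|c *: delta_mx 0 k + tr k| <= `|h|.
    move=> ch; apply: rV_norm_le => // j; rewrite !mxE eqxx /= -val_eqE /=.
    case: (ltngtP j k) => jk /=; rewrite ?mulr0 ?mulr1 ?add0r ?addr0 ?normr0 ?normr_ge0//.
      exact: rV_coord_norm.
    exact: le_trans ch (rV_coord_norm _ _).
  have inball z : `|z| <= `|h| -> (forall a, derivable f (z + x) (delta_mx 0 a)) /\
      forall a, `|partial a f x - partial a f (z + x)| < e / n.+1%:R.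
    move=> zh; apply: hr; rewrite -ball_normE /ball_/= opprD addrCA subrr addr0 normrN.
    exact: le_lt_trans zh hnr.
  have step (k : 'I_n) :
      `|f (tr k.+1 + x) - f (tr k + x) - h 0 k * partial k f x| <= e / n.+1%:R * `|h|.
    have [|c ch] := @mvt_partial n f k (tr k + x) (h 0 k).
      by move=> t th; rewrite addrA; apply: (inball _ _).1; exact: trc.
    rewrite !addrA -trS => ->; rewrite -mulrBr normrM mulrC.
    apply: ler_pM => //; last exact: rV_coord_norm.
    by rewrite distrC; apply/ltW/(inball _ _).2/trc.
  rewrite [X in `|X|](_ : _ = f (tr n + x) - f (tr 0 + x) - L0 h); last first.
    by rewrite trn tr0 add0r -addrA -opprD.
  rewrite [X in `|X|](_ : _ = \sum_(k < n)
     (f (tr k.+1 + x) - f (tr k + x) - h 0 k * partial k f x)).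
    apply: (le_trans (ler_norm_sum _ _ _)).
    apply: (le_trans (ler_sum _ (fun k _ => step k))).
    rewrite sumr_const card_ord [leLHS](_ : _ = n%:R / n.+1%:R * (e * `|h|)); last first.
      by rewrite -[LHS]mulr_natr; move: (n.+1%:R^-1) (n%:R) => N M; ring.
    rewrite ler_piMl//; first by rewrite mulr_ge0// ltW.
    by rewrite ler_pdivrMr// mul1r ler_nat.
  rewrite sumrB; congr (_ - _).
  rewrite -(big_mkord xpredT (fun k => f (tr k.+1 + x) - f (tr k + x))).
  by rewrite telescope_sumr.
have E : 'd f x = L :> (_ -> _) by apply: diff_unique.
by apply/diff_locallyP; rewrite E.
Qed.

Section smooth_closure.
Context {n : nat}.
Implicit Types (U : set 'rV[R]_n) (f g : 'rV[R]_n -> R).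

Lemma near_open U x : open U -> U x -> \forall y \near x, U y.
Proof. by move=> oU Ux; exact: open_nbhs_nbhs. Qed.

Lemma near_continuous f g x : (\forall y \near x, f y = g y) ->
  {for x, continuous f} -> {for x, continuous g}.
Proof.
move=> fg; rewrite /prop_for /continuous_at -(nbhs_singleton fg).
by apply: cvg_trans; exact: (@near_eq_cvg _ _ (nbhs x) _ f g fg).
Qed.

(** On an open set equality holds near each point, so it passes to the partials at every order. *)
Lemma smooth_upto_ext k U f g : open U -> (forall x, U x -> f x = g x) ->
  smooth_upto k U f -> smooth_upto k U g.
Proof.
move=> oU fg0; have near_fg f' g' x : (forall x, U x -> f' x = g' x) -> U x ->
    \forall y \near x, f' y = g' y.
  by move=> fg /(near_open oU); apply: filterS => y; exact: fg.
elim: k f g fg0 => [|k IH] f g fg /= [cf H].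
  split=> // x /set_mem Ux.
  by apply: near_continuous (cf _ (mem_set Ux)); exact: near_fg.
split=> [x /set_mem Ux|a].
  by apply: near_continuous (cf _ (mem_set Ux)); exact: near_fg.
have [df sf] := H a; split.
  by move=> x /set_mem Ux; apply: near_eq_derivable (df _ (mem_set Ux)); exact: near_fg.
apply: IH sf => x Ux; apply: near_eq_derive; exact: near_fg.
Qed.

Lemma smooth_uptoW k U f : smooth_upto k.+1 U f -> smooth_upto k U f.
Proof.
elim: k f => [|k IH] f; first by case.
move=> [cf H]; split=> // a; have [df sf] := H a; split=> //; exact: IH.
Qed.

Lemma smooth_uptoD k U f g : open U -> smooth_upto k U f -> smooth_upto k U g ->
  smooth_upto k U (fun x => f x + g x).
Proof.
move=> oU; elim: k f g => [|k IH] f g /= [cf Hf] [cg Hg].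
  by split=> // x Ux; apply: continuousD; [exact: cf|exact: cg].
split=> [x Ux|a]; first by apply: continuousD; [exact: cf|exact: cg].
have [df sf] := Hf a; have [dg sg] := Hg a.
split=> [x Ux|]; first by apply: derivableD; [exact: df|exact: dg].
apply: (smooth_upto_ext oU _ (IH _ _ sf sg)) => x /mem_set Ux.
by rewrite /partial -(deriveD (df _ Ux) (dg _ Ux)).
Qed.

Lemma smooth_uptoM k U f g : open U -> smooth_upto k U f -> smooth_upto k U g ->
  smooth_upto k U (fun x => f x * g x).
Proof.
move=> oU; elim: k f g => [|k IH] f g.
  by move=> /= [cf _] [cg _]; split=> // x Ux; apply: continuousM; [exact: cf|exact: cg].
move=> Sf Sg; have [Sf' Sg'] := (smooth_uptoW Sf, smooth_uptoW Sg).
move: Sf Sg => [cf Hf] [cg Hg].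
split=> [x Ux|a]; first by apply: continuousM; [exact: cf|exact: cg].
have [df sf] := Hf a; have [dg sg] := Hg a.
split=> [x Ux|]; first by apply: derivableM; [exact: df|exact: dg].
apply: (smooth_upto_ext oU _ (smooth_uptoD oU (IH _ _ Sf' sg) (IH _ _ Sg' sf))) => x /mem_set Ux.
by rewrite /partial -(deriveM (df _ Ux) (dg _ Ux)).
Qed.

Lemma smooth_uptoV k U f : open U -> (forall x, U x -> f x != 0) -> smooth_upto k U f ->
  smooth_upto k U (fun x => (f x)^-1).
Proof.
move=> oU f0; elim: k f f0 => [|k IH] f f0.
  move=> /= [cf _]; split=> // x Ux; apply: continuousV; last exact: cf.
  exact/f0/set_mem.
move=> Sf; have Sf' := smooth_uptoW Sf.
move: Sf => [cf Hf].
split=> [x Ux|a].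
  by apply: continuousV; [exact/f0/set_mem|exact: cf].
have [df sf] := Hf a.
split=> [x Ux|]; first by apply: derivableV; [exact/f0/set_mem|exact: df].
have SV := IH _ f0 Sf'.
apply: (smooth_upto_ext oU _ (smooth_uptoM oU (smooth_upto_cst _ _ (-1))
   (smooth_uptoM oU (smooth_uptoM oU SV SV) sf))) => x Ux.
rewrite /partial deriveV; [|exact: f0|exact/df/mem_set].
by rewrite mulN1r scaleNr expr2 invfM.
Qed.

Lemma smooth_on_cst U (c : R) : smooth_on U (fun=> c).
Proof. by move=> k; exact: smooth_upto_cst. Qed.

Lemma smooth_onD U f g : open U -> smooth_on U f -> smooth_on U g ->
  smooth_on U (fun x => f x + g x).
Proof. by move=> oU sf sg k; exact: smooth_uptoD. Qed.

Lemma smooth_onM U f g : open U -> smooth_on U f -> smooth_on U g ->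
  smooth_on U (fun x => f x * g x).
Proof. by move=> oU sf sg k; exact: smooth_uptoM. Qed.

Lemma smooth_onB U f g : open U -> smooth_on U f -> smooth_on U g ->
  smooth_on U (fun x => f x - g x).
Proof.
move=> oU sf sg; have := smooth_onD oU sf (smooth_onM oU (smooth_on_cst U (-1)) sg).
by under eq_fun do rewrite mulN1r.
Qed.

Lemma smooth_onV U f : open U -> (forall x, U x -> f x != 0) -> smooth_on U f ->
  smooth_on U (fun x => (f x)^-1).
Proof. by move=> oU f0 sf k; exact: smooth_uptoV. Qed.

Lemma smooth_on_ext U f g : open U -> (forall x, U x -> f x = g x) ->
  smooth_on U f -> smooth_on U g.
Proof. by move=> oU fg sf k; exact: smooth_upto_ext fg (sf k). Qed.

Lemma smooth_on_partial U f a : smooth_on U f -> smooth_on U (partial a f).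
Proof. by move=> sf k; have [_ /(_ a)[]] := sf k.+1. Qed.

Lemma smooth_on_derivable U f x a : smooth_on U f -> U x -> derivable f x (delta_mx 0 a).
Proof. by move=> sf /mem_set Ux; have [_ /(_ a)[+ _]] := sf 1; exact. Qed.

Lemma smooth_on_continuous U f x : smooth_on U f -> U x -> {for x, continuous f}.
Proof. by move=> sf /mem_set Ux; have [+ _] := sf 0; exact. Qed.

Lemma smooth_on_sum (I : Type) (r : seq I) (P : pred I) U (F : I -> 'rV[R]_n -> R) : open U ->
  (forall i, smooth_on U (F i)) -> smooth_on U (fun x => \sum_(i <- r | P i) F i x).
Proof.
move=> oU sF; elim: r => [|i r IH].
  by under eq_fun do rewrite big_nil; exact: smooth_on_cst.
under eq_fun do rewrite big_cons; case: (P i) => //; exact: smooth_onD.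
Qed.

Lemma smooth_on_prod (I : Type) (r : seq I) (P : pred I) U (F : I -> 'rV[R]_n -> R) : open U ->
  (forall i, smooth_on U (F i)) -> smooth_on U (fun x => \prod_(i <- r | P i) F i x).
Proof.
move=> oU sF; elim: r => [|i r IH].
  by under eq_fun do rewrite big_nil; exact: smooth_on_cst.
under eq_fun do rewrite big_cons; case: (P i) => //; exact: smooth_onM.
Qed.

Lemma smooth_on_det m U (G : 'rV[R]_n -> 'M[R]_m) : open U ->
  (forall i j, smooth_on U (fun x => G x i j)) -> smooth_on U (fun x => \det (G x)).
Proof.
move=> oU sG; rewrite /determinant; apply: smooth_on_sum => // s.
apply: smooth_onM => //; first exact: smooth_on_cst.
by apply: smooth_on_prod => // i.
Qed.

(** Cramer's rule: an entry is a cofactor over the determinant, both polynomial in the entries of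
    [G]. *)
Lemma smooth_on_invmx m U (G : 'rV[R]_n -> 'M[R]_m) i j : open U ->
  (forall x, U x -> G x \in unitmx) ->
  (forall i j, smooth_on U (fun x => G x i j)) -> smooth_on U (fun x => invmx (G x) i j).
Proof.
move=> oU uG sG.
have sV : smooth_on U (fun x => (\det (G x))^-1).
  apply: smooth_onV => //; last exact: smooth_on_det.
  by move=> x /uG; rewrite unitmxE unitfE.
have sC : smooth_on U (fun x => cofactor (G x) j i).
  rewrite /cofactor; apply: smooth_onM => //; first exact: smooth_on_cst.
  apply: smooth_on_det => // i' j'.
  by under eq_fun do rewrite !mxE; exact: sG.
apply: (smooth_on_ext oU _ (smooth_onM oU sV sC)) => x Ux.
by rewrite /invmx uG// !mxE.
Qed.

Lemma smooth_on_differentiable U f x : open U -> smooth_on U f -> U x -> differentiable f x.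
Proof.
move=> oU sf Ux; apply: differentiable_partials.
  by apply: filterS (near_open oU Ux) => y Uy a; exact: smooth_on_derivable sf Uy.
by move=> a; apply: smooth_on_continuous Ux; exact: smooth_on_partial.
Qed.

Lemma partial_near f g x a : {near x, f =1 g} -> partial a f x = partial a g x.
Proof. by move=> fg; exact: near_eq_derive. Qed.

End smooth_closure.

Lemma differentiable_rV m n (T : 'rV[R]_m -> 'rV[R]_n) x :
  (forall b, differentiable (fun y => T y 0 b) x) -> differentiable T x.
Proof.
move=> dT; have -> : T = \sum_(b < n) (fun y => T y 0 b *: delta_mx 0 b).
  apply/funext => y; rewrite fct_sumE; apply/rowP => j; rewrite summxE.
  rewrite (bigD1 j)//= !mxE !eqxx mulr1 big1 ?addr0// => i ij.
  by rewrite !mxE eq_sym (negbTE ij) andbF mulr0.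
by apply: differentiable_sum => b; exact: differentiableZl.
Qed.

(** Vectors are rows, so the differential of [T] is right multiplication by its Jacobian, and
    [jacobian T x a b] is the partial of component [b] in direction [a]. *)
Lemma partial_comp m n (T : 'rV[R]_m -> 'rV[R]_n) (f : 'rV[R]_n -> R) x a :
  differentiable T x -> differentiable f (T x) ->
  partial a (f \o T) x = \sum_b jacobian T x a b * partial b f (T x).
Proof.
move=> dT df; rewrite /partial deriveE; last exact: differentiable_comp.
rewrite diff_comp//= -[X in 'd f _ X]deriveE// deriveEjacobian// -rowE.
rewrite (row_sum_delta (row a _)) linear_sum; apply: eq_bigr => b _.
by rewrite linearZ /= mxE deriveE.
Qed.

End calculus.

(** * Bounded measurable functions on finite measure spaces *)

Section bounded_measurable.
Context {R : realType}.

(** A class inside which integrability is automatic for finite measures: it is stable under sums,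
    products, non-negative powers and integration in one variable, and contains the continuous
    functions on a compact manifold. *)
Definition bounded_measurable d (T : measurableType d) (f : T -> R) : Prop :=
  measurable_fun setT f /\ exists M, forall x, `|f x| <= M.

Section one_space.
Context {d} {T : measurableType d}.
Implicit Types f g : T -> R.

Lemma bounded_measurable_cst (c : R) : bounded_measurable (fun _ : T => c).
Proof. by split; [exact: measurable_cst|exists `|c|]. Qed.

Lemma bounded_measurableD f g : bounded_measurable f -> bounded_measurable g ->
  bounded_measurable (fun x => f x + g x).
Proof.
move=> [mf [M fM]] [mg [N gN]]; split; first exact: measurable_funD.
by exists (M + N) => x; rewrite (le_trans (ler_normD _ _))// lerD.
Qed.

Lemma bounded_measurableM f g : bounded_measurable f -> bounded_measurable g ->
  bounded_measurable (fun x => f x * g x).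
Proof.
move=> [mf [M fM]] [mg [N gN]]; split; first exact: measurable_funM.
by exists (M * N) => x; rewrite normrM ler_pM.
Qed.

Lemma bounded_measurableZ (c : R) f : bounded_measurable f ->
  bounded_measurable (fun x => c * f x).
Proof. by apply: bounded_measurableM; exact: bounded_measurable_cst. Qed.

Lemma bounded_measurable_norm f : bounded_measurable f ->
  bounded_measurable (fun x => `|f x|).
Proof.
move=> [mf [M fM]]; split; first exact: measurableT_comp.
by exists M => x; rewrite normr_id.
Qed.

Lemma bounded_measurable_sqr f : bounded_measurable f ->
  bounded_measurable (fun x => f x ^+ 2).
Proof. by move=> ?; apply: bounded_measurableM. Qed.

Lemma bounded_measurable_powR f (p : R) : 0 <= p -> (forall x, 0 <= f x) ->
  bounded_measurable f -> bounded_measurable (fun x => f x `^ p).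
Proof.
move=> p0 f0 [mf [M fM]]; split.
  by apply: (@measurableT_comp _ _ _ _ _ _ (@powR R ^~ p)).
exists (M `^ p) => x; rewrite ger0_norm ?powR_ge0//.
have fx : f x <= M by have := fM x; rewrite ger0_norm.
by apply: ge0_ler_powR => //; rewrite nnegrE// (le_trans (f0 x)).
Qed.

Lemma bounded_measurable_integrable (mu : {finite_measure set T -> \bar R}) f :
  bounded_measurable f -> mu.-integrable setT (EFin \o f).
Proof.
move=> [mf [M fM]]; apply: measurable_bounded_integrable => //.
  by rewrite -ge0_fin_numE// fin_num_measure.
exists M; split; first exact: num_real.
by move=> x Mx y _ /=; rewrite (le_trans (fM y))// ltW.
Qed.

Variable mu : {finite_measure set T -> \bar R}.

Lemma bmRintegralD f g : bounded_measurable f -> bounded_measurable g ->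
  \int[mu]_x (f x + g x) = \int[mu]_x f x + \int[mu]_x g x.
Proof. by move=> bf bg; rewrite RintegralD//; exact: bounded_measurable_integrable. Qed.

Lemma bmRintegralZ (c : R) f : bounded_measurable f ->
  \int[mu]_x (c * f x) = c * \int[mu]_x f x.
Proof. by move=> bf; rewrite RintegralZl//; exact: bounded_measurable_integrable. Qed.

Lemma bmRintegral_le f g : bounded_measurable f -> bounded_measurable g ->
  (forall x, f x <= g x) -> \int[mu]_x f x <= \int[mu]_x g x.
Proof. by move=> bf bg fg; apply: le_Rintegral => //; exact: bounded_measurable_integrable. Qed.

Lemma bmRintegral_ge0 f : (forall x, 0 <= f x) -> 0 <= \int[mu]_x f x.
Proof. by move=> f0; apply: Rintegral_ge0. Qed.

Lemma bmRintegralE f : bounded_measurable f ->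
  (\int[mu]_x (f x)%:E)%E = (\int[mu]_x f x)%:E.
Proof.
move=> bf; rewrite /Rintegral fineK//.
exact: integrable_fin_num (bounded_measurable_integrable mu bf).
Qed.

(** Hoelder's inequality with exponents [a^-1] and [b^-1] for the powers of [f] and [g]. In this
    form the norms are powers of plain integrals, so successive uses combine by arithmetic on
    exponents. *)
Lemma weighted_hoelder (a b : R) f g : 0 < a -> 0 < b -> a + b = 1 ->
  bounded_measurable f -> bounded_measurable g -> (forall x, 0 <= f x) -> (forall x, 0 <= g x) ->
  \int[mu]_x (f x `^ a * g x `^ b) <= (\int[mu]_x f x) `^ a * (\int[mu]_x g x) `^ b.
Proof.
move=> a0 b0 ab bf bg f0 g0.
have bfa := bounded_measurable_powR (ltW a0) f0 bf.
have bgb := bounded_measurable_powR (ltW b0) g0 bg.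
have pw (c : R) (h : T -> R) : 0 < c -> (forall x, 0 <= h x) -> bounded_measurable h ->
    Lnorm mu c^-1%:E (EFin \o (fun x => h x `^ c)) = ((\int[mu]_x h x) `^ c)%:E.
  move=> c0 h0 bh; rewrite unlock /= invrK -poweR_EFin -bmRintegralE//; congr (_ `^ _)%E.
  apply: eq_integral => x _.
  by rewrite /= ger0_norm ?powR_ge0// -powRrM mulfV ?gt_eqF// powRr1.
have := @hoelder _ _ _ mu _ _ a^-1 b^-1 bfa.1 bgb.1.
rewrite !invrK !invr_gt0 ab => /(_ a0 b0 erefl).
rewrite Lnorm1 !pw//.
rewrite (eq_integral (fun x => (f x `^ a * g x `^ b)%:E)); last first.
  by move=> x _; rewrite /= ger0_norm// mulr_ge0 ?powR_ge0.
by rewrite bmRintegralE ?lee_fin//; apply: bounded_measurableM.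
Qed.

End one_space.

Section two_spaces.
Context {d1 d2} {X : measurableType d1} {Y : measurableType d2}.
Variables (m1 : {finite_measure set X -> \bar R}) (m2 : {finite_measure set Y -> \bar R}).
Implicit Types F : X * Y -> R.

Lemma bounded_measurable_section F x : bounded_measurable F ->
  bounded_measurable (fun y => F (x, y)).
Proof.
move=> [mF [M FM]]; split; last by exists M.
exact: (measurableT_comp mF (pair1_measurable x)).
Qed.

Lemma bounded_measurable_swap F : bounded_measurable F ->
  bounded_measurable (fun z => F (z.2, z.1)).
Proof.
move=> [mF [M FM]]; split; last by exists M.
by apply: (measurableT_comp mF); exact: measurable_swap.
Qed.

Lemma integrable_bounded_prod F : bounded_measurable F ->
  (m1 \x m2)%E.-integrable setT (EFin \o F).
Proof.
move=> [mF [M FM]]; apply: measurable_bounded_integrable => //.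
  rewrite -setXTT; change (product_measure1 m1 m2 ([set: X] `*` [set: Y]) < +oo)%E.
  by rewrite product_measure1E// lte_mul_pinfty// ?fin_num_measure// -ge0_fin_numE// fin_num_measure.
exists M; split; first exact: num_real.
by move=> x Mx y _ /=; rewrite (le_trans (FM y))// ltW.
Qed.

Lemma bounded_measurable_Rintegral F : bounded_measurable F ->
  bounded_measurable (fun x => \int[m2]_y F (x, y)).
Proof.
move=> bF; split.
  have := measurable_fubini_F (integrable_bounded_prod bF).
  rewrite (_ : fubini_F _ _ = EFin \o (fun x => \int[m2]_y F (x, y))).
    by move=> /measurable_EFinP.
  apply/funext => x; rewrite /fubini_F /= bmRintegralE//.
  exact: bounded_measurable_section.
have [_ [M FM]] := bF.
exists (M * fine (m2 setT)) => x; rewrite -Rintegral_cst//.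
have bs := bounded_measurable_section x bF.
apply: (le_trans (le_normr_Rintegral _ _)) => //; first exact: bounded_measurable_integrable.
apply: bmRintegral_le => //; first exact: bounded_measurable_norm.
exact: bounded_measurable_cst.
Qed.

Lemma Rintegral_prod F : bounded_measurable F ->
  \int[(m1 \x m2)%E]_z F z = \int[m1]_x \int[m2]_y F (x, y).
Proof.
move=> bF; rewrite {1}/Rintegral -(integral12_prod_meas1 (integrable_bounded_prod bF)).
rewrite /Rintegral; congr fine; apply: eq_integral => x _.
by rewrite /fubini_F /= bmRintegralE//; exact: bounded_measurable_section.
Qed.

End two_spaces.
End bounded_measurable.

(** * Minkowski's integral inequality and mixed norms *)

Section mixed_norms.
Context {R : realType}.
Context {d1 d2} {X : measurableType d1} {Y : measurableType d2}.
Variables (m1 : {finite_measure set X -> \bar R}) (m2 : {finite_measure set Y -> \bar R}).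
Implicit Types F : X * Y -> R.

Lemma bounded_measurable_section2 F y : bounded_measurable F ->
  bounded_measurable (fun x => F (x, y)).
Proof. by move/bounded_measurable_swap => /(bounded_measurable_section y). Qed.

Lemma bounded_measurable_Rintegral2 F : bounded_measurable F ->
  bounded_measurable (fun y => \int[m1]_x F (x, y)).
Proof. by move/bounded_measurable_swap => /(bounded_measurable_Rintegral m2 m1). Qed.

Lemma Rintegral_exchange F : bounded_measurable F ->
  \int[m1]_x \int[m2]_y F (x, y) = \int[m2]_y \int[m1]_x F (x, y).
Proof.
move=> bF; have := Fubini (integrable_bounded_prod m1 m2 bF).
rewrite /Rintegral => E; congr fine.
transitivity (\int[m1]_x \int[m2]_y (EFin \o F) (x, y))%E.
  by apply: eq_integral => x _; rewrite /= bmRintegralE//; exact: bounded_measurable_section.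
rewrite E; apply: eq_integral => y _.
by rewrite /= bmRintegralE//; exact: bounded_measurable_section2.
Qed.

(** With [H y] the integral of [F] in [x], split the power [r] of [H] into its power [r - 1] times
    [H], exchange the integrals and apply Hoelder in [y] for each [x]. This bounds [K] by its own
    power [1 - r^-1] times the right-hand side; that power cancels, [K] being finite, and [K = 0] is
    trivial. *)
Lemma minkowski_integral (r : R) F : 1 < r -> bounded_measurable F -> (forall z, 0 <= F z) ->
  (\int[m2]_y (\int[m1]_x F (x, y)) `^ r) `^ r^-1 <=
  \int[m1]_x (\int[m2]_y F (x, y) `^ r) `^ r^-1.
Proof.
move=> r1 bF F0.
have r0 : 0 < r by lra.
have rV0 : 0 < r^-1 by rewrite invr_gt0.
have rV1 : r^-1 < 1 by rewrite invf_lt1.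
set H := fun y => \int[m1]_x F (x, y).
have H0 y : 0 <= H y by exact: bmRintegral_ge0.
have bH : bounded_measurable H by exact: bounded_measurable_Rintegral2.
have bHp (s : R) : 0 <= s -> bounded_measurable (fun y => H y `^ s).
  by move=> s0; apply: bounded_measurable_powR.
have bFr : bounded_measurable (fun z => F z `^ r).
  by apply: bounded_measurable_powR => //; exact: ltW.
set K := \int[m2]_y (H y) `^ r.
set M := \int[m1]_x (\int[m2]_y F (x, y) `^ r) `^ r^-1.
have K0 : 0 <= K by apply: bmRintegral_ge0 => y; exact: powR_ge0.
have M0 : 0 <= M by apply: bmRintegral_ge0 => y; exact: powR_ge0.
have KM : K <= K `^ (1 - r^-1) * M.
  have bHF : bounded_measurable (fun z : X * Y => H z.2 `^ (r - 1) * F z).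
    apply: bounded_measurableM => //.
    have [mH [N HN]] := bHp (r - 1) ltac:(lra).
    split; last by exists N => z; exact: HN.
    exact: (measurableT_comp mH measurable_snd).
  have KE : K = \int[m1]_x \int[m2]_y (H y `^ (r - 1) * F (x, y)).
    rewrite (Rintegral_exchange bHF).
    apply: eq_Rintegral => y _ /=; rewrite bmRintegralZ; last first.
      exact: bounded_measurable_section2.
    by rewrite -/(H y) mulrC mulr_powRB1.
  rewrite [leLHS]KE -bmRintegralZ; last first.
    apply: bounded_measurable_powR; [exact: ltW| |exact: (bounded_measurable_Rintegral m1 m2 bFr)].
    by move=> x; apply: bmRintegral_ge0 => y; exact: powR_ge0.
  apply: bmRintegral_le => [||x].
  - exact: (bounded_measurable_Rintegral m1 m2 bHF).
  - apply: bounded_measurableZ; apply: bounded_measurable_powR; first exact: ltW.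
      by move=> x; apply: bmRintegral_ge0 => y; exact: powR_ge0.
    exact: (bounded_measurable_Rintegral m1 m2 bFr).
  - have e : (fun y => H y `^ r `^ (1 - r^-1) * F (x, y) `^ r `^ r^-1) =
       (fun y => H y `^ (r - 1) * F (x, y)).
      apply/funext => y; rewrite -!powRrM mulfV ?gt_eqF// powRr1//.
      by rewrite mulrBr mulr1 mulfV ?gt_eqF.
    rewrite -[X in X <= _]/(\int[m2]_y ((fun y => H y `^ (r - 1) * F (x, y)) y)) -e.
    have rB : 0 < 1 - r^-1 by lra.
    apply: (weighted_hoelder m2 rB rV0); [lra| | | |].
    + exact/bHp/ltW.
    + exact: (bounded_measurable_section x bFr).
    + by move=> y; exact: powR_ge0.
    + by move=> y; exact: powR_ge0.
have [K00|K00] := eqVneq K 0.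
  by rewrite K00 powR0 ?gt_eqF.
have Kp : 0 < K by rewrite lt_neqAle eq_sym K00.
rewrite -(ler_pM2l (powR_gt0 (1 - r^-1) Kp)) -powRD; last by rewrite K00 implybT.
by rewrite subrK powRr1.
Qed.

Lemma mixed_norm_interpolation (V W p pv pw : R) (f : X * Y -> R) : 2 < V -> 2 < W ->
  p = 2 * (V + W) / (V + W - 2) -> pv = 2 * V / (V - 2) -> pw = 2 * W / (W - 2) ->
  bounded_measurable f -> (forall z, 0 <= f z) ->
  (\int[m1]_x \int[m2]_y f (x, y) `^ p) `^ (2 / p) <=
  (\int[m2]_y (\int[m1]_x f (x, y) `^ pv) `^ (2 / pv)) `^ (V / (V + W)) *
  (\int[m1]_x (\int[m2]_y f (x, y) `^ pw) `^ (2 / pw)) `^ (W / (V + W)).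
Proof.
move=> V2 W2 pE pvE pwE.
have e2p : 2 / p = (V + W - 2) / (V + W).
  by rewrite pE; field; rewrite !gt_eqF//; lra.
have e2v : 2 / pv = (V - 2) / V by rewrite pvE; field; rewrite !gt_eqF//; lra.
have e2w : 2 / pw = (W - 2) / W by rewrite pwE; field; rewrite !gt_eqF//; lra.
have pv0 : 0 <= pv by rewrite pvE divr_ge0//; lra.
have pw0 : 0 <= pw by rewrite pwE divr_ge0//; lra.
have p0 : 0 < p by rewrite pE divr_gt0//; lra.
(* [r] is [pw / 2], so Minkowski with exponent [r] applied to the square of [f] produces the
   [pw]-norm of the slices. [al] and [be] are the weights of the second Hoelder inequality, chosen
   so that its factors are the powers [a] of [P] and [r] of [Q]. *)
have [r rE] : exists r, r = W / (W - 2) by eexists.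
have r1 : 1 < r by rewrite rE ltr_pdivlMr; lra.
have r0 : 0 < r by exact: lt_trans r1.
have [a aE] : exists a, a = 2 / pv by eexists.
have a0 : 0 <= a by rewrite aE divr_ge0.
have [al alE] : exists a, a = V / (V + W - 2) by eexists.
have [be beE] : exists a, a = (W - 2) / (V + W - 2) by eexists.
have al0 : 0 < al by rewrite alE divr_gt0//; lra.
have be0 : 0 < be by rewrite beE divr_gt0//; lra.
have albe : al + be = 1 by rewrite alE beE; field; rewrite gt_eqF//; lra.
have e1 (t : R) : (t `^ a) `^ al = t `^ ((V - 2) / (V + W - 2)).
  by rewrite -(powRrM t); congr (t `^ _); rewrite aE e2v alE; field; rewrite !gt_eqF//; lra.
have e2 (t : R) : (t `^ r) `^ be = t `^ (W / (V + W - 2)).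
  by rewrite -(powRrM t); congr (t `^ _); rewrite rE beE; field; rewrite !gt_eqF//; lra.
have e3 (t : R) : t `^ p =
    (t `^ pv) `^ ((V - 2) / (V + W - 2)) * (t `^ 2) `^ (W / (V + W - 2)).
  have ee : pv * ((V - 2) / (V + W - 2)) + 2 * (W / (V + W - 2)) = p.
    by rewrite pE pvE; field; rewrite !gt_eqF//; lra.
  by rewrite -!(powRrM t) -powRD ee// gt_eqF.
have av : 0 < (V - 2) / (V + W - 2) by rewrite divr_gt0//; lra.
have aw : 0 < W / (V + W - 2) by rewrite divr_gt0//; lra.
have avw : (V - 2) / (V + W - 2) + W / (V + W - 2) = 1 by field; rewrite gt_eqF//; lra.
have e4 : al * (2 / p) = V / (V + W) by rewrite alE e2p; field; rewrite !gt_eqF//; lra.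
have e5 : W / (V + W - 2) * (2 / p) = W / (V + W) by rewrite e2p; field; rewrite !gt_eqF//; lra.
move=> bf f0.
have b2 : bounded_measurable (fun z => f z `^ 2) by exact: bounded_measurable_powR.
have bpv : bounded_measurable (fun z => f z `^ pv) by exact: bounded_measurable_powR.
have bp : bounded_measurable (fun z => f z `^ p) by apply: bounded_measurable_powR => //; exact: ltW.
have [P PE] : exists P : Y -> R, P = fun y => \int[m1]_x f (x, y) `^ pv by exists (fun y => \int[m1]_x f (x, y) `^ pv).
have [Q QE] : exists Q : Y -> R, Q = fun y => \int[m1]_x f (x, y) `^ 2 by exists (fun y => \int[m1]_x f (x, y) `^ 2).
have [S SE] : exists S : Y -> R, S = fun y => \int[m1]_x f (x, y) `^ p by exists (fun y => \int[m1]_x f (x, y) `^ p).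
have P0 y : 0 <= P y by rewrite PE; apply: bmRintegral_ge0 => x; exact: powR_ge0.
have Q0 y : 0 <= Q y by rewrite QE; apply: bmRintegral_ge0 => x; exact: powR_ge0.
have S0 y : 0 <= S y by rewrite SE; apply: bmRintegral_ge0 => x; exact: powR_ge0.
have bP : bounded_measurable P by rewrite PE; exact: bounded_measurable_Rintegral2 bpv.
have bQ : bounded_measurable Q by rewrite QE; exact: bounded_measurable_Rintegral2 b2.
have bS : bounded_measurable S by rewrite SE; exact: bounded_measurable_Rintegral2 bp.
have bPa : bounded_measurable (fun y => P y `^ a) by exact: bounded_measurable_powR.
have bQr : bounded_measurable (fun y => Q y `^ r) by apply: bounded_measurable_powR => //; exact: ltW.
have [mA mAE] : exists A, A = \int[m2]_y (P y `^ a) by eexists.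
have [mB mBE] : exists B, B = \int[m1]_x (\int[m2]_y f (x, y) `^ pw) `^ (2 / pw) by eexists.
have [K KE] : exists K, K = \int[m2]_y (Q y `^ r) by exists (\int[m2]_y (Q y `^ r)).
have A0 : 0 <= mA by rewrite mAE; apply: bmRintegral_ge0 => y; exact: powR_ge0.
have B0 : 0 <= mB by rewrite mBE; apply: bmRintegral_ge0 => y; exact: powR_ge0.
have K0 : 0 <= K by rewrite KE; apply: bmRintegral_ge0 => y; exact: powR_ge0.
(* Write [p] as a convex combination of [pv] and 2: Hoelder on each [X]-slice bounds [S y], a
   second Hoelder integrates the bound over [Y], and Minkowski exchanges the integrals in [K]. *)
have mink : K <= mB `^ r.
  have := minkowski_integral r1 b2 (fun z => powR_ge0 _ _).
  have -> : (fun x => (\int[m2]_y (f (x, y) `^ 2) `^ r) `^ r^-1) =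
    (fun x => (\int[m2]_y f (x, y) `^ pw) `^ (2 / pw)).
    apply/funext => x; have -> : r^-1 = 2 / pw by rewrite e2w rE invf_div.
    have pwr (t : R) : (t `^ 2) `^ r = t `^ pw.
      by rewrite -(powRrM t) rE pwE mulrA.
    by under eq_Rintegral do rewrite pwr.
  rewrite -mBE; move: KE; rewrite QE => <- KB.
  rewrite -[K]powRr1// -(@mulVf _ r) ?(powRrM K); last by rewrite gt_eqF.
  by apply: ge0_ler_powR; rewrite ?nnegrE ?powR_ge0//; exact: ltW.
have holder1 y : S y <= (P y `^ a) `^ al * (Q y `^ r) `^ be.
  rewrite e1 e2 SE PE QE; under eq_Rintegral do rewrite e3.
  apply: weighted_hoelder.
  - exact: av.
  - exact: aw.
  - exact: avw.
  - exact: bounded_measurable_section2 bpv.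
  - exact: bounded_measurable_section2 b2.
  - by move=> x; exact: powR_ge0.
  - by move=> x; exact: powR_ge0.
have step : \int[m2]_y S y <= mA `^ al * (mB `^ r) `^ be.
  apply: (@le_trans _ _ (\int[m2]_y ((P y `^ a) `^ al * (Q y `^ r) `^ be))).
    apply: bmRintegral_le => //.
    by apply: bounded_measurableM; apply: bounded_measurable_powR => //;
      [exact: ltW|move=> y; exact: powR_ge0|exact: ltW|move=> y; exact: powR_ge0].
  apply: (@le_trans _ _ (mA `^ al * K `^ be)).
    by rewrite mAE KE; apply: weighted_hoelder => // y; exact: powR_ge0.
  apply: ler_wpM2l; first exact: powR_ge0.
  by apply: ge0_ler_powR; [exact: ltW|rewrite nnegrE|rewrite nnegrE powR_ge0|exact: mink].
rewrite (Rintegral_exchange bp) -mBE -aE.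
have -> : \int[m2]_y (\int[m1]_x f (x, y) `^ pv) `^ a = mA by rewrite mAE PE.
have -> : \int[m2]_y (\int[m1]_x f (x, y) `^ p) = \int[m2]_y S y by rewrite SE.
apply: (@le_trans _ _ ((mA `^ al * (mB `^ r) `^ be) `^ (2 / p))).
  apply: ge0_ler_powR => //.
  - by rewrite divr_ge0// ltW.
  - by rewrite nnegrE; exact: bmRintegral_ge0.
  - by rewrite nnegrE mulr_ge0 ?powR_ge0.
by rewrite e2 powRM ?powR_ge0// -(powRrM mA) -(powRrM mB) e4 e5.
Qed.

End mixed_norms.

(** * Second countability and Borel sets of products *)

Section countability.
Context {R : realType}.

Lemma second_countable_dense (M : pseudoMetricType R) (I : countType) (D : I -> M) :
  (forall x e, 0 < e -> exists i, ball x e (D i)) -> @second_countable M.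
Proof.
move=> Dd; exists (range (fun ik : I * nat => interior (ball (D ik.1) ik.2.+1%:R^-1))).
  exact: (card_le_trans (card_image_le _ _)) (countableP _).
split=> [_ [ik _ <-]|x A /= /nbhs_ballP[e /= e0 xeA]]; first exact: open_interior.
(* A centre within half of [1 / k.+1] of [x] gives a ball of radius [1 / k.+1] that has [x] in its
   interior and lies within [2 / k.+1 < e] of [x]. *)
pose k := Num.truncn (2 / e).
have ke : 2 / k.+1%:R < e.
  by rewrite ltr_pdivrMr ?ltr0n// mulrC -ltr_pdivrMr// truncnS_gt// ltW// divr_gt0.
have d0 : 0 < k.+1%:R^-1 / 2 :> R by rewrite divr_gt0// invr_gt0 ltr0n.
have [i xi] := Dd x _ d0.
have sub : ball x (k.+1%:R^-1 / 2) `<=` ball (D i) k.+1%:R^-1.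
  move=> y xy; rewrite [k.+1%:R^-1]splitr; apply: ball_triangle xy.
  exact: ball_sym.
exists (interior (ball (D i) k.+1%:R^-1)).
  split; first by exists (i, k).
  by apply: filterS sub _; exact: nbhsx_ballx.
move=> y /interior_subset iy; apply: xeA; apply: le_ball (ltW ke) _ _.
rewrite (_ : 2 / _ = k.+1%:R^-1 + k.+1%:R^-1); last by rewrite mulrDl mul1r.
apply: ball_triangle iy; apply: le_ball xi.
by rewrite ler_pdivrMr// ler_peMr ?ler1n// invr_ge0.
Qed.

Lemma ratr_ball (x e : R) : 0 < e -> exists q : rat, ball x e (ratr q).
Proof.
move=> e0; have /rat_in_itvoo[q] : x < x + e by rewrite ltrDl.
rewrite in_itv /= => /andP[xq qx]; exists q.
by rewrite /ball /= ltr_norml; lra.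
Qed.

Lemma second_countable_R : @second_countable R.
Proof. by apply: (second_countable_dense (D := @ratr R)) => x e; exact: ratr_ball. Qed.

Lemma second_countable_rV n : @second_countable 'rV[R]_n.
Proof.
apply: (second_countable_dense (D := fun q : 'rV[rat]_n => \row_j ratr (q 0 j) : 'rV[R]_n)).
move=> x e e0; have /choice[q qx] j := ratr_ball (x 0 j) e0.
exists (\row_j q j); split => // i j; rewrite ord1 !mxE; exact: qx.
Qed.

End countability.

Section borel_sets.

Lemma borel_open (T : ptopologicalType) (A : set (borel T)) :
  @open T A -> measurable A.
Proof. exact: sub_sigma_algebra. Qed.

Lemma measurable_fun_borel d (T : measurableType d) (U : ptopologicalType)
    (D : set T) (f : T -> borel U) :
  (forall A : set U, open A -> measurable (D `&` f @^-1` A)) -> measurable_fun D f.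
Proof. by move=> H; apply: (@measurability _ _ _ (borel U) D f (@open U)) => // _ [A oA <-]; exact: H. Qed.

Lemma open_within_preimage (T U : topologicalType) (D : set T) (f : T -> U) (A : set U) :
  open D -> {in D, continuous f} -> open A -> open (D `&` f @^-1` A).
Proof.
move=> oD cf oA; rewrite openE => x [Dx fAx]; apply: filterI; first exact: open_nbhs_nbhs.
by apply: (cf x (mem_set Dx)); exact: open_nbhs_nbhs.
Qed.

Lemma continuous_borel_on (T U : ptopologicalType) (D : set (borel T)) (f : borel T -> borel U) :
  @open T D -> {in D, continuous (f : T -> U)} -> measurable_fun D f.
Proof.
move=> oD cf; apply: measurable_fun_borel => A oA; apply: borel_open.
exact: (open_within_preimage (T := T) (U := U)).
Qed.

Lemma continuous_borel_realfun_on (R : realType) (T : ptopologicalType) (D : set (borel T))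
    (f : borel T -> R) : @open T D -> {in D, continuous (f : T -> R)} -> measurable_fun D f.
Proof.
move=> oD cf; apply: (measurability _ (RGenOpens.measurableE R)) => _ [_ [a [b ->] <-]].
apply: borel_open; apply: (open_within_preimage (T := T)) => //; exact: interval_open.
Qed.

(** By second countability an open set of the product is a countable union of open boxes, so it
    belongs to the product sigma-algebra, on which product measures live. The maps [fX] and [fY] let
    each factor carry any sigma-algebra containing the preimages of open sets, such as the standard
    one on [R]. *)
Lemma measurable_open_prod (X Y : topologicalType) d1 d2
    (MX : measurableType d1) (MY : measurableType d2) (fX : MX -> X) (fY : MY -> Y)
    (A : set (X * Y)) :
  @second_countable X -> @second_countable Y ->
  (forall B : set X, open B -> measurable (fX @^-1` B)) ->
  (forall B : set Y, open B -> measurable (fY @^-1` B)) ->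
  open A -> measurable [set z : MX * MY | A (fX z.1, fY z.2)].
Proof.
move=> [BX cX [oX bX]] [BY cY [oY bY]] mX mY oA.
pose I := [set ab : set X * set Y | [/\ BX ab.1, BY ab.2 & ab.1 `*` ab.2 `<=` A]].
have cI : countable I.
  by apply: sub_countable (countableX cX cY); apply: subset_card_le => -[a b] [].
have -> : [set z : MX * MY | A (fX z.1, fY z.2)] =
    \bigcup_(ab in I) ((fX @^-1` ab.1) `*` (fY @^-1` ab.2)).
  apply/seteqP; split=> [[x y] /= Axy|[x y] [[a b] [/= _ _ sab] [/= ax bY']]]; last exact: sab.
  move: oA; rewrite openE => /(_ _ Axy) [[P Q] /= [xP yQ] sPQ].
  have [a [Ba ax] aP] := bX _ _ xP.
  have [b [Bb yb] bQ] := bY _ _ yQ.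
  exists (a, b) => //; split=> //= z [/= z1 z2]; apply: sPQ; split; [exact: aP|exact: bQ].
rewrite bigcup_set_type; apply: countable_bigcupT_measurable.
  by rewrite (eq_countable (card_setT _)).
move=> [ab /set_mem[Ba Bb _]] /=; apply: measurableX; [exact/mX/oX|exact/mY/oY].
Qed.

End borel_sets.

(** * Sigma-finite measures and the Lebesgue integral on row vectors *)

Section sigma_finite_extension.
Context d (T : measurableType d) (R : realType) (m : {measure set T -> \bar R}).

(* The phantom argument carries the proof needed to attach the measure instance below. *)
Definition msigma_finite of sigma_finite setT m : set T -> \bar R := m.

Variable sf : sigma_finite setT m.

HB.instance Definition _ := Measure.on (msigma_finite sf).
HB.instance Definition _ := Measure_isSigmaFinite.Build _ _ _ (msigma_finite sf) sf.

End sigma_finite_extension.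

(** Restriction to the whole space changes no value and carries the structure of a finite
    measure. *)
Lemma finite_measureP d (T : measurableType d) (R : realType)
    (m : {measure set T -> \bar R}) : (m setT < +oo)%E ->
  exists m' : {finite_measure set T -> \bar R}, m' = m :> (set T -> \bar R).
Proof.
move=> mT; exists (mfrestr measurableT mT); apply/funext => A.
by change (m (A `&` setT) = m A); rewrite setIT.
Qed.

(** Monotone exhaustions let a single index serve both coordinates. *)
Lemma sigma_finite_product_measure d1 d2 (T1 : measurableType d1) (T2 : measurableType d2)
    (R : realType) (m1 : {sigma_finite_measure set T1 -> \bar R})
    (m2 : {sigma_finite_measure set T2 -> \bar R}) :
  sigma_finite setT (m1 \x m2)%E.
Proof.
have /sigma_finiteP[F [TF ndF Foo]] := sigma_finiteT m1.
have /sigma_finiteP[G [TG ndG Goo]] := sigma_finiteT m2.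
exists (fun n => F n `*` G n) => [|k].
  apply/seteqP; split=> // -[x y] _.
  have [i _ Fx] : (\bigcup_i F i) x by rewrite -TF.
  have [j _ Gy] : (\bigcup_j G j) y by rewrite -TG.
  exists (maxn i j) => //; split => /=.
    by have /subsetPset := ndF _ _ (leq_maxl i j); exact.
  by have /subsetPset := ndG _ _ (leq_maxr i j); exact.
have [[mF Fk] [mG Gk]] := (Foo k, Goo k); split; first exact: measurableX.
by rewrite product_measure1E// lte_mul_pinfty// ge0_fin_numE.
Qed.

Section lebesgue_rV.
Context {R : realType}.

(** Both sides integrate the coordinates in the same order; only the associativity of [row_mx]
    intervenes. *)
Lemma integral_rV_row_mx v w (f : 'rV[R]_(v + w) -> \bar R) :
  integral_rV f = integral_rV (fun x : 'rV_v => integral_rV (fun y : 'rV_w => f (row_mx x y))).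
Proof.
elim: v f => [|v IH] f.
  rewrite /=; congr integral_rV; apply/funext => y.
  by rewrite row_thin_mx.
rewrite /=; apply: eq_integral => t _; rewrite (IH (fun z => f (row_mx (const_mx t : 'rV_1) z : 'rV_(1 + (v + w))))).
congr integral_rV; apply/funext => x; congr integral_rV; apply/funext => y.
by congr f; rewrite row_mxA castmx_id.
Qed.

Let cons_rV n (z : measurableTypeR R * borel 'rV[R]_n) : borel 'rV[R]_(1 + n) :=
  row_mx (const_mx z.1 : 'rV_1) (z.2 : 'rV[R]_n).

Let uncons_rV n (z : borel 'rV[R]_(1 + n)) : measurableTypeR R * borel 'rV[R]_n :=
  ((z : 'rV[R]_(1 + n)) 0 0, rsubmx (z : 'rV[R]_(1 + n))).

Let cons_rVK n : cancel (@cons_rV n) (@uncons_rV n).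
Proof.
move=> [t y]; rewrite /cons_rV /uncons_rV /= row_mxKr; congr (_, _).
transitivity (row_mx (const_mx t : 'rV_1) y 0 (lshift n 0)); last by rewrite row_mxEl mxE.
by congr (row_mx _ _ _ _); exact: val_inj.
Qed.

Let const_mx_continuous : continuous (fun t : R => const_mx t : 'rV[R]_1).
Proof.
rewrite (_ : (fun t => _) = ( *:%R ^~ (const_mx 1 : 'rV[R]_1))); first exact: scalel_continuous.
by apply/funext => t; apply/rowP => j; rewrite !mxE mulr1.
Qed.

Let measurable_cons_rV n : measurable_fun setT (@cons_rV n).
Proof.
apply: measurable_fun_borel => A oA; rewrite setTI.
pose A' : set (R * 'rV[R]_n) := [set z | A (row_mx (const_mx z.1 : 'rV_1) z.2)].
apply: (@measurable_open_prod R 'rV[R]_n _ _ (measurableTypeR R) (borel 'rV[R]_n) id id A').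
- exact: second_countable_R.
- exact: second_countable_rV.
- by move=> B; exact: open_measurable.
- by move=> B; exact: borel_open.
have c : continuous (fun z : R * 'rV[R]_n => row_mx (const_mx z.1 : 'rV_1) z.2).
  move=> z; apply: (@row_mx_continuous _ _ _ _ z (fun z => const_mx z.1) snd).
    by apply: continuous_comp; [exact: cvg_fst|exact: const_mx_continuous].
  exact: cvg_snd.
by apply: open_comp => // z _; exact: c.
Qed.

Let measurable_uncons_rV n : measurable_fun setT (@uncons_rV n).
Proof.
apply: measurable_fun_pair.
  apply: continuous_borel_realfun_on; first exact: openT.
  by move=> x _; exact: coord_continuous.
apply: continuous_borel_on; first exact: openT.
by move=> x _; exact: continuous_rsubmx.
Qed.

(** By induction, the measure is the image of Lebesgue measure times the previous one under
    prepending a coordinate, and Tonelli gives the formula; in dimension 0 it is the Dirac mass. The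
    general theory of integrals thereby becomes applicable to [integral_rV]. *)
Lemma integral_rV_measure n : exists mu : {sigma_finite_measure set (borel 'rV[R]_n) -> \bar R},
  forall f : borel 'rV[R]_n -> \bar R, measurable_fun setT f -> (forall x, 0 <= f x)%E ->
    integral_rV f = (\int[mu]_x f x)%E.
Proof.
elim: n => [|n [mu IH]].
  exists (dirac (0 : borel 'rV[R]_0)) => f mf f0.
  by rewrite integral_dirac// diracT mul1e.
pose lam : {sigma_finite_measure set (measurableTypeR R) -> \bar R} := lebesgue_measure.
pose prod : {measure set (measurableTypeR R * borel 'rV[R]_n)%type -> \bar R} := (lam \x mu)%E.
pose nu : {measure set (borel 'rV[R]_(1 + n)) -> \bar R} :=
  measure_function_pushforward__canonical__measure_function_Measure prod (@measurable_cons_rV n).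
have sf : sigma_finite setT nu.
  have [F FT Ffin] := sigma_finite_product_measure lam mu.
  exists (fun k => @uncons_rV n @^-1` F k).
    by rewrite -preimage_bigcup -FT preimage_setT.
  move=> k; have [mF Fk] := Ffin k; split.
    by rewrite -[X in measurable X]setTI; exact: measurable_uncons_rV.
  change (prod (@cons_rV n @^-1` (@uncons_rV n @^-1` F k)) < +oo)%E.
  rewrite (_ : _ @^-1` _ = F k)//.
  by apply/seteqP; split=> z /=; rewrite cons_rVK.
exists (msigma_finite sf) => f mf f0.
transitivity (\int[nu]_x f x)%E; last by [].
rewrite (ge0_integral_pushforward (@measurable_cons_rV n) prod measurableT mf)//.
have mfc := measurableT_comp mf (@measurable_cons_rV n).
rewrite preimage_setT fubini_tonelli1//=.
apply: eq_integral => t _; rewrite /fubini_F IH//.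
exact: (measurableT_comp mfc (pair1_measurable t)).
Qed.

End lebesgue_rV.

(** * Positive definite matrices *)

Section positive_definite.
Context {R : realType}.

Lemma posdef_unitmx n (A : 'M[R]_n) :
  (forall y : 'rV[R]_n, y != 0 -> 0 < (y *m A *m y^T) 0 0) -> A \in unitmx.
Proof.
move=> pA; rewrite -row_free_unit -kermx_eq0; apply: contraT => /rowV0Pn[y /sub_kermxP yA y0].
by have := pA y y0; rewrite yA mul0mx mxE ltxx.
Qed.

(** The segment from the identity to [A] consists of matrices positive on nonzero vectors, hence
    invertible. The determinant along it is a polynomial in [t] without zero on the unit interval
    and equal to 1 at [t = 0], so it stays positive. *)
Lemma posdef_det_gt0 n (A : 'M[R]_n) :
  (forall y : 'rV[R]_n, y != 0 -> 0 < (y *m A *m y^T) 0 0) -> 0 < \det A.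
Proof.
move=> pA.
pose f t := \det ((1 - t)%:M + t *: A).
have f_neq0 t : 0 <= t <= 1 -> f t != 0.
  move=> /andP[t0 t1]; rewrite -unitfE -unitmxE; apply: posdef_unitmx => y y0.
  have yy : 0 < (y *m y^T) 0 0.
    have [i yi] : exists i, y 0 i != 0.
      by apply/existsP; apply: contra_neqT y0; rewrite negb_exists => /forallP yi;
        apply/rowP => i; rewrite mxE; apply/eqP; rewrite -[_ == _]negbK.
    rewrite mxE (bigD1 i)//= mxE ltr_pwDl//.
      by rewrite -expr2 exprn_even_gt0.
    by apply: sumr_ge0 => j _; rewrite mxE -expr2 sqr_ge0.
  rewrite mulmxDr mulmxDl mul_mx_scalar -scalemxAr -!scalemxAl 2!mxE [X in _ + X]mxE.
  have yAy := pA y y0; have [->|t_neq0] := eqVneq t 0.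
    by rewrite subr0 mul1r mul0r addr0.
  rewrite ltr_wpDl//; last by rewrite mulr_gt0// lt_neqAle eq_sym t_neq0.
  by rewrite mulr_ge0 ?subr_ge0// ltW.
have cf : continuous f.
  pose P : 'M[{poly R}]_n := (1 - 'X)%:M + 'X *: map_mx polyC A.
  have -> : f = horner (\det P).
    apply/funext => t; rewrite /f -/(horner_eval t _) -det_map_mx; congr (\det _).
    apply/matrixP => i j; rewrite !mxE /= /horner_eval !hornerE /= !hornerMn !hornerE.
    by rewrite mulrC.
  exact: continuous_horner.
have f0 : f 0 = 1 by rewrite /f subr0 scale0r addr0 det1.
have f1 : f 1 = \det A by rewrite /f subrr scale1r raddf0 add0r.
rewrite ltNge; apply/negP => dA.
have [||t t01 ft] := @IVT R f 0 1 0 ler01.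
- exact: continuous_subspaceT.
- by rewrite f0 f1 ge_min dA orbT le_max ler01.
by have := f_neq0 t; rewrite ft eqxx => /(_ t01).
Qed.

End positive_definite.

(** * Densities in charts and uniqueness of the volume measure *)

Section density.
Local Open Scope ereal_scope.
Context d (T : measurableType d) (R : realType) (mu : {measure set T -> \bar R}).

(** The proofs are arguments so that a measure instance can be attached to the head symbol. *)
Definition density_measure (f : T -> \bar R) of measurable_fun setT f & (forall x, 0 <= f x) :=
  fun A : set T => \int[mu]_(x in A) f x.

Variables (f : T -> \bar R) (mf : measurable_fun setT f) (f0 : forall x, 0 <= f x).
Let nu := density_measure mf f0.

Let nu0 : nu set0 = 0. Proof. exact: integral_set0. Qed.

Let nu_ge0 A : 0 <= nu A. Proof. by apply: integral_ge0 => x _; exact: f0. Qed.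

Let nu_sigma_additive : semi_sigma_additive nu.
Proof.
move=> /= A mA tA mUA; rewrite /nu /density_measure ge0_integral_bigcup//.
  by apply: is_cvg_ereal_nneg_natsum_cond => n _ _; exact: nu_ge0.
exact: measurable_funTS.
Qed.

HB.instance Definition _ := isMeasure.Build _ _ _ nu nu0 nu_ge0 nu_sigma_additive.

End density.

Lemma preimage_mem_true T (A : set T) : (fun x => x \in A) @^-1` [set true] = A.
Proof. by apply/seteqP; split=> x /=; [move=> /set_mem|move=> /mem_set]. Qed.

Section chart_density.
Context {R : realType} {n : nat} {M : manifold R n}.
Implicit Types (g : tensor M) (i : chart_index M).

Lemma chart_image_open i : open (chart_image i).
Proof. exact: open_chart_image. Qed.

Lemma chart_imageP i p : chart_dom i p -> chart_image i (chart i p).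
Proof. by move=> ip; exists p. Qed.

Lemma chart_inv_dom i x : chart_image i x -> chart_dom i (chart_inv i x).
Proof. by move=> [p ip <-]; rewrite chartK// inE. Qed.

Lemma chart_invK i x : chart_image i x -> chart i (chart_inv i x) = x.
Proof. by move=> [p ip <-]; rewrite chartK// inE. Qed.

(** Total version of the inverse chart: the value [point] outside the image is harmless because
    [chart_density] vanishes there. *)
Definition chart_param i (x : borel 'rV[R]_n) : borel M :=
  if x \in chart_image i then chart_inv i x else point.

Lemma measurable_chart_param i : measurable_fun setT (chart_param i).
Proof.
have mI : measurable (chart_image i : set (borel 'rV[R]_n)).
  by apply: borel_open; exact: chart_image_open.
apply: measurable_fun_if => //.
- apply: (measurable_fun_bool true); rewrite setTI.
  by rewrite preimage_mem_true.
- rewrite setTI preimage_mem_true.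
  apply: continuous_borel_on; first exact: chart_image_open.
  exact: chart_inv_continuous.
Qed.

Definition chart_density g i (x : borel 'rV[R]_n) : R :=
  if x \in chart_image i then Num.sqrt (\det (g i x)) else 0.

Lemma chart_density_ge0 g i x : 0 <= chart_density g i x.
Proof. by rewrite /chart_density; case: ifP => // _; exact: sqrtr_ge0. Qed.

Lemma measurable_chart_density g i :
  (forall a b, smooth_on (chart_image i) (fun x => g i x a b)) ->
  measurable_fun setT (chart_density g i).
Proof.
move=> sg.
have mI : measurable (chart_image i : set (borel 'rV[R]_n)).
  by apply: borel_open; exact: chart_image_open.
apply: measurable_fun_if => //.
- apply: (measurable_fun_bool true); rewrite setTI.
  by rewrite preimage_mem_true.
- rewrite setTI preimage_mem_true.
  apply: continuous_borel_realfun_on; first exact: chart_image_open.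
  move=> x /set_mem Ix; apply: continuous_comp; last exact: sqrt_continuous.
  apply: (smooth_on_continuous (U := chart_image i)) => //.
  by apply: smooth_on_det => //; exact: chart_image_open.
Qed.

(** Trades the image of [A] under the chart for a preimage under the measurable map [chart_param],
    which makes the integrand visibly measurable. *)
Lemma chart_densityE g i (A : set M) x : A `<=` chart_dom i ->
  \1_(chart i @` A) x * Num.sqrt (\det (g i x)) =
  \1_A (chart_param i x : M) * chart_density g i x.
Proof.
move=> Ai; rewrite /chart_density /chart_param !indicE.
case: ifPn => [/set_mem Ix|Ix]; last first.
  rewrite mulr0 memNset ?mul0r// => -[p Ap px].
  by move: Ix; rewrite notin_setE; apply; exists p => //; exact: Ai.
congr (_%:R * _); congr (nat_of_bool _).
apply/idP/idP => /set_mem H; apply/mem_set.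
  by case: H => p Ap <-; rewrite chartK ?inE//; exact: Ai.
by exists (chart_inv i x) => //; exact: chart_invK.
Qed.

Lemma is_volume_density g m i (A : set (borel M)) : is_volume g m -> measurable A ->
  m (A `&` chart_dom i) =
  integral_rV (fun x => (\1_A (chart_param i x : M) * chart_density g i x)%:E).
Proof.
move=> vm mA; have mD : measurable (chart_dom i : set (borel M)).
  by apply: borel_open; exact: open_chart_dom.
rewrite (vm i); [|exact: measurableI|exact: subIsetr].
congr integral_rV; apply/funext => x; congr EFin.
rewrite (chart_densityE g (A := A `&` chart_dom i)); last exact: subIsetr.
rewrite /chart_density /chart_param; case: ifPn => [/set_mem Ix|_]; last by rewrite !mulr0.
congr (_ * _); rewrite !indicE; congr (_%:R); congr (nat_of_bool _).
rewrite in_setI [X in _ && X]mem_set ?andbT//; exact: chart_inv_dom.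
Qed.

Lemma measurable_chart_density_indic g i (A : set (borel M)) :
  (forall a b, smooth_on (chart_image i) (fun x => g i x a b)) -> measurable A ->
  measurable_fun setT (fun x => (\1_A (chart_param i x : M) * chart_density g i x)%:E).
Proof.
move=> sg mA; apply/measurable_EFinP; apply: measurable_funM; last exact: measurable_chart_density.
by apply: (measurableT_comp _ (measurable_chart_param i)); exact: measurable_indic.
Qed.

Lemma volumeP g : is_volume g (volume g) \/ volume g = mzero :> (set (borel M) -> \bar R).
Proof. by rewrite /volume; case: pselect => [e|_]; [left; case: cid|right]. Qed.

(** [is_volume] prescribes a measure inside single charts only. Compactness gives finitely many
    charts that cover; cutting [A] along one of them at a time leaves pieces on which both measures
    are the same integral. *)
Lemma is_volume_unique g (m m' : {measure set (borel M) -> \bar R}) : compact [set: M] ->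
  is_volume g m -> is_volume g m' -> forall A, measurable A -> m A = m' A.
Proof.
move=> cM vm vm'.
have /choice[c cP] := @chart_dom_cover _ _ M.
have [D _ Dcover] : finite_subset_cover [set: M] (fun p => chart_dom (c p)) [set: M].
  move: cM; rewrite compact_cover; apply => [p _|p _]; first exact: open_chart_dom.
  by exists p => //; exact: cP.
have main (s : seq M) (A : set (borel M)) : measurable A ->
    A `<=` [set p | exists2 q, q \in s & chart_dom (c q) p] -> m A = m' A.
  elim: s A => [|q s IH] A mA As.
    rewrite (_ : A = set0) ?measure0//.
    by apply/seteqP; split=> // p /As[].
  have mD : measurable (chart_dom (c q) : set (borel M)) by apply: borel_open; exact: open_chart_dom.
  rewrite (measureDI m mA mD) (measureDI m' mA mD); congr (_ + _)%E.
    apply: IH; first exact: measurableD.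
    move=> p [Ap Dp]; have [r] := As p Ap.
    by rewrite inE => /predU1P[->//|rs rp]; exists r.
  have mAD : measurable (A `&` chart_dom (c q)) by exact: measurableI.
  by apply: etrans (vm (c q) _ mAD _) (esym (vm' (c q) _ mAD _)); exact: subIsetr.
move=> A mA; apply: (main (finmap.enum_fset D)) => // p _.
by have [q /= qD qp] := Dcover p Logic.I; exists q.
Qed.

End chart_density.

Arguments chart_image_open {R n M} i.

(** * The volume measure of a product metric *)

Section product_volume.
Context {R : realType} {v w : nat} {V : manifold R v} {W : manifold R w}.
Variables (g : tensor V) (h : tensor W).
Hypotheses (rg : riemannian_metric g) (rh : riemannian_metric h).
Variables (m1 : {finite_measure set (borel V) -> \bar R})
          (m2 : {finite_measure set (borel W) -> \bar R}).
Hypotheses (vm1 : is_volume g m1) (vm2 : is_volume h m2).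

Let VW := prod_manifold V W.

(** This is what allows the product measure, defined on the product sigma-algebra, to be pushed
    forward to the Borel sets of the product manifold. *)
Lemma measurable_borel_prod : measurable_fun setT (id : borel V * borel W -> borel VW).
Proof.
apply: measurable_fun_borel => A oA; rewrite setTI.
have -> : id @^-1` A = [set z : borel V * borel W | A (z.1, z.2)] by apply/seteqP; split=> -[].
apply: (@measurable_open_prod V W _ _ (borel V) (borel W) id id A) => //.
- exact: manifold_second_countable.
- exact: manifold_second_countable.
- by move=> B; exact: borel_open.
- by move=> B; exact: borel_open.
Qed.

Definition prod_volume : {measure set (borel VW) -> \bar R} :=
  measure_function_pushforward__canonical__measure_function_Measure
    (m1 \x m2)%E measurable_borel_prod.

Lemma measurable_borel_prodE (A : set (borel VW)) : measurable A ->
  measurable (A : set (borel V * borel W)).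
Proof. by move=> mA; rewrite -[X in measurable X]setTI; exact: measurable_borel_prod. Qed.

Lemma prod_chart_image (i : chart_index VW) z : chart_image i z <->
  chart_image i.1 (lsubmx z) /\ chart_image i.2 (rsubmx z).
Proof.
split=> [[p [p1 p2] <-]|[[p p1 pz] [q q2 qz]]].
  by rewrite /chart /= row_mxKl row_mxKr; split; [exists p.1|exists p.2].
by exists (p, q) => //; rewrite /chart /= pz qz hsubmxK.
Qed.

Let sg i a b : smooth_on (chart_image i) (fun x => g i x a b).
Proof. by case: rg => + _ _ _; exact. Qed.

Let sh i a b : smooth_on (chart_image i) (fun x => h i x a b).
Proof. by case: rh => + _ _ _; exact. Qed.

Section one_chart.
Variable i : chart_index VW.

Let param (z : borel 'rV[R]_(v + w)) : borel V * borel W :=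
  (chart_param i.1 (lsubmx (z : 'rV[R]_(v + w))), chart_param i.2 (rsubmx (z : 'rV[R]_(v + w)))).

Let density (z : borel 'rV[R]_(v + w)) : R :=
  chart_density g i.1 (lsubmx (z : 'rV[R]_(v + w))) *
  chart_density h i.2 (rsubmx (z : 'rV[R]_(v + w))).

Let measurable_lsubmx : measurable_fun setT (lsubmx : borel 'rV[R]_(v + w) -> borel 'rV[R]_v).
Proof. by apply: continuous_borel_on; [exact: openT|move=> x _; exact: continuous_lsubmx]. Qed.

Let measurable_rsubmx : measurable_fun setT (rsubmx : borel 'rV[R]_(v + w) -> borel 'rV[R]_w).
Proof. by apply: continuous_borel_on; [exact: openT|move=> x _; exact: continuous_rsubmx]. Qed.

Let measurable_param : measurable_fun setT param.
Proof.
apply: measurable_fun_pair.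
  exact: (measurableT_comp (measurable_chart_param i.1) measurable_lsubmx).
exact: (measurableT_comp (measurable_chart_param i.2) measurable_rsubmx).
Qed.

Let measurable_density : measurable_fun setT (fun z => (density z)%:E).
Proof.
apply/measurable_EFinP; apply: measurable_funM.
  exact: (measurableT_comp (measurable_chart_density (sg _)) measurable_lsubmx).
exact: (measurableT_comp (measurable_chart_density (sh _)) measurable_rsubmx).
Qed.

Let density_ge0 z : (0 <= (density z)%:E)%E.
Proof. by rewrite lee_fin mulr_ge0 ?chart_density_ge0. Qed.

Let prod_densityE z : chart_image i z ->
  Num.sqrt (\det (prod_metric g h i z)) = density z.
Proof.
move=> /prod_chart_image[Iz Jz]; rewrite /prod_metric det_ublock.
case: rg => _ _ pg _; have dg := posdef_det_gt0 (pg _ _ Iz).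
by rewrite sqrtrM ?ltW// /density /chart_density !mem_set.
Qed.

Let prod_paramE z : chart_image i z -> param z = chart_inv i z.
Proof. by move=> /prod_chart_image[Iz Jz]; rewrite /param /chart_param !mem_set. Qed.

Let density_out z : ~ chart_image i z -> density z = 0.
Proof.
move=> /prod_chart_image nz; rewrite /density /chart_density.
case: ifPn => [Iz|_]; last by rewrite mul0r.
case: ifPn => [Jz|_]; last by rewrite mulr0.
by exfalso; apply: nz; split; exact/set_mem.
Qed.

(** The right-hand side defines a measure [nu] on the product. The determinant of a block-diagonal
    matrix is the product of those of the blocks, so on boxes [nu] factors into the volumes of the
    sides inside the chart domains; uniqueness of product measures does the rest. *)
Lemma prod_volume_chart (A : set (borel VW)) : measurable A -> A `<=` chart_dom i ->
  (m1 \x m2)%E A = integral_rV (fun z =>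
    (\1_(chart i @` A) z * Num.sqrt (\det (prod_metric g h i z)))%:E).
Proof.
move=> mA Ai; have mA' := measurable_borel_prodE mA.
have mD1 : measurable (chart_dom i.1 : set (borel V)).
  by apply: borel_open; exact: open_chart_dom.
have mD2 : measurable (chart_dom i.2 : set (borel W)).
  by apply: borel_open; exact: open_chart_dom.
have [mu muE] := @integral_rV_measure R (v + w).
have [mu1 mu1E] := @integral_rV_measure R v.
have [mu2 mu2E] := @integral_rV_measure R w.
pose dens : {measure set (borel 'rV[R]_(v + w)) -> \bar R} :=
  density_measure mu measurable_density density_ge0.
pose nu : {measure set (borel V * borel W)%type -> \bar R} :=
  measure_function_pushforward__canonical__measure_function_Measure dens measurable_param.
have nuE (B : set (borel V * borel W)%type) : measurable B ->
    nu B = integral_rV (fun z => (\1_B (param z) * density z)%:E).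
  move=> mB; rewrite muE; last 2 first.
  - apply/measurable_EFinP; apply: measurable_funM; last exact/measurable_EFinP.
    exact: (measurableT_comp (measurable_indic mB) measurable_param).
  - by move=> z; rewrite lee_fin mulr_ge0// -lee_fin.
  change ((\int[mu]_(z in param @^-1` B) (density z)%:E)%E =
    (\int[mu]_z (\1_B (param z) * density z)%:E)%E).
  rewrite integral_mkcond; apply: eq_integral => z _.
  rewrite /patch indicE; case: ifPn => [/set_mem Bz|Bz].
    by rewrite mem_set// mul1r.
  by rewrite memNset ?mul0r// => Bz'; move/negP: Bz; apply; exact/mem_set.
pose m1' : {finite_measure set (borel V) -> \bar R} := mrestr m1 mD1.
pose m2' : {finite_measure set (borel W) -> \bar R} := mrestr m2 mD2.
have U1 : (m1' \x m2')%E A = nu A.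
  apply: product_measure_unique => // B C mB mC.
  rewrite nuE; last exact: measurableX.
  rewrite integral_rV_row_mx.
  have m2E : m2' C = integral_rV (fun y => (\1_C (chart_param i.2 y : W) * chart_density h i.2 y)%:E).
    exact: (is_volume_density i.2 vm2).
  have m1E : m1' B = integral_rV (fun x => (\1_B (chart_param i.1 x : V) * chart_density g i.1 x)%:E).
    exact: (is_volume_density i.1 vm1).
  have mf1 := measurable_chart_density_indic (i := i.1) (sg _) mB.
  have mf2 := measurable_chart_density_indic (i := i.2) (sh _) mC.
  have ge1 x : (0 <= (\1_B (chart_param i.1 x : V) * chart_density g i.1 x)%:E)%E.
    by rewrite lee_fin mulr_ge0// chart_density_ge0.
  have ge2 y : (0 <= (\1_C (chart_param i.2 y : W) * chart_density h i.2 y)%:E)%E.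
    by rewrite lee_fin mulr_ge0// chart_density_ge0.
  transitivity (integral_rV (fun x =>
      (\1_B (chart_param i.1 x : V) * chart_density g i.1 x)%:E * m2' C)%E).
    congr integral_rV; apply/funext => x; rewrite m2E.
    rewrite [in RHS](mu2E _ mf2 ge2) -ge0_integralZl_EFin//; last first.
      by rewrite mulr_ge0// chart_density_ge0.
    rewrite -mu2E.
    - congr integral_rV; apply/funext => y; rewrite /param /density row_mxKl row_mxKr -EFinM.
      congr EFin; rewrite -!mulrA; rewrite [X in X * _ = _](_ : _ =
        \1_B (chart_param i.1 x : V) * \1_C (chart_param i.2 y : W)).
        by rewrite -!mulrA; congr (_ * _); rewrite mulrCA.
      by rewrite !indicE in_setX /= -natrM mulnb.
    - by apply: emeasurable_funM.
    - by move=> y; rewrite mule_ge0.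
  rewrite mu1E.
  - rewrite ge0_integralZr// ?measure_ge0// -mu1E// -m1E//.
  - by apply: emeasurable_funM.
  - by move=> x; rewrite mule_ge0// measure_ge0.
(* Uniqueness once more: the restriction of the product to the chart box is the product of the
   restrictions. *)
have U2 : (m1' \x m2')%E A = (m1 \x m2)%E A.
  pose m12 : {measure set (borel V * borel W)%type -> \bar R} :=
    mrestr (m1 \x m2)%E (measurableX mD1 mD2).
  rewrite (@product_measure_unique _ _ _ _ _ m1' m2' m12)//.
    change ((m1 \x m2)%E (A `&` (chart_dom i.1 `*` chart_dom i.2)) = (m1 \x m2)%E A).
    by rewrite setIidl.
  move=> B C mB mC.
  change ((m1 \x m2)%E ((B `*` C) `&` (chart_dom i.1 `*` chart_dom i.2)) =
    m1 (B `&` chart_dom i.1) * m2 (C `&` chart_dom i.2))%E.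
  by rewrite -setXI product_measure1E//; exact: measurableI.
rewrite -U2 U1 nuE//; congr integral_rV; apply/funext => z; congr EFin.
have [Iz|Iz] := pselect (chart_image i z); last first.
  rewrite density_out// mulr0 indicE memNset ?mul0r// => -[p Ap pz].
  by apply: Iz; exists p => //; exact: Ai.
rewrite prod_densityE// prod_paramE// !indicE; congr (_%:R * _); congr (nat_of_bool _).
apply/idP/idP => /set_mem H; apply/mem_set.
  by exists (chart_inv i z) => //; exact: (chart_invK (M := VW)).
by case: H => p Ap <-; rewrite (chartK (m := VW)) ?inE//; exact: Ai.
Qed.

End one_chart.

Lemma is_volume_prod : is_volume (prod_metric g h) prod_volume.
Proof. by move=> i A mA Ai; exact: prod_volume_chart. Qed.

End product_volume.

(** * Gradients and scalar curvature in charts *)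

Section charts.
Context {R : realType} {n : nat} {M : manifold R n}.
Implicit Types (g : tensor M) (i j : chart_index M) (u : M -> R).

Lemma glueE (f : chart_index M -> 'rV[R]_n -> R) (s : M -> R) :
  (forall i p, chart_dom i p -> s p = f i (chart i p)) -> glue f = s.
Proof.
move=> sf; rewrite /glue; case: xgetP => [s' _ /= s'f|/(_ s)]; last by move=> /(_ sf).
apply/funext => p; have [i ip] := chart_dom_cover p.
by rewrite (s'f i)// (sf i).
Qed.

Lemma glue_chart (f : chart_index M -> 'rV[R]_n -> R) :
  (forall i j p, chart_dom i p -> chart_dom j p -> f i (chart i p) = f j (chart j p)) ->
  forall i p, chart_dom i p -> glue f p = f i (chart i p).
Proof.
move=> ff i p ip; have /choice[c cP] := @chart_dom_cover _ _ M.
rewrite (@glueE f (fun q => f (c q) (chart (c q) q))); first exact: ff.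
by move=> j q jq; exact: ff.
Qed.

Lemma continuous_charts (f : chart_index M -> 'rV[R]_n -> R) (s : M -> R) :
  (forall i p, chart_dom i p -> s p = f i (chart i p)) ->
  (forall i x, chart_image i x -> {for x, continuous (f i)}) -> continuous s.
Proof.
move=> sf cf p; have [i ip] := chart_dom_cover p.
have H : {for p, continuous (f i \o chart i)}.
  apply: continuous_comp; first by apply: chart_continuous; rewrite inE.
  by apply: cf; exact: chart_imageP.
move: H; rewrite /prop_for /continuous_at /= -sf// => H.
apply: cvg_trans H; apply: (near_eq_cvg (F := nbhs p)).
by apply: filterS (open_nbhs_nbhs (conj (open_chart_dom i) ip)) => q /= /sf ->.
Qed.

Lemma open_chart_overlap i j : open (chart i @` (chart_dom i `&` chart_dom j)).
Proof.
have -> : chart i @` (chart_dom i `&` chart_dom j) =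
    chart_image i `&` chart_inv i @^-1` chart_dom j.
  apply/seteqP; split=> [_ [p [ip jp] <-]|x [Ix jx]].
    by split; [exact: chart_imageP|rewrite /= chartK ?inE].
  exists (chart_inv i x); last exact: chart_invK.
  by split=> //; exact: chart_inv_dom.
apply: open_within_preimage; [exact: chart_image_open|exact: chart_inv_continuous|].
exact: open_chart_dom.
Qed.

Arguments open_chart_overlap : clear implicits.

Lemma riemannian_smooth g : riemannian_metric g ->
  forall i a b, smooth_on (chart_image i) (fun x => g i x a b).
Proof. by case. Qed.

Lemma riemannian_unitmx g : riemannian_metric g ->
  forall i x, chart_image i x -> g i x \in unitmx.
Proof. by move=> [_ _ pg _] i x Ix; exact/posdef_unitmx/pg. Qed.

Lemma transition_differentiable i j p : chart_dom i p -> chart_dom j p ->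
  differentiable (chart j \o chart_inv i) (chart i p).
Proof.
move=> ip jp; apply: differentiable_rV => b.
have H := smooth_on_differentiable (open_chart_overlap i j) (@transition_smooth _ _ M i j b).
by apply: H; exists p.
Qed.

Lemma partial_transition i j p u a : smooth u -> chart_dom i p -> chart_dom j p ->
  partial a (u \o chart_inv i) (chart i p) =
  \sum_b jacobian (chart j \o chart_inv i) (chart i p) a b *
         partial b (u \o chart_inv j) (chart j p).
Proof.
move=> su ip jp.
have Tp : (chart j \o chart_inv i) (chart i p) = chart j p by rewrite /= chartK ?inE.
have := @partial_comp R n n (chart j \o chart_inv i) (u \o chart_inv j) (chart i p) a
  (transition_differentiable ip jp).
rewrite Tp => <-; last first.
  exact: (smooth_on_differentiable (chart_image_open j) (su j) (chart_imageP jp)).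
apply: partial_near.
have : (chart i @` (chart_dom i `&` chart_dom j)) (chart i p) by exists p.
move=> /(near_open (open_chart_overlap i j)); apply: filterS => _ [q [iq jq] <-].
by rewrite /= !chartK ?inE// chartK ?inE.
Qed.

Definition grad_sq_expr g u i (x : 'rV[R]_n) : R := \sum_a \sum_b
  invmx (g i x) a b * partial a (u \o chart_inv i) x * partial b (u \o chart_inv i) x.

Lemma quadratic_form_sum (A : 'M[R]_n) (c : 'cV[R]_n) :
  \sum_a \sum_b A a b * c a 0 * c b 0 = (c^T *m A *m c) 0 0.
Proof.
rewrite mxE exchange_big; apply: eq_bigr => b _; rewrite mxE big_distrl /=.
by apply: eq_bigr => a _; rewrite mxE; ring.
Qed.

(** Under a change of charts with Jacobian [J] the column of partials is multiplied by [J] and the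
    metric becomes [J *m g *m J^T], so the inverse metric contracted with the partials is unchanged
    and the chart expressions glue. *)
Lemma grad_sq_chart g u : riemannian_metric g -> smooth u ->
  forall i p, chart_dom i p -> grad_sq g u p = grad_sq_expr g u i (chart i p).
Proof.
move=> rg su; apply: glue_chart => i j p ip jp.
pose c k : 'cV[R]_n := \col_a partial a (u \o chart_inv k) (chart k p).
have E k : \sum_a \sum_b invmx (g k (chart k p)) a b * partial a (u \o chart_inv k) (chart k p)
    * partial b (u \o chart_inv k) (chart k p) = ((c k)^T *m invmx (g k (chart k p)) *m c k) 0 0.
  by rewrite -quadratic_form_sum; apply: eq_bigr => a _; apply: eq_bigr => b _; rewrite !mxE.
rewrite !E; set J := jacobian (chart j \o chart_inv i) (chart i p).
have cJ : c i = J *m c j.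
  apply/colP => a; rewrite !mxE (partial_transition (j := j))//.
  by apply: eq_bigr => b _; rewrite !mxE.
have gJ : g i (chart i p) = J *m g j (chart j p) *m J^T.
  case: rg => _ _ _ /(_ i j (chart i p)); rewrite /= chartK ?inE//; apply.
  by exists p.
have ug := riemannian_unitmx rg (chart_imageP jp).
have := riemannian_unitmx rg (chart_imageP ip).
rewrite gJ !unitmx_mul unitmx_tr => /andP[/andP[uJ _] _].
rewrite cJ; congr (fun_of_matrix _ 0 0).
have -> : invmx (J *m g j (chart j p) *m J^T) = invmx J^T *m invmx (g j (chart j p)) *m invmx J.
  have uJT : J^T \in unitmx by rewrite unitmx_tr.
  have uu : J *m g j (chart j p) *m J^T \in unitmx by rewrite !unitmx_mul uJ ug uJT.
  apply: (can_inj (mulKmx uu)); rewrite mulmxV// !mulmxA mulmxK// mulmxK//.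
  by rewrite mulmxV.
by rewrite trmx_mul !mulmxA mulmxKV// mulmxK ?unitmx_tr.
Qed.

Lemma smooth_cst (c : R) : smooth (fun _ : M => c).
Proof. by move=> i; exact: smooth_on_cst. Qed.

Lemma smoothD u1 u2 : smooth u1 -> smooth u2 -> smooth (fun p => u1 p + u2 p).
Proof. by move=> s1 s2 i; exact: (smooth_onD (chart_image_open i) (s1 i) (s2 i)). Qed.

Lemma smoothM u1 u2 : smooth u1 -> smooth u2 -> smooth (fun p => u1 p * u2 p).
Proof. by move=> s1 s2 i; exact: (smooth_onM (chart_image_open i) (s1 i) (s2 i)). Qed.

Lemma smooth_continuous u : smooth u -> continuous u.
Proof.
move=> su; apply: (continuous_charts (f := fun i => u \o chart_inv i)).
  by move=> i p ip; rewrite /= chartK ?inE.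
by move=> i x; exact: smooth_on_continuous.
Qed.

Lemma smooth_grad_sq_expr g u i : riemannian_metric g -> smooth u ->
  smooth_on (chart_image i) (grad_sq_expr g u i).
Proof.
move=> rg su; have oI := chart_image_open i.
do 2 (apply: smooth_on_sum => // ?).
apply: smooth_onM => //; last exact/smooth_on_partial/su.
apply: smooth_onM => //; last exact/smooth_on_partial/su.
apply: smooth_on_invmx => //; first exact: riemannian_unitmx.
exact: riemannian_smooth.
Qed.

Lemma continuous_grad_sq g u : riemannian_metric g -> smooth u -> continuous (grad_sq g u).
Proof.
move=> rg su; apply: (continuous_charts (f := grad_sq_expr g u)).
  by move=> i p ip; exact: grad_sq_chart.
by move=> i x; apply: smooth_on_continuous; exact: smooth_grad_sq_expr.
Qed.

(** Serves for constants, with [t = 0], and for the variation [1 + t s] of the constant function. *)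
Lemma grad_sq_affine g u (c t : R) : riemannian_metric g -> smooth u ->
  grad_sq g (fun p => c + t * u p) = (fun p => t ^+ 2 * grad_sq g u p).
Proof.
move=> rg su; apply/funext => p; have [i ip] := chart_dom_cover p.
have sc := smooth_cst c; have stu := smoothM (smooth_cst t) su.
rewrite (grad_sq_chart rg (smoothD sc stu) ip) (grad_sq_chart rg su ip) /grad_sq_expr.
have E a : partial a ((fun p => c + t * u p) \o chart_inv i) (chart i p) =
    t * partial a (u \o chart_inv i) (chart i p).
  have Ip := chart_imageP ip.
  have du := smooth_on_derivable (a := a) (su i) Ip.
  rewrite /partial -[LHS]/('D_(delta_mx 0 a) (cst c + t *: (u \o chart_inv i)) (chart i p)).
  by rewrite (deriveD (derivable_cst c _ _) (derivableZ (k := t) du)) derive_cst add0r (deriveZ t du).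
rewrite big_distrr /=; apply: eq_bigr => a _; rewrite big_distrr /=; apply: eq_bigr => b _.
rewrite !E; move: (invmx _ a b) (partial a _ _) (partial b _ _) => x y z; ring.
Qed.

Definition scalar_expr (G : 'rV[R]_n -> 'M[R]_n) (x : 'rV[R]_n) : R :=
  \sum_a \sum_b invmx (G x) a b * ricci G a b x.

Lemma smooth_scalar_expr g i : riemannian_metric g ->
  smooth_on (chart_image i) (scalar_expr (g i)).
Proof.
move=> rg; have oI := chart_image_open i.
have sinv a b : smooth_on (chart_image i) (fun x => invmx (g i x) a b).
  by apply: smooth_on_invmx => //; [exact: riemannian_unitmx|exact: riemannian_smooth].
have sG c a b : smooth_on (chart_image i) (christoffel (g i) c a b).
  apply: smooth_onM => //; first exact: smooth_on_cst.
  apply: smooth_on_sum => // d; apply: smooth_onM => //.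
  apply: smooth_onB => //; last exact/smooth_on_partial/riemannian_smooth.
  by apply: smooth_onD => //; exact/smooth_on_partial/riemannian_smooth.
do 2 (apply: smooth_on_sum => // ?); apply: smooth_onM => //.
apply: smooth_on_sum => // c; apply: smooth_onD => //.
  by apply: smooth_onB => //; exact: smooth_on_partial.
by apply: smooth_on_sum => // d; apply: smooth_onB => //; exact: smooth_onM.
Qed.

(* If the chart expressions were incompatible, [glue] would return its junk value 0. *)
Lemma scalar_curvature_chart g : scalar_curvature g <> cst 0 ->
  forall i p, chart_dom i p -> scalar_curvature g p = scalar_expr (g i) (chart i p).
Proof.
rewrite /scalar_curvature /glue; case: xgetP => [s _ /= sE _|//].
exact: sE.
Qed.

Lemma smooth_scalar_curvature g : riemannian_metric g -> scalar_curvature g <> cst 0 ->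
  smooth (scalar_curvature g).
Proof.
move=> rg s0 i; have := smooth_scalar_expr i rg.
apply: smooth_on_ext (chart_image_open i) _ => x Ix.
rewrite /= (scalar_curvature_chart s0 (chart_inv_dom Ix)).
by rewrite chart_invK.
Qed.

End charts.

(** * Partials along projections and slice inclusions *)

Section affine_partials.
Context {R : realType}.

(** The difference quotients themselves coincide, so derivability and the value of a partial
    transfer together. The maps in view are the projections [lsubmx], [rsubmx] and the inclusions of
    slices by [row_mx]. *)
Lemma growth_rate_affine m n (A : 'rV[R]_m -> 'rV[R]_n) (e : 'rV[R]_m) (e' : 'rV[R]_n)
    (f : 'rV[R]_n -> R) x : (forall (h : R) x, A (h *: e + x) = h *: e' + A x) ->
  (fun h : R => h^-1 *: (((f \o A) \o shift x) (h *: e) - (f \o A) x)) =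
  (fun h : R => h^-1 *: ((f \o shift (A x)) (h *: e') - f (A x))).
Proof. by move=> hA; apply/funext => h; rewrite /comp /shift hA. Qed.

Lemma partial_affine m n (A : 'rV[R]_m -> 'rV[R]_n) a b (f : 'rV[R]_n -> R) x :
  (forall (h : R) x, A (h *: delta_mx 0 a + x) = h *: delta_mx 0 b + A x) ->
  partial a (f \o A) x = partial b f (A x).
Proof. by move=> hA; rewrite /partial /derive (growth_rate_affine f x hA). Qed.

Lemma partial_affine0 m n (A : 'rV[R]_m -> 'rV[R]_n) a (f : 'rV[R]_n -> R) x :
  (forall (h : R) x, A (h *: delta_mx 0 a + x) = A x) -> partial a (f \o A) x = 0.
Proof.
move=> hA; rewrite /partial /derive (growth_rate_affine (e' := 0) f x); last first.
  by move=> h y; rewrite hA scaler0 add0r.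
rewrite (_ : (fun h : R => _) = fun=> 0) ?lim_cst//.
by apply/funext => h /=; rewrite scaler0 add0r subrr scaler0.
Qed.

(** Slice inclusions are affine rather than linear, hence this companion of [smooth_upto_comp]; [s]
    tells to which coordinate direction each direction is sent. *)
Lemma smooth_on_affine m n (A : 'rV[R]_m -> 'rV[R]_n) (s : 'I_m -> 'I_n) U
    (f : 'rV[R]_n -> R) : continuous A ->
  (forall a (h : R) x, A (h *: delta_mx 0 a + x) = h *: delta_mx 0 (s a) + A x) ->
  smooth_on U f -> smooth_on (A @^-1` U) (f \o A).
Proof.
move=> cA hA sf k; move: (sf k) => {sf}; elim: k f => [|k IH] f /= [cf H].
  by split=> // x /set_mem Ux; apply: continuous_comp; [exact: cA|exact/cf/mem_set].
split=> [x /set_mem Ux|a].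
  by apply: continuous_comp; [exact: cA|exact/cf/mem_set].
have [df sf] := H (s a); split=> [x /set_mem Ux|].
  by rewrite /derivable (growth_rate_affine f x (hA a)); exact/df/mem_set.
rewrite (_ : partial a (f \o A) = partial (s a) f \o A); first exact: IH.
by apply/funext => x; exact: partial_affine.
Qed.

Lemma lsubmx_shift_l v w (a : 'I_v) (h : R) (x : 'rV[R]_(v + w)) :
  lsubmx (h *: delta_mx 0 (lshift w a) + x) = h *: delta_mx 0 a + lsubmx x.
Proof. by apply/rowP => j; rewrite !mxE /= eq_lshift. Qed.

Lemma lsubmx_shift_r v w (a : 'I_w) (h : R) (x : 'rV[R]_(v + w)) :
  lsubmx (h *: delta_mx 0 (rshift v a) + x) = lsubmx x.
Proof. by apply/rowP => j; rewrite !mxE /= eq_lrshift mulr0 add0r. Qed.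

Lemma rsubmx_shift_r v w (a : 'I_w) (h : R) (x : 'rV[R]_(v + w)) :
  rsubmx (h *: delta_mx 0 (rshift v a) + x) = h *: delta_mx 0 a + rsubmx x.
Proof. by apply/rowP => j; rewrite !mxE /= eq_rshift. Qed.

Lemma rsubmx_shift_l v w (a : 'I_v) (h : R) (x : 'rV[R]_(v + w)) :
  rsubmx (h *: delta_mx 0 (lshift w a) + x) = rsubmx x.
Proof. by apply/rowP => j; rewrite !mxE /= eq_rlshift mulr0 add0r. Qed.

Lemma row_mx_shift_l v w (c : 'rV[R]_w) (a : 'I_v) (h : R) (x : 'rV[R]_v) :
  row_mx (h *: delta_mx 0 a + x) c = h *: delta_mx 0 (lshift w a) + row_mx x c.
Proof.
apply/rowP => j; rewrite -(splitK j); case: (fintype.split j) => k /=; rewrite !mxE.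
  by rewrite (unsplitK (inl k)) !mxE eq_lshift.
by rewrite (unsplitK (inr k)) eq_rlshift mulr0 add0r.
Qed.

Lemma row_mx_shift_r v w (c : 'rV[R]_v) (a : 'I_w) (h : R) (x : 'rV[R]_w) :
  row_mx c (h *: delta_mx 0 a + x) = h *: delta_mx 0 (rshift v a) + row_mx c x.
Proof.
apply/rowP => j; rewrite -(splitK j); case: (fintype.split j) => k /=; rewrite !mxE.
  by rewrite (unsplitK (inl k)) eq_lrshift mulr0 add0r.
by rewrite (unsplitK (inr k)) !mxE eq_rshift.
Qed.

End affine_partials.

(** * Multiplying a metric by a constant *)

Section scaling.
Context {R : realType} {n : nat} {M : manifold R n}.
Variables (g : tensor M) (lam : R).
Hypotheses (rg : riemannian_metric g) (lam0 : 0 < lam).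

Lemma riemannian_scale : riemannian_metric (scale_metric lam g).
Proof.
have [sg tg pg cg] := rg; split.
- move=> i a b; have := smooth_onM (chart_image_open i) (smooth_on_cst _ lam) (sg i a b).
  by apply: smooth_on_ext (chart_image_open i) _ => x _; rewrite /scale_metric mxE.
- by move=> i x Ix; rewrite /scale_metric linearZ /= tg.
- move=> i x Ix y y0; rewrite /scale_metric -scalemxAr -scalemxAl mxE mulr_gt0//.
  exact: pg.
- move=> i j x xij J; rewrite /scale_metric (cg i j x xij).
  by rewrite -scalemxAr -scalemxAl.
Qed.

Let invmx_scale i x : chart_image i x ->
  invmx (scale_metric lam g i x) = lam^-1 *: invmx (g i x).
Proof.
have lamU : lam \is a GRing.unit by rewrite unitfE gt_eqF.
by move=> Ix; rewrite invmxZ// unitmxZ//; exact: riemannian_unitmx.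
Qed.

Lemma grad_sq_scale u : smooth u ->
  grad_sq (scale_metric lam g) u = fun p => lam^-1 * grad_sq g u p.
Proof.
move=> su; apply/funext => p; have [i ip] := chart_dom_cover p.
rewrite (grad_sq_chart riemannian_scale su ip) (grad_sq_chart rg su ip) /grad_sq_expr.
rewrite big_distrr /=; apply: eq_bigr => a _; rewrite big_distrr /=; apply: eq_bigr => b _.
by rewrite invmx_scale ?mxE ?mulrA//; exact: chart_imageP.
Qed.

(** The factor [lam] of the partials of the metric cancels against the factor [lam^-1] of the
    inverse. *)
Lemma christoffel_scale i x c a b : chart_image i x ->
  christoffel (scale_metric lam g i) c a b x = christoffel (g i) c a b x.
Proof.
move=> Ix; rewrite /christoffel; congr (_ * _); apply: eq_bigr => d _.
rewrite invmx_scale// mxE.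
have E k a' b' : partial k (fun y => scale_metric lam g i y a' b') x =
    lam * partial k (fun y => g i y a' b') x.
  rewrite (_ : (fun y => _) = lam *: (fun y => g i y a' b')); last first.
    by apply/funext => y; rewrite /scale_metric mxE.
  have [sg _ _ _] := rg.
  exact: deriveZ (smooth_on_derivable (a := k) (sg i a' b') Ix).
by rewrite !E -mulrDr -mulrBr mulrACA mulVf ?mul1r// gt_eqF.
Qed.

(** The Christoffel symbols agree on the whole open chart image, so their partials and the Ricci
    tensor agree too; only the inverse metric in the trace contributes [lam^-1]. *)
Lemma scalar_expr_scale i x : chart_image i x ->
  scalar_expr (scale_metric lam g i) x = lam^-1 * scalar_expr (g i) x.
Proof.
move=> Ix.
have E k c a b : partial k (christoffel (scale_metric lam g i) c a b) x =
    partial k (christoffel (g i) c a b) x.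
  apply: partial_near; move: Ix => /(near_open (chart_image_open i)).
  by apply: filterS => y; exact: christoffel_scale.
rewrite big_distrr /=; apply: eq_bigr => a _; rewrite big_distrr /=; apply: eq_bigr => b _.
rewrite invmx_scale// mxE -mulrA; congr (_ * (_ * _)).
apply: eq_bigr => c _; rewrite !E; congr (_ + _); apply: eq_bigr => d _.
by rewrite !christoffel_scale.
Qed.

(** The determinant of an [n] by [n] matrix scales by [lam ^+ n], and the density is its square
    root. *)
Lemma is_volume_scale (c : {nonneg R}) (m : {measure set (borel M) -> \bar R}) :
  c%:num = Num.sqrt (lam ^+ n) -> is_volume g m ->
  is_volume (scale_metric lam g) (mscale c m).
Proof.
move=> cE vm i A mA Ai.
change ((c%:num)%:E * m A = integral_rV (fun x =>
  (\1_(chart i @` A) x * Num.sqrt (\det (scale_metric lam g i x)))%:E))%E.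
have [mu muE] := @integral_rV_measure R n.
have mf := measurable_chart_density_indic (i := i) (riemannian_smooth rg i) mA.
have f0 x : (0 <= (\1_A (chart_param i x : M) * chart_density g i x)%:E)%E.
  by rewrite lee_fin mulr_ge0// chart_density_ge0.
have E1 : m A = (\int[mu]_x (\1_A (chart_param i x : M) * chart_density g i x)%:E)%E.
  rewrite -muE// (vm i A mA Ai); congr integral_rV; apply/funext => x.
  by rewrite (chart_densityE g).
rewrite E1 -ge0_integralZl_EFin// -muE.
- congr integral_rV; apply/funext => x; rewrite -EFinM; congr EFin.
  rewrite -(chart_densityE g)// /scale_metric detZ sqrtrM ?exprn_ge0 ?ltW// -cE.
  by rewrite mulrCA.
- by apply: emeasurable_funM.
- by move=> x; rewrite mule_ge0.
Qed.

End scaling.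

(** * Curvature and gradients of a product metric *)

Section product.
Context {R : realType} {v w : nat} {V : manifold R v} {W : manifold R w}.
Let VW := prod_manifold V W.
Variables (g : tensor V) (h : tensor W).
Hypotheses (rg : riemannian_metric g) (rh : riemannian_metric h).
Implicit Types (i : chart_index VW) (z : 'rV[R]_(v + w)) (u : VW -> R).

Let invmx_prod i z : chart_image i z -> invmx (prod_metric g h i z) =
  block_mx (invmx (g i.1 (lsubmx z))) 0 0 (invmx (h i.2 (rsubmx z))).
Proof.
move=> /prod_chart_image[Iz Jz]; apply: invmx_block_diag.
by rewrite block_diag_mx_unit (riemannian_unitmx rg Iz) (riemannian_unitmx rh Jz).
Qed.

Section entries.
Variables (i : chart_index VW) (z : 'rV[R]_(v + w)).
Let G := prod_metric g h i.

Let Gll b d : (fun y => G y (lshift w b) (lshift w d)) = (fun x => g i.1 x b d) \o lsubmx.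
Proof. by apply/funext => y; rewrite /G /prod_metric block_mxEul. Qed.
Let Grr b d : (fun y => G y (rshift v b) (rshift v d)) = (fun x => h i.2 x b d) \o rsubmx.
Proof. by apply/funext => y; rewrite /G /prod_metric block_mxEdr. Qed.
Let Glr b d : (fun y => G y (lshift w b) (rshift v d)) = fun=> 0.
Proof. by apply/funext => y; rewrite /G /prod_metric block_mxEur mxE. Qed.
Let Grl b d : (fun y => G y (rshift v b) (lshift w d)) = fun=> 0.
Proof. by apply/funext => y; rewrite /G /prod_metric block_mxEdl mxE. Qed.

Let partial_cst0 a : partial a (fun=> 0) z = 0 :> R.
Proof. by rewrite /partial derive_cst. Qed.

Let partial_l_lsubmx (f : 'rV[R]_v -> R) a :
  partial (lshift w a) (f \o lsubmx) z = partial a f (lsubmx z).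
Proof. by apply: partial_affine => k x; exact: lsubmx_shift_l. Qed.

Let partial_r_lsubmx (f : 'rV[R]_v -> R) a : partial (rshift v a) (f \o lsubmx) z = 0.
Proof. by apply: partial_affine0 => k x; exact: lsubmx_shift_r. Qed.

Let partial_r_rsubmx (f : 'rV[R]_w -> R) a :
  partial (rshift v a) (f \o rsubmx) z = partial a f (rsubmx z).
Proof. by apply: partial_affine => k x; exact: rsubmx_shift_r. Qed.

Let partial_l_rsubmx (f : 'rV[R]_w -> R) a : partial (lshift w a) (f \o rsubmx) z = 0.
Proof. by apply: partial_affine0 => k x; exact: rsubmx_shift_l. Qed.

Let pE := (Gll, Grr, Glr, Grl, partial_cst0, partial_l_lsubmx, partial_r_lsubmx,
  partial_r_rsubmx, partial_l_rsubmx).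

Let christoffel_splitE c a b : christoffel G c a b z = 2^-1 *
  (\sum_d invmx (G z) c (lshift w d) *
     (partial a (fun y => G y b (lshift w d)) z + partial b (fun y => G y a (lshift w d)) z
      - partial (lshift w d) (fun y => G y a b) z) +
   \sum_d invmx (G z) c (rshift v d) *
     (partial a (fun y => G y b (rshift v d)) z + partial b (fun y => G y a (rshift v d)) z
      - partial (rshift v d) (fun y => G y a b) z)).
Proof. by rewrite /christoffel big_split_ord. Qed.

Hypothesis Iz : chart_image i z.

Let ill c d : invmx (G z) (lshift w c) (lshift w d) = invmx (g i.1 (lsubmx z)) c d.
Proof. by rewrite /G invmx_prod// block_mxEul. Qed.
Let irr c d : invmx (G z) (rshift v c) (rshift v d) = invmx (h i.2 (rsubmx z)) c d.
Proof. by rewrite /G invmx_prod// block_mxEdr. Qed.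
Let ilr c d : invmx (G z) (lshift w c) (rshift v d) = 0.
Proof. by rewrite /G invmx_prod// block_mxEur mxE. Qed.
Let irl c d : invmx (G z) (rshift v c) (lshift w d) = 0.
Proof. by rewrite /G invmx_prod// block_mxEdl mxE. Qed.

Lemma christoffel_prod_lll c a b : christoffel G (lshift w c) (lshift w a) (lshift w b) z =
  christoffel (g i.1) c a b (lsubmx z).
Proof.
rewrite christoffel_splitE [X in _ + X]big1 ?addr0; last by move=> d _; rewrite ilr mul0r.
by rewrite /christoffel; congr (_ * _); apply: eq_bigr => d _; rewrite ill !pE.
Qed.

Lemma christoffel_prod_rrr c a b : christoffel G (rshift v c) (rshift v a) (rshift v b) z =
  christoffel (h i.2) c a b (rsubmx z).
Proof.
rewrite christoffel_splitE [X in X + _]big1 ?add0r; last by move=> d _; rewrite irl mul0r.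
by rewrite /christoffel; congr (_ * _); apply: eq_bigr => d _; rewrite irr !pE.
Qed.

(** The metric and its inverse are block-diagonal and each block depends on its own coordinates
    only, so a symbol with indices from both factors has no surviving term. The six cases are
    bundled as one rewrite rule. *)
Lemma christoffel_prod_mixed :
  ((forall c a b, christoffel G (rshift v c) (lshift w a) (lshift w b) z = 0) *
   (forall c a b, christoffel G (lshift w c) (rshift v a) (rshift v b) z = 0) *
   (forall c a b, christoffel G (lshift w c) (lshift w a) (rshift v b) z = 0) *
   (forall c a b, christoffel G (lshift w c) (rshift v a) (lshift w b) z = 0) *
   (forall c a b, christoffel G (rshift v c) (lshift w a) (rshift v b) z = 0) *
   (forall c a b, christoffel G (rshift v c) (rshift v a) (lshift w b) z = 0))%type.
Proof.
by do ![split] => c a b; rewrite christoffel_splitE !big1 ?addr0 ?mulr0// => d _;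
  rewrite ?(ill, irr, ilr, irl) !pE ?subrr ?addr0 ?subr0 ?mulr0 ?mul0r.
Qed.

End entries.

Section curvature.
Variables (i : chart_index VW) (z : 'rV[R]_(v + w)).
Hypothesis Iz : chart_image i z.
Let G := prod_metric g h i.
Let mixed := christoffel_prod_mixed Iz.

Let nearI : \forall y \near z, chart_image i y.
Proof. exact: near_open (chart_image_open i) Iz. Qed.

Let partial0 k (f : 'rV[R]_(v + w) -> R) :
  (forall y, chart_image i y -> f y = 0) -> partial k f z = 0.
Proof.
move=> f0; rewrite -[RHS](_ : partial k (fun=> 0) z = 0); last by rewrite /partial derive_cst.
by apply: partial_near; apply: filterS nearI => y; exact: f0.
Qed.

Let partial_lll k c a b :
  partial (lshift w k) (christoffel G (lshift w c) (lshift w a) (lshift w b)) z =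
  partial k (christoffel (g i.1) c a b) (lsubmx z).
Proof.
rewrite -[RHS](@partial_affine _ _ _ lsubmx (lshift w k)); last first.
  by move=> ? ?; exact: lsubmx_shift_l.
by apply: partial_near; apply: filterS nearI => y Iy; exact: christoffel_prod_lll.
Qed.

Let partial_rrr k c a b :
  partial (rshift v k) (christoffel G (rshift v c) (rshift v a) (rshift v b)) z =
  partial k (christoffel (h i.2) c a b) (rsubmx z).
Proof.
rewrite -[RHS](@partial_affine _ _ _ rsubmx (rshift v k)); last first.
  by move=> ? ?; exact: rsubmx_shift_r.
by apply: partial_near; apply: filterS nearI => y Iy; exact: christoffel_prod_rrr.
Qed.

(** Any term with a summation index in the other factor contains a mixed Christoffel symbol or a
    partial of one, and these vanish near [z]. *)
Lemma ricci_prod_ll a b :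
  ricci G (lshift w a) (lshift w b) z = ricci (g i.1) a b (lsubmx z).
Proof.
rewrite /ricci big_split_ord /= [X in _ + X]big1 ?addr0 => [|c _].
  apply: eq_bigr => c _; rewrite !partial_lll; congr (_ + _).
  rewrite big_split_ord /= [X in _ + X]big1 ?addr0 => [|d _].
    by apply: eq_bigr => d _; rewrite !christoffel_prod_lll.
  by rewrite !mixed !mulr0 subrr.
rewrite !partial0 => [|y Iy|y Iy]; rewrite ?(christoffel_prod_mixed Iy)//.
rewrite subrr add0r big1// => d _; rewrite -(splitK d); case: (fintype.split d) => e /=.
  by rewrite !mixed !mul0r subrr.
by rewrite !mixed !mulr0 subrr.
Qed.

Lemma ricci_prod_rr a b :
  ricci G (rshift v a) (rshift v b) z = ricci (h i.2) a b (rsubmx z).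
Proof.
rewrite /ricci big_split_ord /= [X in X + _]big1 ?add0r => [|c _].
  apply: eq_bigr => c _; rewrite !partial_rrr; congr (_ + _).
  rewrite big_split_ord /= [X in X + _]big1 ?add0r => [|d _].
    by apply: eq_bigr => d _; rewrite !christoffel_prod_rrr.
  by rewrite !mixed !mulr0 subrr.
rewrite !partial0 => [|y Iy|y Iy]; rewrite ?(christoffel_prod_mixed Iy)//.
rewrite subrr add0r big1// => d _; rewrite -(splitK d); case: (fintype.split d) => e /=.
  by rewrite !mixed !mulr0 subrr.
by rewrite !mixed !mul0r subrr.
Qed.

Lemma scalar_expr_prod : scalar_expr G z =
  scalar_expr (g i.1) (lsubmx z) + scalar_expr (h i.2) (rsubmx z).
Proof.
rewrite /scalar_expr big_split_ord /=; congr (_ + _); apply: eq_bigr => a _;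
    rewrite big_split_ord /=.
  rewrite [X in _ + X]big1 ?addr0 => [|b _]; last first.
    by rewrite invmx_prod// block_mxEur mxE mul0r.
  by apply: eq_bigr => b _; rewrite ricci_prod_ll invmx_prod// block_mxEul.
rewrite [X in X + _]big1 ?add0r => [|b _]; last first.
  by rewrite invmx_prod// block_mxEdl mxE mul0r.
by apply: eq_bigr => b _; rewrite ricci_prod_rr invmx_prod// block_mxEdr.
Qed.

End curvature.

(** The sum of the scalar curvatures of the factors has the right expression in every product chart,
    so it is the glued function: compatibility on the product is inherited from the factors. *)
Lemma scalar_curvature_prod (s : V -> R) (t : W -> R) :
  (forall (j : chart_index V) p, chart_dom j p -> s p = scalar_expr (g j) (chart j p)) ->
  (forall (j : chart_index W) p, chart_dom j p -> t p = scalar_expr (h j) (chart j p)) ->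
  scalar_curvature (prod_metric g h) = fun q : VW => s q.1 + t q.2.
Proof.
move=> sE tE; apply: glueE => i p ip; rewrite (sE i.1) ?(tE i.2); [|exact: ip.2|exact: ip.1].
have := scalar_expr_prod (chart_imageP ip); rewrite /scalar_expr => ->.
by rewrite /chart /= row_mxKl row_mxKr.
Qed.

Lemma smooth_onS m (U U' : set 'rV[R]_m) f : U' `<=` U -> smooth_on U f -> smooth_on U' f.
Proof. by move=> UU' sf k; exact: smooth_uptoS (sf k). Qed.

(** Reduces slices to affine inclusions: their smoothness and partials then follow from those of
    [u]. *)
Lemma section_chart1 u (i : chart_index V) (j : chart_index W) q : chart_dom j q ->
  (u \o chart_inv ((i, j) : chart_index VW)) \o (fun x => row_mx x (chart j q)) =
  (fun p => u (p, q)) \o chart_inv i.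
Proof.
move=> jq; apply/funext => x.
change (u (chart_inv i (lsubmx (row_mx x (chart j q))), chart_inv j (rsubmx (row_mx x (chart j q))))
  = u (chart_inv i x, q)).
by rewrite row_mxKl row_mxKr chartK ?inE.
Qed.

Lemma section_chart2 u (i : chart_index V) (j : chart_index W) p : chart_dom i p ->
  (u \o chart_inv ((i, j) : chart_index VW)) \o (fun y => row_mx (chart i p) y) =
  (fun q => u (p, q)) \o chart_inv j.
Proof.
move=> ip; apply/funext => y.
change (u (chart_inv i (lsubmx (row_mx (chart i p) y)), chart_inv j (rsubmx (row_mx (chart i p) y)))
  = u (p, chart_inv j y)).
by rewrite row_mxKl row_mxKr chartK ?inE.
Qed.

Lemma smooth_section1 u q : smooth u -> smooth (fun p : V => u (p, q)).
Proof.
move=> su i; have [j jq] := chart_dom_cover q; rewrite -(section_chart1 u i jq).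
have cA : continuous (fun x : 'rV[R]_v => row_mx x (chart j q)).
  move=> x; apply: (@row_mx_continuous _ _ _ _ x id (fun=> chart j q)).
    exact: cvg_id.
  exact: cst_continuous.
have H := smooth_on_affine cA (fun a k x => row_mx_shift_l (chart j q) a k x)
  (su ((i, j) : chart_index VW)).
apply: smooth_onS H => x Ix; apply/prod_chart_image; rewrite row_mxKl row_mxKr; split=> //.
exact: chart_imageP.
Qed.

Lemma smooth_section2 u p : smooth u -> smooth (fun q : W => u (p, q)).
Proof.
move=> su j; have [i ip] := chart_dom_cover p; rewrite -(section_chart2 u j ip).
have cA : continuous (fun y : 'rV[R]_w => row_mx (chart i p) y).
  move=> y; apply: (@row_mx_continuous _ _ _ _ y (fun=> chart i p) id).
    exact: cst_continuous.
  exact: cvg_id.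
have H := smooth_on_affine cA (fun a k x => row_mx_shift_r (chart i p) a k x)
  (su ((i, j) : chart_index VW)).
apply: smooth_onS H => x Ix; apply/prod_chart_image; rewrite row_mxKl row_mxKr; split=> //.
exact: chart_imageP.
Qed.

Lemma partial_section1 u (i : chart_index V) (j : chart_index W) q a x : chart_dom j q ->
  partial (lshift w a) (u \o chart_inv ((i, j) : chart_index VW)) (row_mx x (chart j q)) =
  partial a ((fun p => u (p, q)) \o chart_inv i) x.
Proof.
move=> jq; rewrite -(section_chart1 u i jq) -(@partial_affine _ _ _ (fun x => row_mx x (chart j q)) a)//.
by move=> k y; exact: row_mx_shift_l.
Qed.

Lemma partial_section2 u (i : chart_index V) (j : chart_index W) p a y : chart_dom i p ->
  partial (rshift v a) (u \o chart_inv ((i, j) : chart_index VW)) (row_mx (chart i p) y) =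
  partial a ((fun q => u (p, q)) \o chart_inv j) y.
Proof.
move=> ip; rewrite -(section_chart2 u j ip) -(@partial_affine _ _ _ (fun y => row_mx (chart i p) y) a)//.
by move=> k x; exact: row_mx_shift_r.
Qed.

(** The inverse metric has no mixed entries, and the partials of [u] in a product chart are those of
    its slices. *)
Lemma grad_sq_prod u : smooth u -> grad_sq (prod_metric g h) u =
  fun q : VW => grad_sq g (fun p => u (p, q.2)) q.1 + grad_sq h (fun p => u (q.1, p)) q.2.
Proof.
move=> su; apply: glueE => -[i j] [p q] [/= ip jq].
rewrite (grad_sq_chart rg (smooth_section1 q su) ip) (grad_sq_chart rh (smooth_section2 p su) jq).
have Iz : chart_image ((i, j) : chart_index VW) (chart ((i, j) : chart_index VW) (p, q)).
  exact: chart_imageP.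
rewrite invmx_prod// /chart /= row_mxKl row_mxKr big_split_ord /=; congr (_ + _).
  apply: eq_bigr => a _; rewrite big_split_ord /= [X in _ = _ + X]big1 ?addr0 => [|b _]; last first.
    by rewrite block_mxEur mxE !mul0r.
  apply: eq_bigr => b _; rewrite block_mxEul -!(partial_section1 u i _ _ jq).
  by [].
apply: eq_bigr => a _; rewrite big_split_ord /= [X in _ = X + _]big1 ?add0r => [|b _]; last first.
  by rewrite block_mxEdl mxE !mul0r.
by apply: eq_bigr => b _; rewrite block_mxEdr -!(partial_section2 u j _ _ ip).
Qed.

(** Joint continuity in both points, used for measurability on the product. It is read off in
    product charts, where the derivatives of the slices are partials of [u]. *)
Lemma continuous_grad_sq1 u : smooth u ->
  continuous (fun q : VW => grad_sq g (fun p => u (p, q.2)) q.1).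
Proof.
move=> su; apply: (@continuous_charts _ _ VW (fun i z => \sum_a \sum_b
    invmx (g i.1 (lsubmx z)) a b * partial (lshift w a) (u \o chart_inv i) z *
    partial (lshift w b) (u \o chart_inv i) z)).
  move=> [i j] [p q] [/= ip jq]; rewrite (grad_sq_chart rg (smooth_section1 q su) ip).
  apply: eq_bigr => a _; apply: eq_bigr => b _.
  by rewrite -!(partial_section1 u i _ _ jq) /chart /= row_mxKl.
move=> i z; apply: smooth_on_continuous.
have oI := chart_image_open i.
apply: smooth_on_sum => // a; apply: smooth_on_sum => // b.
apply: smooth_onM => //; last exact/smooth_on_partial/su.
apply: smooth_onM => //; last exact/smooth_on_partial/su.
have sinv : smooth_on (chart_image i.1) (fun x => invmx (g i.1 x) a b).
  apply: smooth_on_invmx => //; first exact: chart_image_open.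
    exact: riemannian_unitmx.
  exact: riemannian_smooth.
move=> k; apply: (@smooth_uptoS _ _ _ (lsubmx @^-1` chart_image i.1)).
  by move=> y /prod_chart_image[].
have := @smooth_upto_comp R (v + w) v k lsubmx _ _ _ _ (sinv k).
apply; first exact: continuous_lsubmx.
exact: lsubmx_delta.
Qed.

Lemma continuous_grad_sq2 u : smooth u ->
  continuous (fun q : VW => grad_sq h (fun p => u (q.1, p)) q.2).
Proof.
move=> su; apply: (@continuous_charts _ _ VW (fun i z => \sum_a \sum_b
    invmx (h i.2 (rsubmx z)) a b * partial (rshift v a) (u \o chart_inv i) z *
    partial (rshift v b) (u \o chart_inv i) z)).
  move=> [i j] [p q] [/= ip jq]; rewrite (grad_sq_chart rh (smooth_section2 p su) jq).
  apply: eq_bigr => a _; apply: eq_bigr => b _.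
  by rewrite -!(partial_section2 u j _ _ ip) /chart /= row_mxKr.
move=> i z; apply: smooth_on_continuous.
have oI := chart_image_open i.
apply: smooth_on_sum => // a; apply: smooth_on_sum => // b.
apply: smooth_onM => //; last exact/smooth_on_partial/su.
apply: smooth_onM => //; last exact/smooth_on_partial/su.
have sinv : smooth_on (chart_image i.2) (fun x => invmx (h i.2 x) a b).
  apply: smooth_on_invmx => //; first exact: chart_image_open.
    exact: riemannian_unitmx.
  exact: riemannian_smooth.
move=> k; apply: (@smooth_uptoS _ _ _ (rsubmx @^-1` chart_image i.2)).
  by move=> y /prod_chart_image[].
have := @smooth_upto_comp R (v + w) w k rsubmx _ _ _ _ (sinv k).
apply; first exact: continuous_rsubmx.
exact: rsubmx_delta.
Qed.

End product.

(** * Scaled measures, vanishing integrals and zero variance *)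

Section bounded_measurable_complements.
Context {R : realType} d (T : measurableType d).
Implicit Types f g : T -> R.

Lemma Rintegral_eq1 (m : {measure set T -> \bar R}) f g : f =1 g ->
  \int[m]_x f x = \int[m]_x g x.
Proof. by move=> /funext ->. Qed.

Lemma bmRintegral_mscale (c : {nonneg R}) (m : {finite_measure set T -> \bar R}) f :
  bounded_measurable f -> \int[mscale c m]_x f x = c%:num * \int[m]_x f x.
Proof.
pose cm : {finite_measure set T -> \bar R} := mscale c m.
move=> bf; have [_ [N fN]] := bf.
have bN := @bounded_measurable_cst R _ T N.
have ge0 x : 0 <= f x + N by have := fN x; rewrite ler_norml => /andP[+ _]; rewrite lerNl; lra.
(* Non-negative integrands are treated first; adding the bound [N] reduces signed ones to them. *)
have H : \int[cm]_x (f x + N) = c%:num * \int[m]_x (f x + N).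
  apply: EFin_inj; rewrite EFinM -!bmRintegralE; [|exact: bounded_measurableD..].
  rewrite ge0_integral_mscale//; last first.
  - by move=> x _; rewrite lee_fin.
  - apply/measurable_EFinP; exact: (bounded_measurableD bf bN).1.
have HN : \int[cm]_x N = c%:num * \int[m]_x N.
  by rewrite !Rintegral_cst//= mulrCA; congr (_ * _); rewrite /mscale fineM// fin_num_measure.
move: H; rewrite !(bmRintegralD _ bf bN) HN mulrDr => /addIr; exact.
Qed.

(** A non-negative [f] with zero integral vanishes almost everywhere, hence so does [g]. *)
Lemma bmRintegral_eq0 (m : {finite_measure set T -> \bar R}) f g :
  bounded_measurable f -> bounded_measurable g -> (forall x, 0 <= f x) ->
  (forall x, f x = 0 -> g x = 0) -> \int[m]_x f x = 0 -> \int[m]_x g x = 0.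
Proof.
move=> bf bg f0 fg If.
have mf : measurable_fun setT (EFin \o f) by apply/measurable_EFinP; exact: bf.1.
have mg : measurable_fun setT (EFin \o g) by apply/measurable_EFinP; exact: bg.1.
have : (\int[m]_x `|(f x)%:E| = 0)%E.
  rewrite (eq_integral (EFin \o f)) => [|x _]; last by rewrite /= ger0_norm.
  by rewrite (bmRintegralE m bf) If.
move=> /(ae_eq_integral_abs m measurableT mf) aef.
have aeg : ae_eq m setT (EFin \o g) (cst 0%E).
  by apply: filterS aef => x /= H _; have [/fg ->] := H Logic.I.
apply: EFin_inj; rewrite -bmRintegralE// (ae_eq_integral (cst 0%E) _ measurableT mg _ aeg) ?integral0//.
Qed.

(** Zero mean square deviation from [c] means [f = c] almost everywhere, expressed here by testing
    against every bounded [g]. *)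
Lemma bmRintegral_centered (m : {finite_measure set T -> \bar R}) (f g : T -> R) (c : R) :
  bounded_measurable f -> bounded_measurable g ->
  \int[m]_x (f x - c) ^+ 2 = 0 -> \int[m]_x (f x * g x) = c * \int[m]_x g x.
Proof.
move=> bf bg If.
have bc : bounded_measurable (fun x => f x - c).
  by apply: bounded_measurableD => //; exact: bounded_measurable_cst.
have : \int[m]_x ((f x - c) * g x) = 0.
  apply: bmRintegral_eq0 If; [exact: bounded_measurable_sqr|exact: bounded_measurableM| |].
    by move=> x; exact: sqr_ge0.
  by move=> x /eqP; rewrite sqrf_eq0 => /eqP ->; rewrite mul0r.
have bfg := bounded_measurableM bf bg; have bcg := bounded_measurableZ (- c) bg.
rewrite (Rintegral_eq1 m (g := fun x => f x * g x + - c * g x)); last first.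
  by move=> x; rewrite mulrBl mulNr.
rewrite (bmRintegralD m bfg bcg) (bmRintegralZ m (- c) bg) mulNr => /eqP.
by rewrite subr_eq0 => /eqP.
Qed.

End bounded_measurable_complements.

Lemma linear_coef_eq0 (R : realFieldType) (b c : R) :
  (forall t, 0 <= t * b + t ^+ 2 * c) -> b = 0.
Proof.
move=> H; apply/eqP; apply: contraT => b0.
have k0 : 0 < `|c| + 1 by rewrite ltr_wpDl.
(* At this [t] the expression equals [(b / k) ^+ 2 * (c - k)], which is negative since [k] exceeds
   [c]. *)
have := H (- b / (`|c| + 1)); set k := `|c| + 1.
have -> : - b / k * b + (- b / k) ^+ 2 * c = (b / k) ^+ 2 * (c - k) .
  by field; rewrite gt_eqF.
rewrite pmulr_rge0; last by rewrite exprn_even_gt0//= mulf_neq0// invr_neq0// gt_eqF.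
by rewrite subr_ge0 leNgt (le_lt_trans (ler_norm c))// ltrDl.
Qed.

(** * Yamabe metrics: exponents, Yamabe inequality and mean of the scalar curvature *)

Section yamabe_exponents.
Context {R : realType} (n : nat).
Hypothesis n3 : (3 <= n)%N.

Let n3R : 3 <= n%:R :> R. Proof. by rewrite ler_nat. Qed.

Lemma p_gt1 : 1 < p_ n :> R.
Proof. by have := n3R; rewrite /p_ => ?; rewrite ltr_pdivlMr; lra. Qed.

Lemma p_gt0 : 0 < p_ n :> R.
Proof. exact: lt_trans p_gt1. Qed.

Lemma two_div_p : 2 / p_ n = (n%:R - 2) / n%:R :> R.
Proof. by have := n3R; rewrite /p_ => ?; field; rewrite !gt_eqF//; lra. Qed.

Lemma a_gt0 : 0 < a_ n :> R.
Proof. by have := n3R; rewrite /a_ => ?; rewrite divr_gt0//; lra. Qed.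

End yamabe_exponents.

Section yamabe.
Context {R : realType} {n : nat} {M : manifold R n}.
Hypotheses (n3 : (3 <= n)%N) (cM : compact [set: M]).
Implicit Types (g : tensor M) (u : M -> R) (m : {finite_measure set (borel M) -> \bar R}).

Lemma continuous_bounded_measurable (f : borel M -> R) :
  continuous (f : M -> R) -> bounded_measurable f.
Proof.
move=> cf; split.
  apply: continuous_borel_realfun_on; first exact: openT.
  by move=> x _; exact: cf.
have [|c _ fc] := @compact_EVT_max M R (fun p => `|f p|) setT (ex_intro _ point Logic.I) cM.
  by apply: continuous_subspaceT => x; apply: (continuous_comp (cf x)); exact: norm_continuous.
by exists `|f c| => x; apply: fc; rewrite inE.
Qed.

(* [yd_mean] says that [s] is almost everywhere equal to [sbar]. *)
Record yamabe_data g m (s : borel M -> R) (mu sbar : R) : Prop := YamabeData {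
  yd_riemannian : riemannian_metric g;
  yd_volume : is_volume g m;
  yd_scalar : forall i p, chart_dom i p -> s p = scalar_expr (g i) (chart i p);
  yd_continuous : continuous (s : M -> R);
  yd_sbar_gt0 : 0 < sbar;
  yd_vol_gt0 : 0 < fine (m setT);
  yd_mu : mu = sbar * fine (m setT) `^ (2 / n%:R);
  yd_mean : forall f, bounded_measurable f ->
    \int[m]_x (s x * f x) = sbar * \int[m]_x f x;
  yd_ineq : forall u, smooth u ->
    mu * (\int[m]_x (`|u x| `^ p_ n)) `^ (2 / p_ n) <=
    \int[m]_x (a_ n * grad_sq g u x + s x * u x ^+ 2);
  yd_pos : forall u x, smooth u -> u x != 0 -> 0 < \int[m]_x (`|u x| `^ p_ n) }.

(** Hoelder against the constant 1 replaces the [L^p] norm in the Yamabe inequality by the mean of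
    [u]. When [S] is the integral of [s], the result is still an equality at [u = 1], and along
    [u = 1 + t s] it is polynomial in [t], so the first variation at 1 is a comparison of
    coefficients. *)
Lemma yamabe_sqr_mean g m (s : borel M -> R) u (mu S : R) :
  0 < fine (m setT) -> 0 <= S ->
  mu = S / fine (m setT) `^ (2 / p_ n) -> smooth u ->
  mu * (\int[m]_x (`|u x| `^ p_ n)) `^ (2 / p_ n) <=
    \int[m]_x (a_ n * grad_sq g u x + s x * u x ^+ 2) ->
  S * ((\int[m]_x u x) / fine (m setT)) ^+ 2 <=
    \int[m]_x (a_ n * grad_sq g u x + s x * u x ^+ 2).
Proof.
move=> vol0 S0 muE su; apply: le_trans; rewrite muE -[leRHS]mulrA; apply: ler_wpM2l => //.
set vol := fine (m setT); have p1 := p_gt1 (R := R) n3; have p0 := p_gt0 (R := R) n3.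
set D := \int[m]_x (`|u x| `^ p_ n).
have bu : bounded_measurable (u : borel M -> R).
  by apply: continuous_bounded_measurable; exact: smooth_continuous.
have bu' := bounded_measurable_norm bu.
have D0 : 0 <= D by apply: bmRintegral_ge0 => x; exact: powR_ge0.
have H : \int[m]_x `|u x| <= D `^ (p_ n)^-1 * vol `^ (1 - (p_ n)^-1).
  have := @weighted_hoelder R _ _ m (p_ n)^-1 (1 - (p_ n)^-1)
    (fun x => `|u x| `^ p_ n) (fun=> 1).
  rewrite Rintegral_cst// mul1r -/vol -/D.
  under eq_Rintegral do rewrite -powRrM mulfV ?gt_eqF// powRr1// powR1 mulr1.
  apply => //.
  - by rewrite invr_gt0.
  - by rewrite subr_gt0 invf_lt1.
  - by rewrite subrKC.
  - by apply: bounded_measurable_powR => //; exact: ltW.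
  - exact: bounded_measurable_cst.
rewrite expr_div_n ler_pdivrMr ?exprn_gt0// -mulrA ler_pdivlMl ?powR_gt0//.
apply: (@le_trans _ _ (vol `^ (2 / p_ n) * (D `^ (p_ n)^-1 * vol `^ (1 - (p_ n)^-1)) ^+ 2)).
  rewrite ler_wpM2l ?powR_ge0// -(real_normK (num_real (\int[m]_x u x))) ler_sqr ?nnegrE//.
    apply: le_trans H; apply: le_normr_Rintegral => //.
    exact: bounded_measurable_integrable.
  by rewrite mulr_ge0 ?powR_ge0.
rewrite exprMn -!powR_mulrn ?powR_ge0 ?(ltW vol0)// -!powRrM mulrCA -powRD; last first.
  by rewrite (gt_eqF vol0) implybT.
rewrite le_eqVlt; apply/orP; left; apply/eqP.
by congr (_ `^ _ * vol `^ _); field; rewrite gt_eqF.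
Qed.

Lemma yamabe_data_of g : yamabe_metric g -> (0 < yamabe_constant g)%E ->
  exists m s mu sbar, yamabe_data g m s mu sbar /\ yamabe_constant g = mu%:E.
Proof.
move=> [rg yE]; rewrite -yE lte_fin => Q0.
have p0 := p_gt0 (R := R) n3; have e2p := two_div_p (R := R) n3.
have vg : is_volume g (volume g).
  case: (volumeP g) => // vz; move: Q0; rewrite /einstein_hilbert /Rintegral.
  rewrite (eq_measure_integral mzero) => [|A _ _]; last by rewrite vz.
  by rewrite integral_measure_zero mul0r ltxx.
have s0 : scalar_curvature g <> cst 0.
  move=> sz; move: Q0; rewrite /einstein_hilbert sz Rintegral_cst// mul0r mul0r ltxx.
  by [].
have k0 : (n%:R - 2) / n%:R != 0 :> R by rewrite -e2p gt_eqF// divr_gt0.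
have volfin : (volume g setT < +oo)%E.
  rewrite ltey; apply/eqP => vinf; move: Q0.
  by rewrite /einstein_hilbert vinf /= powR0// invr0 mulr0 ltxx.
have [m mE] := finite_measureP volfin.
have mA A : volume g A = m A := congr1 (fun f => f A) (esym mE).
have intE (f : borel M -> R) : \int[volume g]_x f x = \int[m]_x f x.
  by rewrite /Rintegral; congr fine; apply: eq_measure_integral => A _ _; exact: mA.
have vm : is_volume g m by move=> i A mesA Ai; rewrite -[LHS]mA; exact: vg.
pose s : borel M -> R := scalar_curvature g.
have ss : smooth (s : M -> R) := smooth_scalar_curvature rg s0.
have cs := smooth_continuous ss.
have bs := continuous_bounded_measurable cs.
have [vol volE] : exists vol, vol = fine (m setT) by eexists.
have [S SE] : exists S, S = \int[m]_x s x by eexists.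
have QE : einstein_hilbert g = S / vol `^ (2 / p_ n).
  by rewrite /einstein_hilbert intE e2p SE volE mA.
have vol0 : 0 < vol.
  rewrite lt_neqAle {2}volE fine_ge0 ?measure_ge0// andbT; apply/eqP => v0.
  by move: Q0; rewrite QE -v0 powR0 ?e2p// invr0 mulr0 ltxx.
have S0 : 0 < S by move: Q0; rewrite QE pmulr_lgt0// invr_gt0 powR_gt0.
have [mu muE] : exists mu, mu = einstein_hilbert g by eexists.
rewrite -muE in Q0 QE.
have quot u x : smooth u -> u x != 0 -> mu <=
    (\int[m]_x (a_ n * grad_sq g u x + s x * u x ^+ 2)) /
    (\int[m]_x (`|u x| `^ p_ n)) `^ (2 / p_ n).
  move=> su ux; rewrite -lee_fin muE yE -!intE; apply: ereal_inf_lbound.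
  exists u => //; split=> //; last by exists x.
  exact: (subclosed_compact (@closed_closure _ _) cM).
(* A zero denominator would make the quotient 0 by the convention on division, against the lower
   bound [mu > 0]. *)
have pos u x : smooth u -> u x != 0 -> 0 < \int[m]_x (`|u x| `^ p_ n).
  move=> su ux; rewrite lt_neqAle bmRintegral_ge0 ?andbT => [|y]; last exact: powR_ge0.
  apply/eqP => D0; have := quot u x su ux.
  by rewrite -D0 powR0 ?e2p// invr0 mulr0 leNgt Q0.
have ineq u : smooth u -> mu * (\int[m]_x (`|u x| `^ p_ n)) `^ (2 / p_ n) <=
    \int[m]_x (a_ n * grad_sq g u x + s x * u x ^+ 2).
  move=> su; have [[x ux]|uz] := pselect (exists x, u x != 0).
    by rewrite -ler_pdivlMr; [exact: quot ux|rewrite powR_gt0//; exact: pos ux].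
  (* For the zero function both sides vanish; written in this form, its gradient is evaluated by
     [grad_sq_affine]. *)
  have u0 : u = fun p => 0 + 0 * u p.
    by apply/funext => p; rewrite mul0r addr0; apply: contrapT => /eqP up; apply: uz; exists p.
  rewrite u0 (grad_sq_affine 0 0 rg su).
  under eq_Rintegral do rewrite mul0r addr0 normr0 powR0 ?gt_eqF//.
  under [X in _ <= X]eq_Rintegral do rewrite expr0n /= mul0r mulr0 mul0r addr0 expr0n /= mulr0 add0r.
  by rewrite !Rintegral_cst// !mul0r powR0 ?e2p// mulr0.
exists m, s, mu, (S / vol); split; last by rewrite muE.
split=> //.
- exact: scalar_curvature_chart.
- by rewrite divr_gt0.
- by rewrite -volE.
(* The exponents match because [1 - 2 / p_ n = 2 / n]. *)
- rewrite QE -volE -mulrA; congr (_ * _).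
  have n3R : 3 <= n%:R :> R by rewrite ler_nat.
  rewrite -powRN -(powR_inv1 (ltW vol0)) -powRD ?(gt_eqF vol0) ?implybT//; congr (_ `^ _).
  by rewrite e2p; field; rewrite gt_eqF//; lra.
- move=> f bf; apply: bmRintegral_centered => //.
  have b2 := bounded_measurable_sqr bs.
  (* With mean [S / vol], vanishing variance amounts to this value of the second moment. *)
  suff H : \int[m]_x s x ^+ 2 = S ^+ 2 / vol.
    have b1 := bounded_measurableZ (- (2 * (S / vol))) bs.
    have bc := @bounded_measurable_cst R _ (borel M) ((S / vol) ^+ 2).
    rewrite (Rintegral_eq1 m (g := fun x => (s x ^+ 2 + - (2 * (S / vol)) * s x) + (S / vol) ^+ 2)).
      rewrite (bmRintegralD m (bounded_measurableD b2 b1) bc) (bmRintegralD m b2 b1).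
      rewrite (bmRintegralZ m _ bs) H -SE Rintegral_cst// -volE; field.
      by rewrite gt_eqF.
    by move=> x; ring.
  have cG : continuous (grad_sq g s) by exact: continuous_grad_sq.
  have bG := continuous_bounded_measurable cG.
  have b3 := bounded_measurableM bs b2.
  have baG := bounded_measurableZ (a_ n) bG.
  have bC := bounded_measurableD baG b3.
  pose C := \int[m]_x (a_ n * grad_sq g s x + s x * s x ^+ 2).
  apply/eqP; rewrite -subr_eq0; apply/eqP.
  (* Test the Yamabe inequality with [1 + t s]: the part linear in [t] is twice the variance
     integral of [s], which therefore vanishes. *)
  have := @linear_coef_eq0 R (2 * (\int[m]_x s x ^+ 2 - S ^+ 2 / vol))
     (C - S * (S / vol) ^+ 2).
  move=> lin; suff /lin /eqP : forall t, 0 <= t * (2 * (\int[m]_x s x ^+ 2 - S ^+ 2 / vol)) +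
      t ^+ 2 * (C - S * (S / vol) ^+ 2).
    by rewrite mulf_eq0 pnatr_eq0 /= => /eqP.
  move=> t.
  have st : smooth (fun p : M => 1 + t * s p).
    exact: smoothD (smooth_cst 1) (smoothM (smooth_cst t) ss).
  have := @yamabe_sqr_mean g m s _ mu S _ (ltW S0) _ st (ineq _ st).
  rewrite -volE => /(_ vol0 QE).
  rewrite (grad_sq_affine 1 t rg ss).
  have bt := bounded_measurableZ t bs.
  have b1 := @bounded_measurable_cst R _ (borel M) 1.
  rewrite (bmRintegralD m b1 bt) (bmRintegralZ m t bs) Rintegral_cst// -volE -SE.
  rewrite (_ : \int[m]_x (a_ n * (t ^+ 2 * grad_sq g s x) + s x * (1 + t * s x) ^+ 2) =
    \int[m]_x ((s x + 2 * t * s x ^+ 2) +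
      t ^+ 2 * (a_ n * grad_sq g s x + s x * s x ^+ 2))); last first.
    by apply: Rintegral_eq1 => x; move: (grad_sq g s x) (s x) (a_ n) => G y a; ring.
  have b2t := bounded_measurableZ (2 * t) b2.
  rewrite (bmRintegralD m (bounded_measurableD bs b2t) (bounded_measurableZ (t ^+ 2) bC)).
  rewrite (bmRintegralD m bs b2t) (bmRintegralZ m (2 * t) b2) (bmRintegralZ m (t ^+ 2) bC).
  rewrite -/C -SE mul1r; set X := \int[m]_x _; rewrite -subr_ge0.
  suff -> : S + 2 * t * X + t ^+ 2 * C - S * ((vol + t * S) / vol) ^+ 2 =
    t * (2 * (X - S ^+ 2 / vol)) + t ^+ 2 * (C - S * (S / vol) ^+ 2) by [].
  by field; rewrite gt_eqF.
Qed.

End yamabe.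

(** * Scale invariance of the Yamabe data *)

Section scaled_data.
Context {R : realType} {n : nat} {M : manifold R n}.
Hypotheses (n3 : (3 <= n)%N) (cM : compact [set: M]).

(** Volume scales by [c], the square root of [lam ^+ n], while the scalar curvature and the squared
    gradient scale by [lam^-1]. Since the power [2 / n] of [c] is [lam], the power [2 / p_ n] is
    [c / lam]: both sides of the Yamabe inequality scale alike and [mu] is unchanged. *)
Lemma yamabe_data_scale (g : tensor M) (m : {finite_measure set (borel M) -> \bar R}) s mu sbar
    (lam : R) : 0 < lam -> yamabe_data g m s mu sbar ->
  exists m', yamabe_data (scale_metric lam g) m' (fun x => lam^-1 * s x) mu (lam^-1 * sbar).
Proof.
move=> lam0 [rg vm sE cs sb0 vol0 muE mean ineq pos].
have n0 : 0 < n%:R :> R by rewrite ltr0n (leq_trans _ n3).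
have [c cE] : exists c : {nonneg R}, c%:num = Num.sqrt (lam ^+ n).
  by exists (NngNum (sqrtr_ge0 (lam ^+ n))).
have c0 : 0 < c%:num by rewrite cE sqrtr_gt0 exprn_gt0.
have lamV0 : 0 < lam^-1 by rewrite invr_gt0.
pose m' : {finite_measure set (borel M) -> \bar R} := mscale c m.
have volE : fine (m' setT) = c%:num * fine (m setT).
  by rewrite /m' /= /mscale fineM// fin_num_measure.
have c2n : c%:num `^ (2 / n%:R) = lam.
  rewrite cE -powR12_sqrt ?exprn_ge0 ?ltW// -powR_mulrn ?ltW// -!powRrM.
  by rewrite -[RHS]powRr1 ?ltW//; congr (lam `^ _); field; rewrite gt_eqF.
have cp : c%:num `^ (2 / p_ n) = c%:num * lam^-1.
  rewrite two_div_p// -[in RHS]c2n -powRN -[in RHS](powRr1 (ltW c0)) -powRrM.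
  rewrite -powRD ?(gt_eqF c0) ?implybT//; congr (_ `^ _); field; rewrite gt_eqF//.
have su_bm (u : M -> R) : smooth u -> bounded_measurable (u : borel M -> R).
  by move=> su; apply: continuous_bounded_measurable => //; exact: smooth_continuous.
have bD (u : M -> R) : smooth u -> bounded_measurable (fun x : borel M => `|u x| `^ p_ n).
  move=> su; apply: bounded_measurable_powR => //; first exact/ltW/p_gt0.
  exact/bounded_measurable_norm/su_bm.
have bs : bounded_measurable s by exact: continuous_bounded_measurable.
exists m'; split.
- exact: riemannian_scale.
- exact: is_volume_scale.
- by move=> i p ip; rewrite (sE i p ip) scalar_expr_scale//; exact: chart_imageP.
- by move=> x; apply: (continuous_comp (cs x)); exact: mulrl_continuous.
- by rewrite mulr_gt0.
- by rewrite volE mulr_gt0.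
- rewrite volE powRM ?(ltW c0) ?(ltW vol0)// c2n muE; field.
  by rewrite gt_eqF.
- move=> f bf; rewrite !bmRintegral_mscale//; last exact/bounded_measurableM/bf/bounded_measurableZ.
  rewrite (Rintegral_eq1 m (g := fun x => lam^-1 * (s x * f x))); last by move=> x; rewrite mulrA.
  rewrite bmRintegralZ; last exact: bounded_measurableM.
  by rewrite mean//; ring.
- move=> u su; rewrite grad_sq_scale//.
  have bG : bounded_measurable (grad_sq g u : borel M -> R).
    by apply: continuous_bounded_measurable => //; exact: continuous_grad_sq.
  have bN : bounded_measurable (fun x : borel M => a_ n * grad_sq g u x + s x * u x ^+ 2).
    apply: bounded_measurableD; first exact: bounded_measurableZ.
    by apply: bounded_measurableM => //; apply: bounded_measurable_sqr; exact: su_bm.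
  rewrite [leRHS](Rintegral_eq1 m' (g := fun x => lam^-1 * (a_ n * grad_sq g u x + s x * u x ^+ 2))).
    rewrite [X in mu * X `^ _ <= _](bmRintegral_mscale c m (bD u su)).
    rewrite [leRHS](bmRintegral_mscale c m (bounded_measurableZ lam^-1 bN)).
    rewrite (bmRintegralZ m _ bN) powRM ?(ltW c0)//; last first.
      by apply: bmRintegral_ge0 => x; exact: powR_ge0.
    rewrite cp mulrCA -[leLHS]mulrA mulrA [leRHS]mulrA.
    by apply: ler_wpM2l; [rewrite mulr_ge0// ltW|exact: ineq].
  by move=> x; move: (grad_sq g u x) (s x) (u x) (a_ n) (lam^-1) => G y z a l; ring.
- move=> u x su ux; rewrite bmRintegral_mscale; last exact: bD.
  by rewrite mulr_gt0//; exact: pos ux.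
Qed.

End scaled_data.

(** * Linearity of iterated integrals and weighted AM-GM *)

Section iterated.
Context {R : realType} {d1 d2} {X : measurableType d1} {Y : measurableType d2}.
Variables (m1 : {finite_measure set X -> \bar R}) (m2 : {finite_measure set Y -> \bar R}).
Implicit Types F G : X * Y -> R.

Lemma iterated_RintegralD F G : bounded_measurable F -> bounded_measurable G ->
  \int[m1]_x \int[m2]_y (F (x, y) + G (x, y)) =
  \int[m1]_x \int[m2]_y F (x, y) + \int[m1]_x \int[m2]_y G (x, y).
Proof.
move=> bF bG; rewrite -bmRintegralD; [|exact: (bounded_measurable_Rintegral m1 m2)..].
apply: Rintegral_eq1 => x.
exact: (bmRintegralD m2 (bounded_measurable_section x bF) (bounded_measurable_section x bG)).
Qed.

Lemma iterated_RintegralZ (c : R) F : bounded_measurable F ->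
  \int[m1]_x \int[m2]_y (c * F (x, y)) = c * \int[m1]_x \int[m2]_y F (x, y).
Proof.
move=> bF; rewrite -bmRintegralZ; last exact: (bounded_measurable_Rintegral m1 m2).
by apply: Rintegral_eq1 => x; exact: (bmRintegralZ m2 c (bounded_measurable_section x bF)).
Qed.

End iterated.

(** Young's inequality for powers of [X / V] and [Y / W] with exponents [(V + W) / V] and
    [(V + W) / W]. The normalisation by [V] and [W] puts the case of equality at [X / V = Y / W]. *)
Lemma weighted_amgm (R : realType) (X Y V W : R) : 0 <= X -> 0 <= Y -> 0 < V -> 0 < W ->
  (V + W) * (X / V) `^ (V / (V + W)) * (Y / W) `^ (W / (V + W)) <= X + Y.
Proof.
move=> X0 Y0 V0 W0; have VW0 : 0 < V + W by rewrite addr_gt0.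
have a0 : 0 < V / (V + W) by rewrite divr_gt0.
have b0 : 0 < W / (V + W) by rewrite divr_gt0.
have := @conjugate_powR R ((X / V) `^ (V / (V + W))) ((Y / W) `^ (W / (V + W)))
  (V / (V + W))^-1 (W / (V + W))^-1 (powR_ge0 _ _) (powR_ge0 _ _).
rewrite !invr_gt0 !invrK => /(_ a0 b0).
rewrite -mulrDl divrr ?unitfE ?gt_eqF// => /(_ erefl).
have XV0 : 0 <= X / V by rewrite divr_ge0 ?(ltW V0).
have YW0 : 0 <= Y / W by rewrite divr_ge0 ?(ltW W0).
rewrite -!powRrM (divff (lt0r_neq0 a0)) (divff (lt0r_neq0 b0)) (powRr1 XV0) (powRr1 YW0) => H.
rewrite -mulrA -ler_pdivlMl//; apply: le_trans H _.
rewrite le_eqVlt; apply/orP; left; apply/eqP; field.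
by rewrite !gt_eqF.
Qed.

(** * Lower and upper bounds on the product *)

Section product_bounds.
Context {R : realType} {v w : nat} {V : manifold R v} {W : manifold R w}.
Hypotheses (hv : (3 <= v)%N) (hw : (3 <= w)%N).
Hypotheses (cV : compact [set: V]) (cW : compact [set: W]).
Let VW := prod_manifold V W.

Lemma compact_prod_manifold : compact [set: VW].
Proof.
rewrite (_ : [set: VW] = [set: V] `*` [set: W]); first exact: compact_setX.
by rewrite setXTT.
Qed.

Lemma bounded_measurable_prod (F : borel VW -> R) : bounded_measurable F ->
  bounded_measurable (F : borel V * borel W -> R).
Proof.
move=> [mF [N FN]]; split; last by exists N.
exact: (measurableT_comp mF (@measurable_borel_prod R v w V W)).
Qed.

Variables (g : tensor V) (h : tensor W).
Variables (m1 : {finite_measure set (borel V) -> \bar R})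
          (m2 : {finite_measure set (borel W) -> \bar R}).
Variables (s1 : borel V -> R) (s2 : borel W -> R) (mu1 mu2 sb1 sb2 : R).
Hypotheses (Y1 : yamabe_data g m1 s1 mu1 sb1) (Y2 : yamabe_data h m2 s2 mu2 sb2).

(** [volume] of the product metric is a measure picked by choice. The product measure shows that
    such a measure exists, uniqueness on a compact manifold identifies the two, and Fubini gives the
    iterated integral. *)
Lemma Rintegral_volume_prod (F : borel VW -> R) : bounded_measurable F ->
  \int[volume (prod_metric g h)]_z F z = \int[m1]_x \int[m2]_y F (x, y).
Proof.
have [rg vg _ _ _ _ _ _ _ _] := Y1; have [rh vh _ _ _ _ _ _ _ _] := Y2.
have vp := is_volume_prod rg rh vg vh.
move=> bF; have bF' := bounded_measurable_prod bF.
rewrite -(Rintegral_prod m1 m2 bF') /Rintegral; congr fine.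
have vol : is_volume (prod_metric g h) (volume (prod_metric g h)).
  by rewrite /volume; case: pselect => [e|[]]; [case: cid|exists (prod_volume m1 m2)].
rewrite (eq_measure_integral (prod_volume m1 m2)) => [|A mA _]; last first.
  exact: (is_volume_unique compact_prod_manifold vol vp).
have mF : measurable_fun setT (EFin \o F) by apply/measurable_EFinP; exact: bF.1.
exact: (integral_pushforward (@measurable_borel_prod R v w V W) mF
  (integrable_bounded_prod m1 m2 bF') measurableT).
Qed.

Let rg := yd_riemannian Y1.
Let rh := yd_riemannian Y2.

Let bounded_cont (F : borel VW -> R) : continuous (F : VW -> R) ->
  bounded_measurable (F : borel V * borel W -> R).
Proof.
move=> cF; apply: bounded_measurable_prod.
exact: (continuous_bounded_measurable compact_prod_manifold).
Qed.

Let cs1 : continuous (fun z : VW => s1 z.1).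
Proof. by move=> z; apply: continuous_comp; [exact: cvg_fst|exact: (yd_continuous Y1)]. Qed.

Let cs2 : continuous (fun z : VW => s2 z.2).
Proof. by move=> z; apply: continuous_comp; [exact: cvg_snd|exact: (yd_continuous Y2)]. Qed.

Let K : R := (v + w)%:R * (mu1 / v%:R) `^ (v%:R / (v + w)%:R) * (mu2 / w%:R) `^ (w%:R / (v + w)%:R).

Let v0 : 0 < v%:R :> R. Proof. by rewrite ltr0n (leq_trans _ hv). Qed.
Let w0 : 0 < w%:R :> R. Proof. by rewrite ltr0n (leq_trans _ hw). Qed.
Let v2 : 2 < v%:R :> R. Proof. by rewrite ltr_nat. Qed.
Let w2 : 2 < w%:R :> R. Proof. by rewrite ltr_nat. Qed.
Let vw3 : (3 <= v + w)%N. Proof. exact: leq_trans hv (leq_addr _ _). Qed.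

Lemma yd_mu_gt0 n (M : manifold R n) (k : tensor M) m s mu sb :
  yamabe_data k m s mu sb -> 0 < mu.
Proof. by move=> [_ _ _ _ sb0 vol0 -> _ _ _]; rewrite mulr_gt0// powR_gt0. Qed.

Lemma yamabe_quotient_prod (u : VW -> R) : smooth u ->
  yamabe_quotient (prod_metric g h) u =
  (\int[m1]_x \int[m2]_y (a_ (v + w) * (grad_sq g (fun p => u (p, y)) x +
      grad_sq h (fun q => u (x, q)) y) + (s1 x + s2 y) * u (x, y) ^+ 2)) /
  (\int[m1]_x \int[m2]_y (`|u (x, y)| `^ p_ (v + w))) `^ (2 / p_ (v + w)).
Proof.
move=> su; rewrite /yamabe_quotient grad_sq_prod//.
rewrite (scalar_curvature_prod rg rh (yd_scalar Y1) (yd_scalar Y2)).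
have cu := smooth_continuous su.
have bu : bounded_measurable (u : borel VW -> R).
  exact: (continuous_bounded_measurable compact_prod_manifold).
have bcont (F : borel VW -> R) : continuous (F : VW -> R) -> bounded_measurable F.
  by move=> cF; exact: (continuous_bounded_measurable compact_prod_manifold).
rewrite (Rintegral_volume_prod (F := fun z : borel VW => `|u z| `^ p_ (v + w))); last first.
  by apply: bounded_measurable_powR => //; [exact/ltW/p_gt0|exact: bounded_measurable_norm].
rewrite (Rintegral_volume_prod (F := fun z : borel VW => a_ (v + w) *
   (grad_sq g (fun p => u (p, z.2)) z.1 + grad_sq h (fun p => u (z.1, p)) z.2) +
   (s1 z.1 + s2 z.2) * u z ^+ 2))//.
apply: bounded_measurableD.
  apply: bounded_measurableZ; apply: bounded_measurableD; apply: bcont.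
    exact: continuous_grad_sq1.
  exact: continuous_grad_sq2.
apply: bounded_measurableM; last exact: bounded_measurable_sqr.
by apply: bounded_measurableD; apply: bcont.
Qed.

Let u_bm (u : VW -> R) : smooth u -> bounded_measurable (u : borel V * borel W -> R).
Proof. by move=> su; apply: bounded_cont; exact: smooth_continuous. Qed.

Let u_pow_bm (u : VW -> R) (p : R) : 0 < p -> smooth u ->
  bounded_measurable (fun z : borel V * borel W => `|u z| `^ p).
Proof.
by move=> p0 su; apply: bounded_measurable_powR => //; [exact: ltW|exact/bounded_measurable_norm/u_bm].
Qed.

(* If the integral vanished, so would the section [u (x, _)] almost everywhere, for a point [x] of
   the first factor where that section is not identically zero. *)
Lemma prod_Lp_gt0 (u : VW -> R) z : smooth u -> u z != 0 ->
  0 < \int[m1]_x \int[m2]_y (`|u (x, y)| `^ p_ (v + w)).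
Proof.
move=> su; case: z => x0 y0 uz.
have bp := u_pow_bm (p_gt0 (R := R) vw3) su.
have bpv := u_pow_bm (p_gt0 (R := R) hv) su.
have bpw := u_pow_bm (p_gt0 (R := R) hw) su.
rewrite lt_neqAle bmRintegral_ge0 ?andbT => [|x]; last first.
  by apply: bmRintegral_ge0 => y; exact: powR_ge0.
apply/eqP => /esym; rewrite (Rintegral_exchange m1 m2 bp) => I0.
have := yd_pos Y2 (smooth_section2 x0 su) uz.
rewrite (@bmRintegral_eq0 _ _ _ m2 _ (fun y => `|u (x0, y)| `^ p_ w) _ _ _ _ I0) ?ltxx//.
- exact: (bounded_measurable_Rintegral2 m1 m2 bp).
- by have := bounded_measurable_section (x0 : borel V) bpw.
- by move=> y; apply: bmRintegral_ge0 => x; exact: powR_ge0.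
move=> y Iy; have [->|uy] := eqVneq (u (x0, y)) 0.
  by rewrite normr0 powR0 ?gt_eqF// p_gt0.
have := yd_pos Y1 (smooth_section1 y su) uy.
rewrite (@bmRintegral_eq0 _ _ _ m1 _ (fun x => `|u (x, y)| `^ p_ v) _ _ _ _ Iy) ?ltxx//.
- exact: (bounded_measurable_section2 y bp).
- exact: (bounded_measurable_section2 y bpv).
by move=> x /powR_eq0_eq0 ->; rewrite powR0 ?gt_eqF// p_gt0.
Qed.

Let am := a_ (v + w) : R.

Let am_gt0 : 0 < am. Proof. exact: a_gt0. Qed.

(** [a_ k] equals [4 + 4 / (k - 2)], hence decreases in [k]. *)
Let ratio_le1 k j : (3 <= k)%N -> (k <= j)%N -> a_ j / a_ k <= 1 :> R.
Proof.
move=> k3 kj; have k3R : 3 <= k%:R :> R by rewrite ler_nat.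
have kjR : k%:R <= j%:R :> R by rewrite ler_nat.
rewrite ler_pdivrMr ?a_gt0// mul1r /a_ ler_pdivrMr; last by lra.
rewrite mulrAC ler_pdivlMr; last by lra.
nra.
Qed.

Lemma product_bound_gt0 : 0 < K.
Proof.
rewrite /K; apply: mulr_gt0; [apply: mulr_gt0|].
- by rewrite natrD; exact: addr_gt0.
- by apply: powR_gt0; apply: divr_gt0; [exact: yd_mu_gt0 Y1|exact: v0].
- by apply: powR_gt0; apply: divr_gt0; [exact: yd_mu_gt0 Y2|exact: w0].
Qed.

Lemma eps_gt0 : 0 < eps_ R v w.
Proof.
rewrite /eps_ -/am; apply: divr_gt0 => //.
by apply: mulr_gt0; apply: powR_gt0; exact: a_gt0.
Qed.

(** The origin of [eps_]: the ratios [am / a_ v] and [am / a_ w] leave the weighted geometric mean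
    with their exponents, and as these add up to 1 the powers of [am] recombine to [am]. *)
Lemma eps_factor (A B : R) : 0 <= A -> 0 <= B ->
  eps_ R v w * K * (A `^ (v%:R / (v + w)%:R) * B `^ (w%:R / (v + w)%:R)) =
  (v%:R + w%:R) * (am / a_ v * (mu1 * A) / v%:R) `^ (v%:R / (v%:R + w%:R)) *
    (am / a_ w * (mu2 * B) / w%:R) `^ (w%:R / (v%:R + w%:R)).
Proof.
move=> A0 B0; rewrite /eps_ /K -/am !natrD.
set al := v%:R / (v%:R + w%:R); set be := w%:R / (v%:R + w%:R).
have av0 := a_gt0 (R := R) hv; have aw0 := a_gt0 (R := R) hw.
have m10 := yd_mu_gt0 Y1; have m20 := yd_mu_gt0 Y2.
have e1 : am / a_ v * (mu1 * A) / v%:R = am * ((a_ v)^-1 * (mu1 / v%:R * A)) by ring.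
have e2 : am / a_ w * (mu2 * B) / w%:R = am * ((a_ w)^-1 * (mu2 / w%:R * B)) by ring.
have q1 : 0 <= mu1 / v%:R * A by rewrite mulr_ge0// divr_ge0 ?(ltW m10) ?(ltW v0).
have q2 : 0 <= mu2 / w%:R * B by rewrite mulr_ge0// divr_ge0 ?(ltW m20) ?(ltW w0).
have i1 : 0 <= (a_ v)^-1 :> R by rewrite invr_ge0 ltW.
have i2 : 0 <= (a_ w)^-1 :> R by rewrite invr_ge0 ltW.
have am0 := ltW am_gt0.
have d1 : 0 <= mu1 / v%:R by rewrite divr_ge0 ?(ltW m10) ?(ltW v0).
have d2 : 0 <= mu2 / w%:R by rewrite divr_ge0 ?(ltW m20) ?(ltW w0).
rewrite e1 e2 (powRM _ am0 (mulr_ge0 i1 q1)) (powRM _ am0 (mulr_ge0 i2 q2)).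
rewrite (powRM _ i1 q1) (powRM _ i2 q2) (powRM _ d1 A0) (powRM _ d2 B0).
have vn (x r : R) : (x^-1) `^ r = (x `^ r)^-1 \/ x < 0.
  have [x0|x0] := leP 0 x; [left|by right].
  by rewrite -powR_inv1// -powRrM mulN1r powRN.
have -> : ((a_ v)^-1) `^ al = (a_ v `^ al)^-1 :> R by case: (vn (a_ v) al) => // ?; lra.
have -> : ((a_ w)^-1) `^ be = (a_ w `^ be)^-1 :> R by case: (vn (a_ w) be) => // ?; lra.
have amE : am = am `^ al * am `^ be.
  rewrite -powRD ?(gt_eqF am_gt0) ?implybT// /al /be -mulrDl divff ?powRr1//.
  by rewrite gt_eqF// addr_gt0.
have P1 : a_ v `^ al != 0 :> R by rewrite gt_eqF// powR_gt0.
have P2 : a_ w `^ be != 0 :> R by rewrite gt_eqF// powR_gt0.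
rewrite [X in X / _ * _ * _]amE.
move: (a_ v `^ al) (a_ w `^ be) (am `^ al) (am `^ be) P1 P2 => x1 x2 x3 x4 P1 P2.
move: (A `^ al) (B `^ be) ((mu1 / v%:R) `^ al) ((mu2 / w%:R) `^ be) => z1 z2 z3 z4.
by field; rewrite P1 P2.
Qed.

Lemma yamabe_prod_lower (u : VW -> R) : smooth u -> (exists z, u z != 0) ->
  eps_ R v w * K <= yamabe_quotient (prod_metric g h) u.
Proof.
move=> su [z uz]; rewrite yamabe_quotient_prod//.
have D0 := prod_Lp_gt0 su uz.
rewrite (ler_pdivlMr _ _ (powR_gt0 _ D0)).
have bu := u_bm su; have bu2 := bounded_measurable_sqr bu.
have bs1 := bounded_cont cs1; have bs2 := bounded_cont cs2.
have bF1 := bounded_cont (continuous_grad_sq1 rg su).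
have bF2 := bounded_cont (continuous_grad_sq2 rh su).
have bsu1 := bounded_measurableM bs1 bu2; have bsu2 := bounded_measurableM bs2 bu2.
have bpv := u_pow_bm (p_gt0 (R := R) hv) su.
have bpw := u_pow_bm (p_gt0 (R := R) hw) su.
pose F1 := fun q : borel V * borel W => grad_sq g (fun p => u (p, q.2)) q.1.
pose F2 := fun q : borel V * borel W => grad_sq h (fun p => u (q.1, p)) q.2.
pose T1 := fun q : borel V * borel W => a_ v * F1 q + s1 q.1 * u q ^+ 2.
pose T2 := fun q : borel V * borel W => a_ w * F2 q + s2 q.2 * u q ^+ 2.
pose U1 := fun q : borel V * borel W => s1 q.1 * u q ^+ 2.
pose U2 := fun q : borel V * borel W => s2 q.2 * u q ^+ 2.
have bT1 : bounded_measurable T1 by apply: bounded_measurableD => //; exact: bounded_measurableZ.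
have bT2 : bounded_measurable T2 by apply: bounded_measurableD => //; exact: bounded_measurableZ.
have av0 := a_gt0 (R := R) hv; have aw0 := a_gt0 (R := R) hw.
have k1 := ratio_le1 hv (leq_addr w v); have k2 := ratio_le1 hw (leq_addl v w).
rewrite -/am in k1 k2.
have r1 : 0 < am / a_ v by rewrite divr_gt0.
have r2 : 0 < am / a_ w by rewrite divr_gt0.
set N := (X in _ <= X).
(* Lowering the gradient coefficients of the slice energies [T1] and [T2] to [am] scales their
   curvature terms by the ratios as well; the last two summands restore what is missing, with
   coefficients non-negative by [ratio_le1]. *)
have NE : N = (am / a_ v * \int[m1]_x \int[m2]_y T1 (x, y) +
   am / a_ w * \int[m1]_x \int[m2]_y T2 (x, y)) +
   ((1 - am / a_ v) * \int[m1]_x \int[m2]_y U1 (x, y) +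
   (1 - am / a_ w) * \int[m1]_x \int[m2]_y U2 (x, y)).
  have b1 := bounded_measurableZ (am / a_ v) bT1; have b2 := bounded_measurableZ (am / a_ w) bT2.
  have b3 := bounded_measurableZ (1 - am / a_ v) bsu1.
  have b4 := bounded_measurableZ (1 - am / a_ w) bsu2.
  transitivity (\int[m1]_x \int[m2]_y ((am / a_ v * T1 (x, y) + am / a_ w * T2 (x, y)) +
      ((1 - am / a_ v) * U1 (x, y) + (1 - am / a_ w) * U2 (x, y)))).
    apply: Rintegral_eq1 => x; apply: Rintegral_eq1 => y; rewrite /T1 /T2 /U1 /U2 /F1 /F2 /= -/am.
    move: (grad_sq g _ _) (grad_sq h _ _) (s1 x) (s2 y) (u (x, y)) => G1 G2 t1 t2 t.
    by field; rewrite !gt_eqF.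
  apply: etrans (iterated_RintegralD m1 m2 (bounded_measurableD b1 b2) (bounded_measurableD b3 b4)) _.
  congr (_ + _).
    apply: etrans (iterated_RintegralD m1 m2 b1 b2) _.
    by congr (_ + _); [exact: iterated_RintegralZ bT1|exact: iterated_RintegralZ bT2].
  apply: etrans (iterated_RintegralD m1 m2 b3 b4) _.
  by congr (_ + _); [exact: iterated_RintegralZ bsu1|exact: iterated_RintegralZ bsu2].
(* [s1] is known to equal the positive constant [sb1] almost everywhere only, so the sign is
   obtained after integrating over each slice, by [yd_mean]. *)
have U1_ge0 : 0 <= \int[m1]_x \int[m2]_y U1 (x, y).
  rewrite (Rintegral_exchange m1 m2 bsu1); apply: bmRintegral_ge0 => y.
  rewrite /U1 /= (yd_mean Y1 (bounded_measurable_section2 y bu2)).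
  rewrite mulr_ge0// ?(ltW (yd_sbar_gt0 Y1))//.
  by apply: bmRintegral_ge0 => x; exact: sqr_ge0.
have U2_ge0 : 0 <= \int[m1]_x \int[m2]_y U2 (x, y).
  apply: bmRintegral_ge0 => x.
  rewrite /U2 /= (yd_mean Y2 (bounded_measurable_section x bu2)).
  rewrite mulr_ge0// ?(ltW (yd_sbar_gt0 Y2))//.
  by apply: bmRintegral_ge0 => y; exact: sqr_ge0.
(* [A] integrates over the second factor the squared [L^p] norms, [p = p_ v], of the slices in the
   first; [B] does the same with the factors exchanged and [p = p_ w]. *)
pose A := \int[m2]_y (\int[m1]_x (`|u (x, y)| `^ p_ v)) `^ (2 / p_ v).
pose B := \int[m1]_x (\int[m2]_y (`|u (x, y)| `^ p_ w)) `^ (2 / p_ w).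
have A0 : 0 <= A by apply: bmRintegral_ge0 => y; exact: powR_ge0.
have B0 : 0 <= B by apply: bmRintegral_ge0 => y; exact: powR_ge0.
have q1 : 0 <= 2 / p_ v :> R by rewrite divr_ge0 ?(ltW (p_gt0 hv)).
have q2 : 0 <= 2 / p_ w :> R by rewrite divr_ge0 ?(ltW (p_gt0 hw)).
have T1_ge : mu1 * A <= \int[m1]_x \int[m2]_y T1 (x, y).
  rewrite (Rintegral_exchange m1 m2 bT1).
  have bA : bounded_measurable (fun y : borel W => (\int[m1]_x (`|u (x, y)| `^ p_ v)) `^ (2 / p_ v)).
    apply: bounded_measurable_powR; first exact: q1.
      by move=> y; apply: bmRintegral_ge0 => x; exact: powR_ge0.
    exact: (bounded_measurable_Rintegral2 m1 m2 bpv).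
  rewrite -(bmRintegralZ m2 mu1 bA); apply: bmRintegral_le.
  - exact: bounded_measurableZ.
  - exact: (bounded_measurable_Rintegral2 m1 m2 bT1).
  - by move=> y; exact: (yd_ineq Y1 (smooth_section1 y su)).
have T2_ge : mu2 * B <= \int[m1]_x \int[m2]_y T2 (x, y).
  have bB : bounded_measurable (fun x : borel V => (\int[m2]_y (`|u (x, y)| `^ p_ w)) `^ (2 / p_ w)).
    apply: bounded_measurable_powR; first exact: q2.
      by move=> x; apply: bmRintegral_ge0 => y; exact: powR_ge0.
    exact: (bounded_measurable_Rintegral m1 m2 bpw).
  rewrite -(bmRintegralZ m1 mu2 bB); apply: bmRintegral_le.
  - exact: bounded_measurableZ.
  - exact: (bounded_measurable_Rintegral m1 m2 bT2).
  - by move=> x; exact: (yd_ineq Y2 (smooth_section2 x su)).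
have m10 := yd_mu_gt0 Y1; have m20 := yd_mu_gt0 Y2.
have XA : 0 <= am / a_ v * (mu1 * A) by rewrite mulr_ge0 ?(ltW r1)// mulr_ge0// ltW.
have XB : 0 <= am / a_ w * (mu2 * B) by rewrite mulr_ge0 ?(ltW r2)// mulr_ge0// ltW.
apply: (@le_trans _ _ (am / a_ v * (mu1 * A) + am / a_ w * (mu2 * B))); last first.
  rewrite NE -[leLHS]addr0; apply: lerD.
    exact: lerD (ler_wpM2l (ltW r1) T1_ge) (ler_wpM2l (ltW r2) T2_ge).
  have c1 : 0 <= 1 - am / a_ v by rewrite subr_ge0.
  have c2 : 0 <= 1 - am / a_ w by rewrite subr_ge0.
  exact: addr_ge0 (mulr_ge0 c1 U1_ge0) (mulr_ge0 c2 U2_ge0).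
(* After AM-GM, [eps_factor] leaves exactly the product of powers of [A] and [B] that
   [mixed_norm_interpolation] bounds from below. *)
apply: le_trans (weighted_amgm XA XB v0 w0).
rewrite -(eps_factor A0 B0); apply: (ler_wpM2l (mulr_ge0 (ltW eps_gt0) (ltW product_bound_gt0))).
have pE : p_ (v + w) = 2 * (v%:R + w%:R) / (v%:R + w%:R - 2) :> R by rewrite /p_ natrD.
rewrite natrD; exact: (@mixed_norm_interpolation R _ _ _ _ m1 m2 _ _ _ _ _
  (fun z : borel V * borel W => `|u z|) v2 w2 pE (erefl (p_ v)) (erefl (p_ w))
  (bounded_measurable_norm bu) (fun z => normr_ge0 (u z))).
Qed.

(** The hypothesis is the equality case of [weighted_amgm], so the test function 1 attains [K]. *)
Lemma yamabe_prod_upper : sb1 / v%:R = sb2 / w%:R ->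
  (yamabe_constant (prod_metric g h) <= K%:E)%E.
Proof.
move=> sbE; have s1_ := smooth_cst (M := VW) 1.
have -> : K = yamabe_quotient (prod_metric g h) (fun=> 1).
  rewrite yamabe_quotient_prod//.
  have G0 n (M : manifold R n) (k : tensor M) : riemannian_metric k -> grad_sq k (fun=> 1) = fun=> 0.
    move=> rk; have := grad_sq_affine 1 0 rk (smooth_cst (M := M) 1).
    under [X in grad_sq k X]eq_fun do rewrite mul0r addr0.
    by move=> ->; apply/funext => p; rewrite expr0n /= mul0r.
  have [vol1 v1E] : exists x, x = fine (m1 setT) by eexists.
  have [vol2 v2E] : exists x, x = fine (m2 setT) by eexists.
  have vol1_gt0 : 0 < vol1 by rewrite v1E; exact: yd_vol_gt0 Y1.
  have vol2_gt0 : 0 < vol2 by rewrite v2E; exact: yd_vol_gt0 Y2.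
  have I1 : \int[m1]_x s1 x = sb1 * vol1.
    have := yd_mean Y1 (bounded_measurable_cst 1).
    rewrite Rintegral_cst// mul1r -v1E => <-.
    by apply: Rintegral_eq1 => x; rewrite mulr1.
  have I2 : \int[m2]_x s2 x = sb2 * vol2.
    have := yd_mean Y2 (bounded_measurable_cst 1).
    rewrite Rintegral_cst// mul1r -v2E => <-.
    by apply: Rintegral_eq1 => x; rewrite mulr1.
  have bs1 : bounded_measurable s1 by apply: continuous_bounded_measurable cV _ _; exact: yd_continuous Y1.
  have bs2 : bounded_measurable s2 by apply: continuous_bounded_measurable cW _ _; exact: yd_continuous Y2.
  rewrite (Rintegral_eq1 m1 (g := fun x => \int[m2]_y (s1 x + s2 y))); last first.
    move=> x; apply: Rintegral_eq1 => y.
    by rewrite (G0 _ _ g)// (G0 _ _ h)// addr0 mulr0 add0r expr1n mulr1.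
  rewrite (Rintegral_eq1 m1 (g := fun x => vol2 * s1 x + sb2 * vol2)); last first.
    move=> x; rewrite (bmRintegralD m2 (bounded_measurable_cst (s1 x)) bs2) I2.
    by rewrite Rintegral_cst// -v2E mulrC.
  rewrite (bmRintegralD m1 (bounded_measurableZ vol2 bs1) (bounded_measurable_cst _)).
  rewrite (bmRintegralZ m1 _ bs1) I1 Rintegral_cst// -v1E.
  have -> : \int[m1]_x \int[m2]_y (`|1 : R| `^ p_ (v + w)) = vol1 * vol2.
    rewrite (Rintegral_eq1 m1 (g := fun x => vol2)).
      by rewrite Rintegral_cst// -v1E mulrC.
    by move=> x; rewrite normr1 powR1 Rintegral_cst// mul1r -v2E.
  (* In terms of the common ratio [sg] the numerator is [(v + w) * sg * (vol1 * vol2)]. Dividing by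
     the volume to the power [(v + w - 2) / (v + w)] leaves the power [2 / (v + w)] of each volume,
     which is what [K] contains. *)
  have [sg sgE] : exists x, x = sb1 / v%:R by eexists.
  have sg0 : 0 < sg by rewrite sgE divr_gt0//; exact: yd_sbar_gt0 Y1.
  have sb1E : sb1 = sg * v%:R by rewrite sgE divfK// gt_eqF.
  have sb2E : sb2 = sg * w%:R by rewrite sgE sbE divfK// gt_eqF.
  have VW0 : 0 < v%:R + w%:R :> R by rewrite addr_gt0.
  rewrite /K (yd_mu Y1) (yd_mu Y2) -v1E -v2E sb1E sb2E natrD two_div_p// natrD.
  have -> : sg * v%:R * vol1 `^ (2 / v%:R) / v%:R = sg * vol1 `^ (2 / v%:R).
    by field; rewrite gt_eqF.
  have -> : sg * w%:R * vol2 `^ (2 / w%:R) / w%:R = sg * vol2 `^ (2 / w%:R).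
    by field; rewrite gt_eqF.
  rewrite !(powRM _ (ltW sg0)) ?powR_ge0// -!powRrM.
  have -> : 2 / v%:R * (v%:R / (v%:R + w%:R)) = 2 / (v%:R + w%:R) :> R.
    by field; rewrite !gt_eqF.
  have -> : 2 / w%:R * (w%:R / (v%:R + w%:R)) = 2 / (v%:R + w%:R) :> R.
    by field; rewrite !gt_eqF.
  have sgs : sg `^ (v%:R / (v%:R + w%:R)) * sg `^ (w%:R / (v%:R + w%:R)) = sg.
    rewrite -powRD ?(gt_eqF sg0) ?implybT// -mulrDl divff ?powRr1 ?(ltW sg0)//.
    by rewrite gt_eqF.
  have vv : (vol1 * vol2) `^ ((v%:R + w%:R - 2) / (v%:R + w%:R)) *
      (vol1 `^ (2 / (v%:R + w%:R)) * vol2 `^ (2 / (v%:R + w%:R))) = vol1 * vol2.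
    rewrite -powRM ?(ltW vol1_gt0) ?(ltW vol2_gt0)// -powRD; last first.
      by rewrite (gt_eqF (mulr_gt0 vol1_gt0 vol2_gt0)) implybT.
    rewrite -[RHS]powRr1 ?mulr_ge0 ?(ltW vol1_gt0) ?(ltW vol2_gt0)//; congr (_ `^ _).
    by field; rewrite gt_eqF.
  have P0 : (vol1 * vol2) `^ ((v%:R + w%:R - 2) / (v%:R + w%:R)) != 0.
    by rewrite gt_eqF// powR_gt0// mulr_gt0.
  apply: (mulIf P0); rewrite divfK//.
  rewrite (_ : vol2 * (sg * v%:R * vol1) + sg * w%:R * vol2 * vol1 =
    (v%:R + w%:R) * sg * (vol1 * vol2)); last by ring.
  rewrite -[in RHS]vv -[in RHS]sgs.
  by move: (powR _ _) (powR _ _) (powR _ _) (powR _ _) (powR _ _) => *; ring.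
apply: ereal_inf_lbound; exists (fun=> 1) => //; split=> //.
  exact: (subclosed_compact (@closed_closure _ _) compact_prod_manifold).
by exists point; rewrite oner_eq0.
Qed.

Lemma yamabe_prod_lower_inf : ((eps_ R v w * K)%:E <= yamabe_constant (prod_metric g h))%E.
Proof.
apply: le_ereal_inf_tmp => _ [u [su _ nu] <-].
by rewrite lee_fin; exact: yamabe_prod_lower.
Qed.

End product_bounds.

(** * The infimum over all lambda *)

Theorem mainTheorem2 (R : realType) (v w : nat) (hv : (3 <= v)%N) (hw : (3 <= w)%N)
    (V : manifold R v) (W : manifold R w)
    (cV : compact [set: V]) (cW : compact [set: W])
    (g : tensor V) (h : tensor W)
    (yg : yamabe_metric g) (yh : yamabe_metric h)
    (mug : (0 < yamabe_constant g)%E) (muh : (0 < yamabe_constant h)%E) :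
  ((eps_ R v w)%:E <=
   ereal_inf [set yamabe_constant (prod_metric g (scale_metric lam h))
               | lam in [set lam : R | (0 < lam)%R]]
   / ((v + w)%:R%:E
      * (yamabe_constant g / v%:R%:E) `^ (v%:R / (v + w)%:R)
      * (yamabe_constant h / w%:R%:E) `^ (w%:R / (v + w)%:R))
   <= 1)%E.
Proof.
have [m1 [s1 [mu1 [sb1 [Y1 mu1E]]]]] := yamabe_data_of hv cV yg mug.
have [m2 [s2 [mu2 [sb2 [Y2 mu2E]]]]] := yamabe_data_of hw cW yh muh.
have v0 : 0 < v%:R :> R by rewrite ltr0n (leq_trans _ hv).
have w0 : 0 < w%:R :> R by rewrite ltr0n (leq_trans _ hw).
have sb10 := yd_sbar_gt0 Y1; have sb20 := yd_sbar_gt0 Y2.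
have K0 := product_bound_gt0 hv hw Y1 Y2.
set I := ereal_inf _.
have lower : ((eps_ R v w * ((v + w)%:R * (mu1 / v%:R) `^ (v%:R / (v + w)%:R) *
    (mu2 / w%:R) `^ (w%:R / (v + w)%:R)))%:E <= I)%E.
  apply: le_ereal_inf_tmp => _ [lam lam0 <-].
  have [m Y] := yamabe_data_scale hw cW lam0 Y2.
  exact: (yamabe_prod_lower_inf hv hw cV cW Y1 Y).
have upper : (I <= ((v + w)%:R * (mu1 / v%:R) `^ (v%:R / (v + w)%:R) *
    (mu2 / w%:R) `^ (w%:R / (v + w)%:R))%:E)%E.
  (* Solves [lam^-1 * sb2 / w = sb1 / v], the hypothesis of [yamabe_prod_upper] for the scaled
     metric. *)
  pose lam := v%:R * sb2 / (w%:R * sb1).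
  have lam0 : 0 < lam by rewrite divr_gt0 ?mulr_gt0.
  have [m Y] := yamabe_data_scale hw cW lam0 Y2.
  apply: (@le_trans _ _ (yamabe_constant (prod_metric g (scale_metric lam h)))).
    by apply: ereal_inf_lbound; exists lam.
  apply: (yamabe_prod_upper hv hw cV cW Y1 Y).
  by rewrite /lam; field; rewrite !gt_eqF.
(* The Yamabe constants are now real and the denominators nonzero, so the extended-real inverses
   become real ones. *)
rewrite mu1E mu2E !inver !gt_eqF // -!EFinM.
rewrite inver gt_eqF//.
by rewrite lee_pdivlMr// lee_pdivrMr// mul1e -EFinM; apply/andP.
Qed.
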